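(* Let $K$ be a field of characteristic $p\ge 0$ and let $S$ be a finite semigroup. Then the following are equivalent for an integer $k\ge 0$. (1) $S$ has a faithful completely reducible representation over $K$ with $k$ irreducible constituents. (2) $S$ has a faithful completely reducible representation over $K$ and there is a $KS$-module with $k$ simple composition factors affording a faithful representation of $S$. (3) The congruence $\equiv_{\mathsf{GGM}}$ is trivial (the equality relation), $p\nmid |A(G_J)\cap N_J|$ for each irreducible regular $\mathscr J$-class $J$ of $S$, and $k\ge \sum_{J} k_J$, the sum being over all regular $\mathscr J$-classes $J$ of $S$, where: $k_J=0$ if $J$ is reducible; $k_J=1$ if $J$ is irreducible and $N_J=\{e_J\}$; and otherwise $k_J$ is the minimal number of generators of $S(G_J)\cap N_J$ as a normal subgroup of $G_J$.
   Context: Semigroup notation. For a semigroup $S$, $S^1$ is the monoid obtained by adjoining an identity. Write $s\mathrel{\mathscr J}t$ if $S^1sS^1=S^1tS^1$; the equivalence classes are the $\mathscr J$-classes. They are partially ordered by $J\le J'$ if $J\subseteq S^1J'S^1$. A $\mathscr J$-class is regular if it contains an idempotent. For each regular $\mathscr J$-class $J$ fix an idempotent $e_J\in J$ and let $G_J$ be the group of units of the monoid $e_JSe_J$ (a finite group with identity $e_J$, independent of the choice of $e_J$ up to isomorphism). Congruences. For a regular $\mathscr J$-class $J$, $\equiv_J$ is the congruence on $S$ defined by: $s\equiv_J t$ if for all $x,y\in J$ one has $xsy\in J\iff xty\in J$, and if $xsy,xty\in J$ then $xsy=xty$. $\equiv_{\mathsf{GGM}}$ is the intersection of the congruences $\equiv_J$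 over all regular $\mathscr J$-classes $J$. A regular $\mathscr J$-class $J$ is reducible if $\bigcap_{J'}{\equiv_{J'}}\subseteq{\equiv_J}$, where $J'$ runs over the regular $\mathscr J$-classes with $J'<J$ (an empty intersection being the universal relation $S\times S$); otherwise $J$ is irreducible. For $J$ irreducible and regular, $N_J=\{g\in G_J : g\equiv_{J'}e_J \text{ for all regular } \mathscr J\text{-classes } J'<J\}$, a normal subgroup of $G_J$. Group notation. For a finite group $G$, a minimal normal subgroup is a minimal nontrivial normal subgroup; $A(G)$ is the subgroup generated by all abelian minimal normal subgroups of $G$, and the socle $S(G)$ is the subgroup generated by all minimal normal subgroups of $G$. A normal subgroup of $G$ is generated by a set $X$ as a normal subgroup if it is the normal closure of $X$ in $G$. The characteristic $0$ divides no positive integer. Representations. A $KS$-module is a $K$-vector space with an action of $S$ by $K$-linear maps (extended linearly to the semigroup algebra $KS$); modules affording matrix representations are finite dimensional. A $KS$-module $V$ is simple if $KS\cdot V\ne 0$ and its only submodules are $0$ and $V$; it is semisimple if isomorphic to a direct sum of simple modules (the zero module is semisimple but not simple), and the simple summands, counted with multiplicity, are its irreducible constituents. A completely reducible representation is one afforded by a semisimple module. A representation of $S$ is faithful if it is an injective homomorphism on $S$; the zero module affords the degree $0$ representation, which is a faithful representation of both the trivial and the empty semigroup. A composition series of a module is an unrefinable series of submodules; its factors are either simple or null (one-dimensional $W$ with $KS\cdot W=0$); in (2) only the simple (non-null) composition factors are counted, with multiplicity.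
   Formalization: For the empty semigroup only k = 0 is considered: when S is empty and k ≥ 1 there is no simple KS-module, so (1) and (2) fail while (3) holds vacuously, and the equivalence as stated is false. *)

(* Defs.v *)
From HB Require Import structures.
From mathcomp Require Import all_boot all_fingroup all_algebra all_solvable.

Set Implicit Arguments.
Unset Strict Implicit.
Unset Printing Implicit Defensive.

(* MathComp's semigroupType has no join with finType, and {set S} is only
   usable over a finType, hence this bundle. The carrier may be empty. *)
Record finSemigroup := FinSemigroup {
  carrier :> finType;
  smul : carrier -> carrier -> carrier;
  smulA : associative smul
}.

Notation "s ** t" := (smul s t) (at level 40, left associativity).

Section JClasses.
Variable S : finSemigroup.
Implicit Types (s t x y : S) (I J : {set S}).

(* Multiplication by an element of S^1 = option S, None being the identity. *)
Definition lmul1 (x : option S) s : S := if x is Some y then y ** s else s.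
Definition rmul1 s (x : option S) : S := if x is Some y then s ** y else s.

(* S^1 J S^1 *)
Definition ideal1 J : {set S} :=
  \bigcup_(s in J) [set rmul1 (lmul1 x s) y | x : option S, y : option S].

Definition Jrel s t : bool := ideal1 [set s] == ideal1 [set t].

Definition Jclass s : {set S} := [set t | Jrel s t].

Definition regular_Jclass J : bool :=
  (J \in [set Jclass s | s : S]) && [exists e in J, e ** e == e].

Definition regJ := {J : {set S} | regular_Jclass J}.

Definition idem_elt := {e : S | e ** e == e}.

Definition Jlt (I J : regJ) : bool :=
  (val I \subset ideal1 (val J)) && (I != J).

Definition congJ (J : regJ) s t : bool :=
  [forall x in val J, forall y in val J,
     ((x ** s ** y \in val J) == (x ** t ** y \in val J)) &&
     ((x ** s ** y \in val J) && (x ** t ** y \in val J) ==>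
        (x ** s ** y == x ** t ** y))].

Definition congGGM s t : bool := [forall J : regJ, congJ J s t].

Definition cong_below (J : regJ) s t : bool :=
  [forall I : regJ, Jlt I J ==> congJ I s t].

Definition reducible (J : regJ) : bool :=
  [forall s, forall t, cong_below J s t ==> congJ J s t].

(* The monoid e S e and its group of units *)
Definition local_monoid (e : S) : {set S} := [set e ** x ** e | x : S].

Definition local_units (e : S) : {set S} :=
  [set s in local_monoid e |
    [exists t in local_monoid e, (s ** t == e) && (t ** s == e)]].

Record unit_group (e : idem_elt) : predArgType := UnitElt {
  unit_elt : S;
  unit_eltP : unit_elt \in local_units (val e)
}.

End JClasses.

HB.instance Definition _ (S : finSemigroup) (e : idem_elt S) :=
  [isSub for @unit_elt S e].
HB.instance Definition _ (S : finSemigroup) (e : idem_elt S) :=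
  [Finite of unit_group e by <:].

Section UnitGroup.
Variables (S : finSemigroup) (e : idem_elt S).
Let f : S := val e.

Let ff : f ** f = f. Proof. exact/eqP/(valP e). Qed.

Lemma local_monoidP s :
  reflect (f ** s = s /\ s ** f = s) (s \in local_monoid f).
Proof.
apply: (iffP imsetP) => [[x _ ->] | [fs sf]].
  by split; [rewrite !smulA ff | rewrite -smulA ff].
by exists s => //; rewrite fs sf.
Qed.

Lemma local_unitsP s :
  reflect [/\ f ** s = s, s ** f = s &
             exists t, [/\ f ** t = t, t ** f = t, s ** t = f & t ** s = f]]
          (s \in local_units f).
Proof.
rewrite inE; apply: (iffP andP).
  case=> /local_monoidP[fs sf] /exists_inP[t /local_monoidP[ft tf]].
  by case/andP=> /eqP st /eqP ts; split=> //; exists t.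
case=> fs sf [t [ft tf st ts]]; split; first exact/local_monoidP.
by apply/exists_inP; exists t; [exact/local_monoidP | rewrite st ts eqxx].
Qed.

Lemma unit_one_proof : f \in local_units f.
Proof. by apply/local_unitsP; split=> //; exists f. Qed.

Lemma unit_mul_proof (a b : unit_group e) : val a ** val b \in local_units f.
Proof.
case/local_unitsP: (valP a) => fa af [a' [fa' a'f aa' a'a]].
case/local_unitsP: (valP b) => fb bf [b' [fb' b'f bb' b'b]].
apply/local_unitsP; split; [by rewrite smulA fa | by rewrite -smulA bf |].
exists (b' ** a'); split; [by rewrite smulA fb' | by rewrite -smulA a'f | |].
  by rewrite smulA -(smulA (val a)) bb' af aa'.
by rewrite smulA -(smulA b') a'a b'f b'b.
Qed.

Lemma unit_inv_subproof (a : unit_group e) :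
  exists t, (t \in local_units f) && (t ** val a == f).
Proof.
case/local_unitsP: (valP a) => fa af [t [ft tf at_ ta]].
exists t; rewrite ta eqxx andbT; apply/local_unitsP; split=> //.
by exists (val a).
Qed.

Lemma unit_inv_proof (a : unit_group e) :
  xchoose (unit_inv_subproof a) \in local_units f.
Proof. by case/andP: (xchooseP (unit_inv_subproof a)). Qed.

Definition unit_one : unit_group e := UnitElt unit_one_proof.
Definition unit_mul (a b : unit_group e) : unit_group e :=
  UnitElt (unit_mul_proof a b).
Definition unit_inv (a : unit_group e) : unit_group e :=
  UnitElt (unit_inv_proof a).

Lemma unit_mulA : associative unit_mul.
Proof. by move=> a b c; apply: val_inj; rewrite /= smulA. Qed.

Lemma unit_mul1 : left_id unit_one unit_mul.
Proof. by move=> a; apply: val_inj; case/local_unitsP: (valP a). Qed.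

Lemma unit_mulV : left_inverse unit_one unit_inv unit_mul.
Proof.
move=> a; apply: val_inj => /=.
by case/andP: (xchooseP (unit_inv_subproof a)) => _ /eqP.
Qed.

HB.instance Definition _ :=
  Finite_isGroup.Build (unit_group e) unit_mulA unit_mul1 unit_mulV.

End UnitGroup.

Section GroupNotions.
Variables (gT : finGroupType) (G : {group gT}).
Local Open Scope group_scope.

Definition is_min_normal (M : {group gT}) : bool :=
  (M \subset G) && minnormal M G.

(* A(G) *)
Definition abelian_socle : {group gT} :=
  <<\bigcup_(M : {group gT} | is_min_normal M && abelian M) M>>%G.

(* S(G) *)
Definition normal_socle : {group gT} :=
  <<\bigcup_(M : {group gT} | is_min_normal M) M>>%G.

Definition normal_closure (X : {set gT}) : {set gT} := <<class_support X G>>.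

(* Minimal size of a set X with normal closure A. The default value A of the
   arg min is itself such a set whenever A is a normal subgroup of G. *)
Definition min_normal_gens (A : {set gT}) : nat :=
  #|[arg min_(X < A | normal_closure X == A) #|X|]|.

End GroupNotions.

Section Invariants.
Variables (S : finSemigroup) (e : regJ S -> idem_elt S) (J : regJ S).

Definition maxsubgroup : {group unit_group (e J)} :=
  [set: unit_group (e J)]%G.

Definition NJ : {set unit_group (e J)} :=
  [set g | cong_below J (val g) (val (e J))].

Definition kJ : nat :=
  if reducible J then 0
  else if NJ == 1%g then 1
  else min_normal_gens maxsubgroup (normal_socle maxsubgroup :&: NJ).

End Invariants.

Section Modules.
Variables (K : fieldType) (S : finSemigroup) (V : vectType K).
Variable act : S -> 'End(V).
Implicit Types U W X : {vspace V}.
Local Open Scope ring_scope.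

Definition is_module : Prop := forall s t, act (s ** t) = (act s \o act t)%VF.

Definition submodule W : Prop := forall s, (act s @: W <= W)%VS.

(* KS . W *)
Definition KSmul W : {vspace V} := (\sum_(s : S) act s @: W)%VS.

Definition simple_submodule W : Prop :=
  [/\ submodule W, KSmul W != 0%VS &
      forall X, submodule X -> (X <= W)%VS -> X = 0%VS \/ X = W].

(* V is the direct sum of k simple submodules *)
Definition semisimple (k : nat) : Prop :=
  exists W : 'I_k -> {vspace V},
    [/\ forall i, simple_submodule (W i),
        (\sum_i W i)%VS = fullv & directv (\sum_i W i)%VS].

(* 0 = c 0 < c 1 < ... < c n = V; the values of c beyond n are irrelevant. *)
Definition composition_series (n : nat) (c : nat -> {vspace V}) : Prop :=
  [/\ c 0%N = 0%VS, c n = fullv,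
      forall i, (i <= n)%N -> submodule (c i) &
      forall i, (i < n)%N ->
        [/\ (c i <= c i.+1)%VS, c i <> c i.+1 &
            forall X, submodule X -> (c i <= X)%VS -> (X <= c i.+1)%VS ->
              X = c i \/ X = c i.+1]].

(* The factor c i.+1 / c i is null, i.e. annihilated by KS, exactly when
   KS . c i.+1 is contained in c i; the other factors are the simple ones. *)
Definition nb_simple_factors (n : nat) (c : nat -> {vspace V}) : nat :=
  #|[set i : 'I_n | ~~ (KSmul (c i.+1) <= c i)%VS]|.

End Modules.

Definition has_faithful_semisimple (K : fieldType) (S : finSemigroup)
    (k : nat) : Prop :=
  exists (V : vectType K) (act : S -> 'End(V)),
    [/\ is_module act, injective act & semisimple act k].

Definition has_faithful_with_simple_factors (K : fieldType) (S : finSemigroup)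
    (k : nat) : Prop :=
  exists (V : vectType K) (act : S -> 'End(V)),
    [/\ is_module act, injective act &
        exists (n : nat) (c : nat -> {vspace V}),
          composition_series act n c /\ nb_simple_factors act n c = k].

(* p is the characteristic of K; 0 %| n holds only for n = 0. *)
Definition has_char (K : fieldType) (p : nat) : Prop :=
  if p == 0 then [pchar K]%R =i pred0 else p \in [pchar K]%R.

(* Main.v *)
(* A simple KS-module has an apex: the regular J-class J that is minimal among
   those not annihilating it. On it S acts through congJ J, and its image under
   e_J is a simple K G_J-module.

   Necessity. Let J be irreducible and consider the simple factors with apex J.
   An element of N_J that acts trivially on them acts trivially on every factor,
   hence unipotently on a faithful module; such elements form a normal p-subgroup,
   which is trivial because p does not divide the order of A(G_J) :&: N_J. So
   these factors separate the minimal normal subgroups of G_J contained in N_J.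
   An abelian group acting on a simple module has a nonzero vector fixed by a
   subgroup with cyclic quotient, i.e. by the kernel of a linear character; thus m
   factors yield m linear characters of the abelian part of the socle whose kernels
   have no common nontrivial normal subgroup of G_J. Duality turns them into m
   normal generators, and one of these can be multiplied by an element that
   generates the nonabelian part.

   Sufficiency. Conversely m generators give m such characters lam. For each lam
   the product E of the idempotents avg D - avg Q, where (D, Q) runs through
   (ker lam :&: Q, Q) for elementary abelian subgroups Q of the socle, one for each
   prime, and through (1, P_M) with P_M <= M of order prime to p, one for each
   nonabelian minimal normal M, is nonzero on the module with basis J. So E is
   nonzero on some simple factor of that module, and a minimal normal subgroup
   acting trivially on that factor is abelian and contained in ker lam. *)
From HB Require Import structures.
From Stdlib Require Import Classical_Prop.
Require Import Defs.
From mathcomp Require Import all_boot all_fingroup all_algebra all_solvable.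
From mathcomp Require Import all_field all_character zify.

Set Implicit Arguments.
Unset Strict Implicit.
Unset Printing Implicit Defensive.

(** * Finite semigroups *)

(** The order of G_J may be divisible by p, and K need not be algebraically closed. Idempotents deal
    with the first point: an idempotent that lowers every step of a filtration is zero, so
    triviality on the factors of a faithful module can be lifted back, and conversely a nonzero
    idempotent survives on some factor. As for K, a simple factor is remembered only through a
    subgroup D with cyclic quotient, which is encoded by a character with values in [algC].

    Attention can be confined to N_J because of the stability of finite semigroups: it reduces
    [congJ] to the local monoid at e_J, whose elements in J are its units. Factors with another apex
    do not see N_J: either that apex lies below J, where N_J is congruent to the identity, or e_J
    annihilates the factor.

    Duality is obtained by counting equivariant homomorphisms, without forming a dual module: the
    two counts agree because both are multiplicative over independent minimal normal subgroups. *)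

Section FiniteSemigroups.
Variable S : finSemigroup.
Implicit Types (s t u v x y e f : S) (l r : option S) (J : regJ S).

Lemma rmul1A s t r : s ** rmul1 t r = rmul1 (s ** t) r.
Proof. by case: r => //= z; rewrite smulA. Qed.

Lemma lmul1A l s t : lmul1 l s ** t = lmul1 l (s ** t).
Proof. by case: l => //= z; rewrite smulA. Qed.

Lemma lrmul1 l s r : lmul1 l (rmul1 s r) = rmul1 (lmul1 l s) r.
Proof. by case: l => //= z; rewrite rmul1A. Qed.

Lemma rmul1_lmul1 s r t : rmul1 s r ** t = s ** lmul1 r t.
Proof. by case: r => //= z; rewrite smulA. Qed.

Definition mul1 (x y : option S) : option S :=
  if x is Some s then Some (rmul1 s y) else y.

Lemma lmul1M l r s : lmul1 l (lmul1 r s) = lmul1 (mul1 l r) s.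
Proof. by case: l r => [x|] [y|] //=; rewrite smulA. Qed.

Lemma rmul1M l r s : rmul1 (rmul1 s l) r = rmul1 s (mul1 l r).
Proof. by case: l r => [x|] [y|] //=; rewrite smulA. Qed.

(** Divisibility reverses the J-order: multiples of s lie J-below s. *)
Definition divs s t : bool := [exists l, exists r, t == rmul1 (lmul1 l s) r].

Lemma divsP s t : reflect (exists l r, t = rmul1 (lmul1 l s) r) (divs s t).
Proof.
apply: (iffP existsP) => [[x /existsP[y /eqP ->]] | [x [y ->]]]; first by exists x, y.
by exists x; apply/existsP; exists y.
Qed.

Lemma divs_refl s : divs s s.
Proof. by apply/divsP; exists None, None. Qed.

Lemma divs_trans s t u : divs s t -> divs t u -> divs s u.
Proof.
move=> /divsP[x [y ->]] /divsP[x' [y' ->]]; apply/divsP.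
exists (mul1 x' x), (mul1 y y').
by rewrite lrmul1 lmul1M rmul1M.
Qed.

Lemma divs_lmul1 l s : divs s (lmul1 l s).
Proof. by apply/divsP; exists l, None. Qed.

Lemma divs_rmul1 s r : divs s (rmul1 s r).
Proof. by apply/divsP; exists None, r. Qed.

Lemma divs_mull s t : divs t (s ** t).
Proof. exact: (divs_lmul1 (Some s)). Qed.

Lemma divs_mulr s t : divs s (s ** t).
Proof. exact: (divs_rmul1 s (Some t)). Qed.

Lemma ideal1P (A : {set S}) t : reflect (exists2 s, s \in A & divs s t) (t \in ideal1 A).
Proof.
apply: (iffP bigcupP) => [[s sA /imset2P[x y _ _ ->]] | [s sA /divsP[x [y ->]]]].
  by exists s => //; apply/divsP; exists x, y.
by exists s => //; apply/imset2P; exists x y.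
Qed.

Lemma ideal1_set1 s t : (t \in ideal1 [set s]) = divs s t.
Proof.
apply/ideal1P/idP => [[u /set1P ->] //|]; by exists s; rewrite ?inE.
Qed.

Lemma JrelE s t : Jrel s t = divs s t && divs t s.
Proof.
apply/eqP/andP => [E | [st ts]].
  by rewrite -!ideal1_set1 E ideal1_set1 divs_refl -E ideal1_set1 divs_refl.
by apply/setP=> u; rewrite !ideal1_set1; apply/idP/idP; apply: divs_trans.
Qed.

Lemma mem_Jclass s t : (t \in Jclass s) = divs s t && divs t s.
Proof. by rewrite inE JrelE. Qed.

Lemma Jclass_eq s t : t \in Jclass s -> Jclass s = Jclass t.
Proof. by rewrite inE => /eqP E; apply/setP=> u; rewrite !inE /Jrel E. Qed.

Lemma regJ_mem J s : s \in val J -> val J = Jclass s.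
Proof. by case/andP: (valP J) => /imsetP[t _ ->] _; apply: Jclass_eq. Qed.

Lemma ideal1_regJ J s t : s \in val J -> (t \in ideal1 (val J)) = divs s t.
Proof.
move=> sJ; apply/ideal1P/idP => [[u] | st]; last by exists s.
by rewrite (regJ_mem sJ) mem_Jclass => /andP[su _]; apply: divs_trans.
Qed.

Lemma mem_regJ J s t : s \in val J -> (t \in val J) = divs s t && divs t s.
Proof. by move=> sJ; rewrite (regJ_mem sJ) mem_Jclass. Qed.

Lemma regJ_ideal J s t : s \in val J -> divs s t -> divs t s -> t \in val J.
Proof. by move=> sJ st ts; rewrite (mem_regJ _ sJ) st. Qed.

Lemma regJ_eq (I J : regJ S) s : s \in val I -> s \in val J -> I = J.
Proof. by move=> sI sJ; apply: val_inj; rewrite (regJ_mem sI) (regJ_mem sJ). Qed.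

Lemma Jlt_divs (I J : regJ S) s t : s \in val I -> t \in val J ->
  Jlt I J = divs t s && ~~ divs s t.
Proof.
move=> sI tJ; apply/andP/andP => [[/subsetP IJ neq] | [ts nst]].
  have ts : divs t s by rewrite -(ideal1_regJ _ tJ); apply: IJ.
  split=> //; apply: contra neq => st; apply/eqP/(regJ_eq sI).
  by rewrite (mem_regJ _ tJ) ts.
split; last by apply: contraNneq nst => E; move: tJ; rewrite -E (mem_regJ _ sI) => /andP[].
apply/subsetP=> u; rewrite (mem_regJ _ sI) (ideal1_regJ _ tJ) => /andP[su _].
exact: divs_trans su.
Qed.

Lemma regJ_nonempty J : exists s, s \in val J.
Proof. by case/andP: (valP J) => _ /exists_inP[s sJ _]; exists s. Qed.

Lemma Jlt_trans : transitive (@Jlt S).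
Proof.
move=> J I L; have [i iI] := regJ_nonempty I; have [j jJ] := regJ_nonempty J.
move=> IJ JL; have [l lL] := regJ_nonempty L; move: IJ JL.
rewrite (Jlt_divs iI jJ) (Jlt_divs jJ lL) (Jlt_divs iI lL) => /andP[ji nij] /andP[lj njl].
by rewrite (divs_trans lj ji); apply: contra nij => il; apply: divs_trans lj.
Qed.

Lemma Jlt_irr : irreflexive (@Jlt S).
Proof. by move=> J; rewrite /Jlt eqxx andbF. Qed.

Lemma Jlt_ind (P : regJ S -> Prop) :
  (forall J, (forall I, Jlt I J -> P I) -> P J) -> forall J, P J.
Proof.
move=> IH J; have [n] := ubnP #|[pred I | Jlt I J]|.
elim: n J => // n IHn J le_n; apply: IH => I IJ; apply: IHn.
rewrite -ltnS; apply: leq_trans le_n; rewrite ltnS; apply/proper_card/properP; split.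
  by apply/subsetP=> L; rewrite !inE => LI; apply: Jlt_trans IJ.
by exists I; rewrite inE ?Jlt_irr.
Qed.

(* s to the power n.+1 *)
Definition spow s n := iter n (smul s) s.

Lemma spowS s n : spow s n.+1 = s ** spow s n.
Proof. by []. Qed.

Lemma spowD s m n : spow s m ** spow s n = spow s (m + n).+1.
Proof. by elim: m => [|m IH] //; rewrite spowS -smulA IH addSn spowS. Qed.

Lemma idem_pow s : exists n, spow s n ** spow s n = spow s n.
Proof.
have [i [d E]] : exists i d, spow s (i + d.+1) = spow s i.
  have /injectivePn[x [y]] : ~~ injectiveb (fun n : 'I_#|S|.+1 => spow s n).
    by apply: contraTN isT => /injectiveP/leq_card; rewrite card_ord ltnn.
  wlog ltxy : x y / x < y => [W | _ E].
    case: (ltngtP x y) => [||/val_inj->]; [exact: W | rewrite eq_sym =>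
      lt ne E | by rewrite eqxx].
    by apply: (W y x).
  by exists x, (y - x).-1; rewrite prednK ?subn_gt0 // subnKC // ltnW.
have E1 j : spow s (i + j + d.+1) = spow s (i + j).
  elim: j => [|j IH]; first by rewrite addn0.
  have -> : i + j.+1 + d.+1 = (i + j + d.+1).+1 by lia.
  by rewrite (addnS i j) !spowS IH.
have E2 j q : spow s (i + j + q * d.+1) = spow s (i + j).
  elim: q => [|q IH]; first by rewrite addn0.
  have -> : i + j + q.+1 * d.+1 = i + (j + q * d.+1) + d.+1 by lia.
  by rewrite E1 addnA IH.
(* As [spow s n] has exponent n + 1, this choice gives exponent (i + 1)(d + 1), a multiple of the
   period that is past the preperiod. *)
exists (i + (i * d + d)); by rewrite spowD -[RHS](E2 _ i.+1); congr spow; lia.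
Qed.

End FiniteSemigroups.

(** * Stability and local monoids *)

Section LocalMonoids.
Variable S : finSemigroup.
Implicit Types (s t u v x y f : S) (l r : option S) (J : regJ S).

Lemma spowSr s n : spow s n.+1 = spow s n ** s.
Proof. by elim: n => [|n IH] //; rewrite spowS [in LHS]IH smulA. Qed.

(** In a finite monoid a one-sided inverse is two-sided: some power of u is idempotent, and a right
    invertible idempotent is the identity f. *)
Lemma local_mulV f u v : f ** f = f -> f ** u = u -> f ** v = v ->
  u ** f = u -> v ** f = v -> u ** v = f -> v ** u = f.
Proof.
move=> ff fu fv uf vf uv; have [n idn] := idem_pow u.
have fspow k : f ** spow v k = spow v k.
  by case: k => [|k] //; rewrite spowS smulA fv.
have uvn k : spow u k ** spow v k = f.
  elim: k => [|k IH] //.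
  by rewrite spowSr spowS -smulA (smulA u) uv fspow.
have un : spow u n = f.
  have spowf : spow u n ** f = spow u n.
    by case: {+}n => [|k] //; rewrite spowSr -smulA uf.
  by rewrite -[LHS]spowf -(uvn n) smulA idn.
have un2 : spow u (n + n) ** u = f by rewrite -spowSr -spowD un.
by rewrite -[v]fv -un2 -(smulA _ u v) uv -smulA fu un2.
Qed.

(** If f = l s r, the outer factors can be compressed into the local monoid, giving P s Q = f.
    One-sided inverses being two-sided there, Q P inverts s on both sides. *)
Lemma local_unitsE J f s : f ** f = f -> f \in val J ->
  (s \in local_units f) = (s \in local_monoid f) && (s \in val J).
Proof.
move=> ff fJ; rewrite inE; apply: andb_id2l => sM.
have /imsetP[x _ sE] := sM.
have fs : f ** s = s by rewrite sE !smulA ff.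
have sf : s ** f = s by rewrite sE -!smulA ff.
apply/exists_inP/idP => [[t _ /andP[/eqP st _]] | sJ].
  by apply: (regJ_ideal fJ); [rewrite -fs divs_mulr | rewrite -st divs_mulr].
move: sJ; rewrite (mem_regJ _ fJ) => /andP[_ /divsP[l [r fE]]].
pose P := f ** lmul1 l f; pose Q := rmul1 f r ** f.
have fP : f ** P = P by rewrite /P smulA ff.
have Pf : P ** f = P by rewrite /P -smulA lmul1A ff.
have fQ : f ** Q = Q by rewrite /Q smulA rmul1A ff.
have Qf : Q ** f = Q by rewrite /Q -smulA ff.
have PsQ : P ** s ** Q = f.
  rewrite /P /Q -(smulA f) lmul1A fs -(smulA f) lmul1A smulA.
  by rewrite rmul1A sf -lmul1A lrmul1 -fE ff ff.
clearbody P Q.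
have sQP : s ** Q ** P = f.
  apply: (local_mulV ff fP _ Pf); rewrite ?smulA ?fs //.
  by rewrite -!smulA Qf.
have QPs : Q ** (P ** s) = f.
  apply: (local_mulV ff _ fQ _ Qf); rewrite ?smulA ?fP //.
  by rewrite -!smulA sf.
exists (Q ** P); last by rewrite smulA sQP -smulA QPs eqxx.
by apply/imsetP; exists (Q ** P) => //; rewrite smulA fQ -smulA Pf.
Qed.

Lemma idem_factor f l r : f ** f = f -> f = rmul1 (lmul1 l f) r ->
  (exists u, u ** lmul1 l f = f) /\ (exists u, rmul1 f r ** u = f).
Proof.
move=> ff fE; pose P := f ** lmul1 l f; pose Q := rmul1 f r ** f.
have PQ : P ** Q = f.
  by rewrite /P /Q -(smulA f) lmul1A smulA rmul1A ff -lmul1A lrmul1 -fE ff ff.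
have QP : Q ** P = f.
  apply: (local_mulV ff _ _ _ _ PQ); rewrite /P /Q ?smulA ?rmul1A ?ff //.
    by rewrite -smulA lmul1A ff.
  by rewrite -!smulA ff.
by split; [exists (Q ** f); rewrite -smulA | exists (f ** P); rewrite smulA].
Qed.

(** Stability: multiplying a product in J back to f gives a factorisation of f through itself, to
    which [idem_factor] applies. *)
Lemma regJ_stable J f l r : f ** f = f -> f \in val J ->
  rmul1 (lmul1 l f) r \in val J ->
  (exists u, u ** lmul1 l f = f) /\ (exists u, rmul1 f r ** u = f).
Proof.
move=> ff fJ; rewrite (mem_regJ _ fJ) => /andP[_ /divsP[l' [r' fE]]].
have [|[u uE] [v vE]] := idem_factor (l := mul1 l' l) (r := mul1 r r') ff.
  by rewrite -lmul1M -rmul1M -(lrmul1 l').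
split; first by exists (rmul1 u l'); rewrite rmul1_lmul1 lmul1M.
by exists (lmul1 r' v); rewrite -rmul1_lmul1 rmul1M.
Qed.

(** Write x = a f l and y = r f d. Stability supplies u undoing a and v undoing d, so passing from
    the global to the local product is reversible, uniformly in s. *)
Lemma sandwich J f x y : f ** f = f -> f \in val J -> x \in val J -> y \in val J ->
  exists (l r a d : option S) (u v : S), forall s,
    x ** s ** y = rmul1 (lmul1 a (f ** lmul1 l (rmul1 s r) ** f)) d /\
    f ** lmul1 l (rmul1 s r) ** f = u ** (x ** s ** y) ** v.
Proof.
move=> ff fJ xJ yJ.
have /andP[/divsP[a [l xE]] _] : divs f x && divs x f by rewrite -(mem_regJ _ fJ).
have /andP[/divsP[r [d yE]] _] : divs f y && divs y f by rewrite -(mem_regJ _ fJ).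
have [|[u ua] _] := regJ_stable (l := a) (r := l) ff fJ; first by rewrite -xE.
have [|_ [v dv]] := regJ_stable (l := r) (r := d) ff fJ; first by rewrite -yE.
have sE s : x ** s ** y = lmul1 a f ** lmul1 l (rmul1 s r) ** rmul1 f d.
  rewrite xE yE rmul1_lmul1 -smulA.
  by rewrite (lrmul1 l s r) -(smulA (lmul1 a f)) rmul1_lmul1 lrmul1.
exists l, r, a, d, u, v => s; rewrite sE; split.
  by rewrite -(lrmul1 a) -rmul1A -!lmul1A -smulA.
by rewrite -!smulA dv !smulA ua.
Qed.

End LocalMonoids.

(** * The congruences attached to regular J-classes *)

Section Congruences.
Variable S : finSemigroup.
Implicit Types (s t u v x y f : S) (l r : option S) (I J : regJ S).

Lemma congJP J s t :
  reflect (forall x y, x \in val J -> y \in val J ->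
             (x ** s ** y \in val J) = (x ** t ** y \in val J) /\
             (x ** s ** y \in val J -> x ** s ** y = x ** t ** y))
          (congJ J s t).
Proof.
apply: (iffP forall_inP) => [H x y xJ yJ | H x xJ].
  have /forall_inP/(_ y yJ)/andP[/eqP E H2] := H x xJ.
  by split=> // sJ; apply/eqP; move: H2; rewrite -E sJ.
apply/forall_inP=> y yJ; have [E H2] := H x y xJ yJ.
rewrite E eqxx /=; apply/implyP=> /andP[tJ _].
by rewrite H2 ?E.
Qed.

Lemma congJ_refl J s : congJ J s s.
Proof. exact/congJP. Qed.

Lemma congJ_sym J s t : congJ J s t -> congJ J t s.
Proof.
move=> /congJP H; apply/congJP=> x y xJ yJ; have [E H2] := H x y xJ yJ.
by split=> // tJ; rewrite H2 ?E.
Qed.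

Lemma congJ_trans J s t u : congJ J s t -> congJ J t u -> congJ J s u.
Proof.
move=> /congJP H /congJP H'; apply/congJP=> x y xJ yJ.
have [E H2] := H x y xJ yJ; have [E' H2'] := H' x y xJ yJ.
by split=> [|sJ]; [rewrite E | rewrite H2 // H2' // -E].
Qed.

Lemma regJ_mulr J x s y : x \in val J -> x ** s ** y \in val J -> x ** s \in val J.
Proof.
move=> xJ; rewrite (mem_regJ _ xJ) => /andP[_ d].
by apply: (regJ_ideal xJ); [apply: divs_mulr | apply: divs_trans d; apply: divs_mulr].
Qed.

Lemma regJ_mull J x s y : y \in val J -> x ** (s ** y) \in val J -> s ** y \in val J.
Proof.
move=> yJ; rewrite (mem_regJ _ yJ) => /andP[_ d].
by apply: (regJ_ideal yJ); [apply: divs_mull | apply: divs_trans d; apply: divs_mull].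
Qed.

(** Once x ** u has left J, no product through it returns to J, so both memberships are false. *)
Lemma congJ_mull J u s t : congJ J s t -> congJ J (u ** s) (u ** t).
Proof.
move=> /congJP H; apply/congJP=> x y xJ yJ; rewrite !(smulA x u).
have [xuJ | xuJ] := boolP (x ** u \in val J); first exact: H.
have N z : (x ** u ** z ** y \in val J) = false.
  by apply: contraNF xuJ; rewrite -smulA; apply: regJ_mulr.
by rewrite !N.
Qed.

Lemma congJ_mulr J u s t : congJ J s t -> congJ J (s ** u) (t ** u).
Proof.
move=> /congJP H; apply/congJP=> x y xJ yJ; rewrite -!(smulA x) -!(smulA _ u) !smulA -!(smulA
  _ u).
have [uyJ | uyJ] := boolP (u ** y \in val J); first exact: H.
have N z : (x ** z ** (u ** y) \in val J) = false.
  by apply: contraNF uyJ; apply: regJ_mull.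
by rewrite !N.
Qed.

Lemma congJ_sandwich J f s t : f ** f = f -> f \in val J ->
  (forall l r, let s' := f ** lmul1 l (rmul1 s r) ** f in
               let t' := f ** lmul1 l (rmul1 t r) ** f in
     (s' \in val J) = (t' \in val J) /\ (s' \in val J -> s' = t')) ->
  congJ J s t.
Proof.
move=> ff fJ H; apply/congJP=> x y xJ yJ.
have [l [r [a [d [u [v E]]]]]] := sandwich ff fJ xJ yJ.
have mE z : (x ** z ** y \in val J) = (f ** lmul1 l (rmul1 z r) ** f \in val J).
  have [E1 E2] := E z; apply/idP/idP => zJ.
    apply: (regJ_ideal fJ); first by rewrite -smulA divs_mulr.
    apply: (@divs_trans _ _ (x ** z ** y)).
      by rewrite E1; apply/divsP; exists a, d.
    by move: zJ; rewrite (mem_regJ _ fJ) => /andP[].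
  apply: (regJ_ideal xJ); first by rewrite -smulA divs_mulr.
  apply: (@divs_trans _ _ (f ** lmul1 l (rmul1 z r) ** f)).
    by rewrite E2; apply/divsP; exists (Some u), (Some v).
  by move: zJ; rewrite (mem_regJ _ xJ) => /andP[].
have [H1 H2] := H l r; rewrite !mE; split=> // sJ.
by rewrite !(proj1 (E _)) H2.
Qed.

Lemma cong_belowP J s t :
  reflect (forall I, Jlt I J -> congJ I s t) (cong_below J s t).
Proof. by apply: (iffP forallP) => H I; [move/implyP: (H I) | apply/implyP/H]. Qed.

Lemma cong_below_sym J s t : cong_below J s t -> cong_below J t s.
Proof. by move=> /cong_belowP H; apply/cong_belowP=> I /H/congJ_sym. Qed.

Lemma cong_below_mull J u s t : cong_below J s t -> cong_below J (u ** s) (u ** t).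
Proof. by move=> /cong_belowP H; apply/cong_belowP=> I /H/congJ_mull. Qed.

Lemma cong_below_mulr J u s t : cong_below J s t -> cong_below J (s ** u) (t ** u).
Proof. by move=> /cong_belowP H; apply/cong_belowP=> I /H/congJ_mulr. Qed.

End Congruences.

Lemma idem_eltK (S : finSemigroup) (i : idem_elt S) : val i ** val i = val i.
Proof. exact/eqP/(valP i). Qed.

Lemma unit_valM (S : finSemigroup) (i : idem_elt S) (g h : unit_group i) :
  val (g * h)%g = val g ** val h.
Proof. by []. Qed.

Section GroupNJ.
Variables (S : finSemigroup) (e : regJ S -> idem_elt S) (J : regJ S).
Hypothesis he : val (e J) \in val J.
Let f : S := val (e J).

Lemma unit_mem_local (g : unit_group (e J)) : f ** val g = val g /\ val g ** f = val g.
Proof. by case/local_unitsP: (valP g). Qed.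

Lemma regJ_unit s : f ** s ** f \in val J -> exists g : unit_group (e J), val g = f ** s ** f.
Proof.
move=> sJ; have sU : f ** s ** f \in local_units f.
  by rewrite (local_unitsE _ (idem_eltK _) he) sJ andbT; apply/imsetP; exists s.
by exists (UnitElt sU).
Qed.

(* By finite stability, x ** s ** y and the local product f ** (l s r) ** f
   determine each other, so congJ J can be tested inside f S f. *)
Lemma congJ_of_units (R : S -> S -> Prop) :
  (forall s t, R s t -> R t s) ->
  (forall u s t, R s t -> R (u ** s) (u ** t)) ->
  (forall u s t, R s t -> R (s ** u) (t ** u)) ->
  (forall h, f ** h = h -> h ** f = h -> R h f -> h \in val J) ->
  (forall g : unit_group (e J), R (val g) f -> g = 1%g) ->
  forall s t, R s t -> congJ J s t.
Proof.
move=> symR Rl Rr R_J R_1 s t Rst; have ff : f ** f = f := idem_eltK (e J).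
have key u w : R u w -> f ** u ** f \in val J ->
    f ** w ** f \in val J /\ f ** u ** f = f ** w ** f.
  move=> uw uJ; have [g gE] := regJ_unit uJ.
  (* h is related to f, hence lies in J by [R_J]; this forces f ** w ** f into J. The resulting unit
     g^-1 g' is again related to f, so [R_1] makes it 1. *)
  pose h := val (g^-1)%g ** (f ** w ** f).
  have Rh : R h f.
    have <- : val (g^-1)%g ** (f ** u ** f) = f by rewrite -gE -unit_valM mulVg.
    exact/Rl/symR/Rr/Rl.
  have hJ : h \in val J.
    apply: R_J Rh; last by rewrite /h -!smulA ff.
    by rewrite /h smulA; have [-> _] := unit_mem_local (g^-1)%g.
  have wJ : f ** w ** f \in val J.
    apply: (regJ_ideal he); first by rewrite -smulA divs_mulr.
    apply: divs_trans (divs_mull (val (g^-1)%g) _) _.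
    by move: hJ; rewrite (mem_regJ _ he) => /andP[].
  split=> //; have [g' g'E] := regJ_unit wJ.
  have /R_1/(canRL (mulKVg _)) : R (val (g^-1 * g')%g) f by rewrite unit_valM g'E.
  by rewrite mulg1 => gg; rewrite -gE -g'E gg.
have Rlr l r : R (lmul1 l (rmul1 s r)) (lmul1 l (rmul1 t r)).
  by case: l r => [l|] [r|] /=; rewrite ?(Rl, Rr) //; [apply/Rl/Rr | apply: Rl | apply: Rr].
apply: (congJ_sandwich ff he) => l r /=.
split=> [|sJ]; last by have [] := key _ _ (Rlr l r) sJ.
by apply/idP/idP => [/(key _ _ (Rlr l r))[]|/(key _ _ (symR _ _ (Rlr l r)))[]].
Qed.

Lemma NJ_group_set : group_set (NJ e J).
Proof.
apply/group_setP; split=> [|g h].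
  by rewrite inE; apply/cong_belowP=> I _; apply: congJ_refl.
rewrite !inE => /cong_belowP H /cong_belowP H'; apply/cong_belowP=> I IJ.
rewrite unit_valM; apply: (@congJ_trans _ _ _ (f ** val h)).
  by apply: congJ_mulr; apply: H.
by have [-> _] := unit_mem_local h; apply: H'.
Qed.

Definition NJ_group : {group unit_group (e J)} := Group NJ_group_set.

Lemma NJ_normal : (NJ_group <| maxsubgroup e J)%g.
Proof.
apply/andP; split; first exact: subsetT.
apply/subsetP=> h _; rewrite inE; apply/subsetP=> _ /imsetP[g gN ->].
move: gN; rewrite !inE => /cong_belowP H; apply/cong_belowP=> I IJ.
rewrite conjgE mulgA !unit_valM.
have E : val (h^-1)%g ** f ** val h = f.
  have [_ ->] := unit_mem_local (h^-1)%g.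
  by rewrite -unit_valM mulVg.
by rewrite -[X in congJ I _ X]/f -E; apply/congJ_mulr/congJ_mull/H.
Qed.

End GroupNJ.

(** * Simple modules and their apexes *)

Section Subquotients.
Import GRing.Theory.
Local Open Scope ring_scope.
Variables (K : fieldType) (S : finSemigroup).

Definition simple_module (V : vectType K) (act : S -> 'End(V)) : Prop :=
  [/\ is_module act, KSmul act fullv != 0%VS &
      forall X, submodule act X -> X = 0%VS \/ X = fullv].

Section OneModule.
Variables (V : vectType K) (act : S -> 'End(V)).
Implicit Types (A B X Y : {vspace V}).

Lemma submoduleP X : submodule act X <-> forall s v, v \in X -> act s v \in X.
Proof.
split=> [sX s v vX | H s]; first exact: (subvP (sX s) _ (memv_img _ vX)).
by apply/subvP=> _ /memv_imgP[v vX ->]; apply: H.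
Qed.

Lemma KSmul_sub X Y : (KSmul act X <= Y)%VS <-> forall s v, v \in X -> act s v \in Y.
Proof.
split=> [/subv_sumP sXY s v vX | H]; first exact: (subvP (sXY s isT) _ (memv_img _ vX)).
by apply/subv_sumP=> s _; apply/subvP=> _ /memv_imgP[v vX ->]; apply: H.
Qed.

End OneModule.

Section Factors.
Variables (V : vectType K) (act : S -> 'End(V)).
Implicit Types (A B X Y : {vspace V}).
Hypothesis mod_act : is_module act.

Lemma modM s t v : act (s ** t) v = act s (act t v).
Proof. by rewrite mod_act comp_lfunE. Qed.

(** B / A is realised on a complement C of A in B, with q the projection onto C along A. It is
    defined on all of V but is meaningful only on B. *)
Lemma subquotient A B : submodule act A -> submodule act B -> (A <= B)%VS ->
  exists (W : vectType K) (act' : S -> 'End(W)) (q : 'Hom(V, W)),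
  [/\ is_module act', forall s v, v \in B -> q (act s v) = act' s (q v),
      (q @: B)%VS = fullv & forall v, v \in B -> (q v == 0) = (v \in A)].
Proof.
move=> /submoduleP sA /submoduleP sB sAB.
set C := (B :\: A)%VS; set pi := addv_pi1 B A.
have CA : (C :&: A = 0)%VS by rewrite capv_diff.
have sCB : (C <= B)%VS by apply: diffvSl.
pose q : 'Hom(V, subvs_of C) := (linfun (vsproj C) \o pi)%VF.
have piC v : pi v \in C by apply: memv_pi.
have qE v : vsval (q v) = pi v by rewrite comp_lfunE lfunE /= vsprojK.
clearbody q; have BE v : v \in B -> v - pi v \in A.
  move=> vB; rewrite -{1}(@addv_pi1_pi2 _ _ B A v) ?(addv_idPl _) //.
  by rewrite addrC addKr; apply: memv_pi2.
have piA v : v \in A -> pi v = 0.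
  move=> vA; have := daddv_pi_add CA (subvP (addvSr _ _) _ vA).
  rewrite (@daddv_pi_id _ _ A C) ?(capvC A) // => /(canRL (addrK _)).
  by rewrite subrr.
have piid v : v \in C -> pi v = v by move=> vC; apply: daddv_pi_id.
have q0 v : v \in B -> (q v == 0) = (v \in A).
  move=> vB; apply/eqP/idP => [q0 | vA].
    by have := BE v vB; rewrite -qE q0 [vsval 0](raddf0 _) subr0.
  by apply: val_inj; rewrite /= qE piA.
have qpi v : v \in B -> q (pi v) = q v.
  move=> vB; apply/eqP; rewrite -subr_eq0 -raddfB q0; last first.
    by rewrite memvB //; apply: (subvP sCB _ (piC v)).
  by rewrite -opprB rpredN BE.
pose act' s : 'End(subvs_of C) := (q \o act s \o linfun vsval)%VF.
have act'E s v : v \in B -> q (act s v) = act' s (q v).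
  move=> vB; rewrite /act' !comp_lfunE (lfunE vsval) /= qE.
  apply/eqP; rewrite -subr_eq0 -!raddfB q0 ?sB //=.
    by apply/sA/BE.
  rewrite memvB //. exact: (subvP sCB _ (piC v)).
have qval w : q (vsval w) = w.
  by apply: val_inj; rewrite /= qE piid // subvsP.
have valB (w : subvs_of C) : vsval w \in B by apply: (subvP sCB); apply: (subvsP w).
exists (subvs_of C), act', q; split=> //.
  move=> s t; apply/lfunP=> w; rewrite comp_lfunE -{1 2}[w]qval.
  by rewrite -!act'E ?modM ?sB.
apply/eqP; rewrite eqEsubv subvf; apply/subvP=> w _; rewrite -[w]qval.
exact: memv_img.
Qed.

Lemma simple_factor A B : submodule act A -> submodule act B -> (A <= B)%VS ->
  (forall X, submodule act X -> (A <= X)%VS -> (X <= B)%VS -> X = A \/ X = B) ->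
  ~~ (KSmul act B <= A)%VS ->
  exists (W : vectType K) (act' : S -> 'End(W)) (q : 'Hom(V, W)),
  [/\ simple_module act', forall s v, v \in B -> q (act s v) = act' s (q v),
      (q @: B)%VS = fullv & forall v, v \in B -> (q v == 0) = (v \in A)].
Proof.
move=> sA sB sAB maxA nz; have [W [act' [q [m' qact qB q0]]]] := subquotient sA sB sAB.
move/submoduleP: sB => sB; move/submoduleP: sA => sA.
exists W, act', q; split=> //; split=> //.
  apply: contra nz => /eqP nz; apply/KSmul_sub=> s v vB.
  rewrite -q0 ?sB // qact // -memv0 -nz; apply: (subvP (@sumv_sup _ _ _ s xpredT _ _ isT
    (subvv _))).
  by rewrite memv_img // memvf.
move=> X /submoduleP sX; pose Y := (B :&: q @^-1: X)%VS.
have sub_AY : (A <= Y)%VS.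
  apply/subvP=> v vA; have vB := subvP sAB v vA; rewrite memv_cap vB /= -memv_preim.
  by move: vA; rewrite -q0 // => /eqP->; rewrite mem0v.
have qY w : w \in X -> exists2 v, v \in Y & w = q v.
  move=> wX; have : w \in fullv by apply: memvf.
  rewrite -qB => /memv_imgP[v vB wE]; exists v => //.
  by rewrite memv_cap vB -memv_preim -wE.
have [|//||YA|YB] := maxA Y.
- apply/submoduleP=> s v; rewrite !memv_cap -!memv_preim => /andP[vB qv].
  by rewrite sB // qact // sX.
- exact: capvSl.
- left; apply/eqP; rewrite -subv0; apply/subvP=> w /qY[v].
  by rewrite YA => vA ->; rewrite memv0 q0 // (subvP sAB).
- right; apply/eqP; rewrite eqEsubv subvf -qB -YB; apply/subvP=> _ /memv_imgP[v vY ->].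
  by move: vY; rewrite memv_cap -memv_preim => /andP[].
Qed.

End Factors.
End Subquotients.

Section Apex.
Import GRing.Theory.
Local Open Scope ring_scope.
Variables (K : fieldType) (S : finSemigroup).

(** Since b a divides a, there is z, a left multiple of b, with a = z a r. Iterating, an idempotent
    power of z fixes a on the left, and it lies between b and a in the J-order. *)
Lemma regular_Jclass_product (s a b : S) :
  a \in Jclass s -> b \in Jclass s -> b ** a \in Jclass s -> regular_Jclass (Jclass s).
Proof.
rewrite !mem_Jclass => /andP[sa as_] /andP[sb bs] /andP[sba bas].
have /divsP[l [r aE]] : divs (b ** a) a by apply: divs_trans sa.
pose z := lmul1 l b.
have {}aE : a = rmul1 (z ** a) r by rewrite {1}aE -lmul1A.
have aEn n : exists r', a = rmul1 (spow z n ** a) r'.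
  elim: n => [|n [r' E]]; first by exists r.
  exists (mul1 r' r); rewrite -rmul1M {1}aE; congr (rmul1 _ r).
  by rewrite {1}E rmul1A smulA.
have [n zz] := idem_pow z; have [r' E] := aEn n.
have gE : spow z n ** a = a by rewrite {1}E rmul1A smulA zz -E.
rewrite /regular_Jclass imset_f //=; apply/exists_inP; exists (spow z n); last exact/eqP.
rewrite mem_Jclass; apply/andP; split.
  apply: (divs_trans sb); case: {+}n => [|k]; rewrite ?spowS; first exact: divs_lmul1.
  by apply: divs_trans (divs_mulr _ _); apply: divs_lmul1.
by apply: divs_trans as_; rewrite -[X in divs _ X]gE divs_mulr.
Qed.

Section SimpleModule.
Variables (V : vectType K) (act : S -> 'End(V)).
Hypothesis simple_act : simple_module act.
Let mod_act : is_module act. Proof. by case: simple_act. Qed.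

Definition apex (J : regJ S) : Prop :=
  (exists2 s, s \in val J & act s != 0) /\
  (forall s, s \in ideal1 (val J) -> s \notin val J -> act s = 0).

Lemma exists_vector : exists v : V, v != 0.
Proof.
have [_ nz _] := simple_act; exists (vpick (fullv : {vspace V})).
rewrite vpick0; apply: contra nz => /eqP E.
by rewrite -subv0; apply/KSmul_sub=> s v; rewrite E memv0 => /eqP->; rewrite linear0 mem0v.
Qed.

Lemma exists_act : exists s, act s != 0.
Proof.
apply/existsP; rewrite -negb_forall; have [_ nz _] := simple_act.
apply: contra nz => /forallP H; rewrite -subv0; apply/KSmul_sub=> s v _.
by rewrite (eqP (H s)) lfunE mem0v.
Qed.

(** The vectors killed by a right ideal form a submodule, which is proper as soon as the ideal acts
    nontrivially, hence zero. *)
Lemma ideal_vector (I : pred S) (v : V) :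
  (forall s x, x \in I -> x ** s \in I) ->
  (exists2 x, x \in I & act x != 0) -> v != 0 -> exists2 x, x \in I & act x v != 0.
Proof.
move=> idI [x0 x0I nz0] nzv; apply/exists_inP; rewrite -negb_forall_in.
apply: contra nzv => /forall_inP H.
pose X := (\bigcap_(x in I) lker (act x))%VS.
have XP w : reflect (forall x, x \in I -> act x w = 0) (w \in X).
  rewrite memvE; apply: (iffP subv_bigcapP) => E x xI.
    by apply/eqP; rewrite -memv_ker memvE; apply: E.
  by rewrite -memvE memv_ker E.
have [_ _ /(_ X)[|X0|XV]] := simple_act.
- by apply/submoduleP=> s w /XP E; apply/XP=> x xI; rewrite -(modM mod_act) // E // idI.
- by rewrite -memv0 -X0; apply/XP=> x xI; apply/eqP; exact: H.
case/eqP: nz0; apply/lfunP=> w; rewrite lfunE /=.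
by have /XP-> : w \in X by rewrite XV memvf.
Qed.

(** Dual to [ideal_vector]: for a left ideal the span of the images of v is a submodule. *)
Lemma ideal_span (I : pred S) (v : V) :
  (forall s x, x \in I -> s ** x \in I) ->
  (exists2 x, x \in I & act x v != 0) -> (\sum_(x in I) <[act x v]>)%VS = fullv.
Proof.
move=> idI [x0 x0I nz0]; have [_ _ /(_ (\sum_(x in I) <[act x v]>)%VS)[|X0|//]] := simple_act.
  move=> s; rewrite limg_sum; apply/subv_sumP=> x xI; rewrite limg_line -(modM mod_act) //.
  by apply: (sumv_sup (s ** x)); rewrite ?idI.
case/negP: nz0; rewrite -memv0 -X0 memvE.
by apply: (sumv_sup x0).
Qed.

(** Take s acting nontrivially with the smallest principal ideal, so that everything strictly below
    s acts as zero. Two applications of [ideal_vector] give a and b in its J-class whose product b a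
    acts nontrivially, hence stays in the class and makes it regular. *)
Lemma apex_exists : exists J, apex J.
Proof.
have [s0 nz0] := exists_act.
case: (@arg_minnP _ s0 (fun s => act s != 0) (fun s => #|ideal1 [set s]|) nz0) => s nz min_s.
have I0 t : divs s t -> ~~ divs t s -> act t = 0.
  move=> st nts; apply/eqP; apply: contraTT (isT) => /min_s; rewrite leqNgt => /negP[].
  apply/proper_card/properP; split.
    by apply/subsetP=> u; rewrite !ideal1_set1; apply: divs_trans.
  by exists s; rewrite ideal1_set1 ?divs_refl.
have [v nzv] := exists_vector.
have H u : u != 0 -> exists2 x, x \in divs s & act x u != 0.
  apply: ideal_vector; last by exists s => //; apply: divs_refl.
  by move=> t x xI; apply: divs_trans xI _; apply: divs_mulr.
have [a sa nza] := H v nzv; have [b sb nzb] := H _ nza.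
have in_J t w : t \in divs s -> act t w != 0 -> t \in Jclass s.
  move=> st nzt; have {}st : divs s t by []; rewrite mem_Jclass st /=;
    apply: contraR nzt => nts.
  by rewrite I0 ?lfunE.
have regs : regular_Jclass (Jclass s).
  apply: (@regular_Jclass_product s a b); [exact: in_J nza | exact: in_J nzb |].
  apply: (in_J _ v); last by rewrite (modM mod_act).
  by apply: divs_trans sa _; apply: divs_mull.
pose J : regJ S := Sub (Jclass s) regs.
have sJ : s \in val J by rewrite SubK mem_Jclass divs_refl.
exists J; split; first by exists s.
by move=> t; rewrite (ideal1_regJ _ sJ) (mem_regJ _ sJ) => st; rewrite st; apply: I0.
Qed.

Section WithApex.
Variables (J : regJ S).
Hypothesis apexJ : apex J.

Lemma apex_vec v : v != 0 -> exists2 x, x \in val J & act x v != 0.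
Proof.
have [[s sJ nzs] I0] := apexJ => nzv.
have [||x xI nzx] := @ideal_vector (mem (ideal1 (val J))) v _ _ nzv.
- move=> t x; rewrite !(ideal1_regJ _ sJ) => sx; apply: divs_trans sx _; apply: divs_mulr.
- by exists s => //; rewrite (ideal1_regJ _ sJ) divs_refl.
by exists x => //; apply: contraR nzx => /I0-> //; rewrite lfunE.
Qed.

Lemma apex_ext (D D' : 'End(V)) : (forall x, x \in val J -> forall v, D (act x v) = D' (act x
  v)) -> D = D'.
Proof.
have [[s sJ nzs] I0] := apexJ.
move=> H; have [v nzv] := exists_vector; have [x xJ nzx] := apex_vec nzv.
have span : (\sum_(x in ideal1 (val J)) <[act x v]>)%VS = fullv.
  apply: ideal_span.
    by move=> t y; rewrite !(ideal1_regJ _ sJ) => sy; apply: divs_trans sy _; apply: divs_mull.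
  exists x => //; rewrite (ideal1_regJ _ sJ).
  by move: xJ; rewrite (mem_regJ _ sJ) => /andP[].
apply/lfunP=> w; apply/eqP; rewrite -subr_eq0.
have -> : D w - D' w = (D - D') w by rewrite lfunE /= lfunE.
rewrite -memv_ker; suff /subvP-> : (fullv <= lker (D - D'))%VS by rewrite ?memvf.
rewrite -span; apply/subv_sumP=> y yI; rewrite -memvE memv_ker lfunE /= lfunE /= subr_eq0.
apply/eqP; have [yJ | yJ] := boolP (y \in val J); first exact: H.
by rewrite I0 // lfunE !linear0.
Qed.

(** The actions can be compared after multiplying by J on both sides: [apex_ext] removes the right
    factor and [apex_vec] the left one. Products that leave J act as zero. *)
Lemma apex_congJ s t : congJ J s t -> act s = act t.
Proof.
have [[s0 s0J _] I0] := apexJ.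
move=> /congJP H; apply: apex_ext => y yJ v; apply/eqP; rewrite -subr_eq0; apply/negPn/negP.
case/apex_vec=> x xJ; rewrite linearB /= -!(modM mod_act) subr_eq0 => /negP[]; apply/eqP.
have [E H2] := H x y xJ yJ; rewrite !smulA.
have [sJ | sJ] := boolP (x ** s ** y \in val J); first by rewrite H2.
have idl z : x ** z ** y \in ideal1 (val J).
  by rewrite (ideal1_regJ _ xJ) -smulA divs_mulr.
by rewrite !I0 // -E.
Qed.

(** Some multiple y of s moves a nonzero vector, and a further multiplication by an element of J
    keeps the image nonzero; that product, being in the ideal of J, must lie in J. *)
Lemma apex_divs s x : act s != 0 -> x \in val J -> divs s x.
Proof.
move=> nzs xJ; have [_ I0] := apexJ.
have [w nzw] := exists_vector.
have [||y sy /apex_vec[x' x'J]] := @ideal_vector (divs s) w _ _ nzw.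
- by move=> t y sy; apply: divs_trans sy _; apply: divs_mulr.
- by exists s => //; apply: divs_refl.
rewrite -(modM mod_act) // => nz; have x'yI : x' ** y \in ideal1 (val J).
  by rewrite (ideal1_regJ _ x'J) divs_mulr.
have x'yJ : x' ** y \in val J by apply: contraR nz => /I0-> //; rewrite lfunE.
apply: (divs_trans sy); apply: (@divs_trans _ _ (x' ** y)); first exact: divs_mull.
by move: xJ; rewrite (mem_regJ _ x'yJ) => /andP[].
Qed.

(** V is spanned by the images of w, so the image of f is spanned by the f ** x ** f applied to w;
    each of these is a unit or lies strictly below J and acts as zero. This is simplicity of the
    local module. *)
Lemma apex_span (i : idem_elt S) (w w' : V) : val i \in val J ->
  w != 0 -> act (val i) w = w -> act (val i) w' = w' ->
  w' \in (\sum_(g : unit_group i) <[act (val g) w]>)%VS.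
Proof.
set f := val i => fJ nzw fw fw'; have [_ I0] := apexJ.
have span : (\sum_(x in predT) <[act x w]>)%VS = fullv.
  by apply: ideal_span => //; exists f => //; rewrite fw.
have : w' \in (act f @: fullv)%VS by rewrite -fw' memv_img ?memvf.
rewrite -span limg_sum; apply/subvP/subv_sumP=> x _; rewrite limg_line -memvE.
rewrite -[w in act x w]fw -!(modM mod_act).
have [xJ | xJ] := boolP (f ** x ** f \in val J); last first.
  by rewrite I0 ?lfunE ?mem0v // (ideal1_regJ _ fJ) -smulA divs_mulr.
have gU : f ** x ** f \in local_units f.
  rewrite (local_unitsE _ _ fJ) ?xJ ?andbT; last exact/eqP/(valP i).
  by apply/imsetP; exists x.
rewrite memvE; exact: (sumv_sup (UnitElt gU : unit_group i)).
Qed.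

End WithApex.
End SimpleModule.
End Apex.

(** [mxsimple_exists] holds over an arbitrary field only under [classically]; excluded middle
    extracts the submodule. *)
Lemma classicallyE (P : Prop) : classically P -> P.
Proof. by move=> cP; apply: NNPP => nP; have := cP false (fun p => False_ind _ (nP p)). Qed.

Section LocalGroupAction.
Import GRing.Theory VectorInternalTheory.
Local Open Scope ring_scope.
Variables (K : fieldType) (S : finSemigroup) (V : vectType K) (act : S -> 'End(V)).
Variable i : idem_elt S.
Hypothesis mod_act : is_module act.
Local Notation f := (val i).

Lemma act_idem v : act f (act f v) = act f v.
Proof. by rewrite -(modM mod_act) idem_eltK. Qed.

Lemma act_unitl (g : unit_group i) v : act f (act (val g) v) = act (val g) v.
Proof. by rewrite -(modM mod_act); case: (local_unitsP _ _ (valP g)) => ->. Qed.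

Lemma act_unitr (g : unit_group i) v : act (val g) (act f v) = act (val g) v.
Proof. by rewrite -(modM mod_act); case: (local_unitsP _ _ (valP g)) => _ ->. Qed.

Lemma act_unitM (g h : unit_group i) v : act (val (g * h)%g) v = act (val g) (act (val h) v).
Proof. by rewrite -(modM mod_act). Qed.

Section AbelianSubgroup.
Variable A : {group unit_group i}.
Hypothesis cAA : abelian A.

(* Adding v - act f v makes the units act on all of V by a group representation. *)
Definition ext_unit (g : unit_group i) (v : V) : V := act (val g) v + (v - act f v).

Definition ext_unit_mx (g : unit_group i) : 'M[K]_(dim V) :=
  lin1_mx (v2r \o (linfun (ext_unit g)) \o r2v).

Lemma ext_unit_linear g : linear (ext_unit g).
Proof.
move=> a u v; rewrite /ext_unit !linearP /= (addrACA (a *: u)) [LHS]addrACA.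
by rewrite -!scalerDr.
Qed.

HB.instance Definition _ g := GRing.isLinear.Build K V V _ (ext_unit g) (ext_unit_linear g).

Lemma ext_unit_mxE g u : u *m ext_unit_mx g = v2r (ext_unit g (r2v u)).
Proof. by rewrite mul_rV_lin1 /= lfunE. Qed.

Lemma ext_unit_repr : mx_repr A ext_unit_mx.
Proof.
split=> [|g h gA hA]; apply/row_matrixP=> j; rewrite !rowE ?mulmxA !ext_unit_mxE.
  by rewrite /ext_unit addrC subrK r2vK mulmx1.
(* Matrices act on row vectors from the right, which reverses products; commutativity of A restores
   the order. *)
rewrite v2rK (centsP cAA _ gA _ hA); congr v2r; set v := r2v _; rewrite /ext_unit.
have E (k : unit_group i) : act (val k) (v - act f v) = 0.
  by rewrite linearB /= act_unitr subrr.
have E' : act f (act (val g) v + (v - act f v)) = act (val g) v.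
  by rewrite linearD /= act_unitl linearB /= act_idem subrr addr0.
by rewrite E' act_unitM linearD /= E addr0 (addrC (act (val g) v)) addrK.
Qed.

Definition ext_unit_rep := MxRepresentation ext_unit_repr.

(** B is the kernel of A on a simple submodule of the image of f. A faithful simple module of an
    abelian group forces the group to be cyclic over any field, and p-subgroups normal in A act
    trivially in characteristic p. The vector w is any nonzero vector of the submodule; A itself
    need not act on it by scalars. *)
Lemma local_eigenvector : act f != 0 ->
  exists (w : V) (B : {group unit_group i}),
    [/\ w != 0, act f w = w, (B \subset A) && cyclic (A / B)%g,
        forall g, g \in B -> act (val g) w = w &
        forall p, p \in [pchar K] -> ('O_p(A) \subset B)%g].
Proof.
move=> nzf; pose U : 'M[K]_(dim V) := lin1_mx (v2r \o act f \o r2v).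
have UE u : u *m U = v2r (act f (r2v u)) by rewrite mul_rV_lin1.
have nzU : U != 0.
  apply: contra nzf => /eqP U0; apply/eqP/lfunP=> v; rewrite lfunE /=.
  by apply: (can_inj v2rK); rewrite -[v in LHS]v2rK -UE U0 mulmx0 linear0.
have modU : mxmodule ext_unit_rep U.
  apply/mxmoduleP=> g gA; apply/row_subP=> j; rewrite row_mul rowE UE ext_unit_mxE v2rK.
  rewrite /ext_unit act_idem subrr addr0 act_unitr -act_unitl.
  by rewrite -[act (val g) _]v2rK -UE submxMl.
have [M simM sMU] := classicallyE (mxsimple_exists modU nzU).
have [modM' nzM _] := simM.
have irrM : mx_irreducible (submod_repr modM') by apply/submod_mx_irr.
pose B := [group of rker (submod_repr modM')]%g.
have BE : B = rstab ext_unit_rep M :> {set _} by rewrite /= rker_submod.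
pose r := nz_row M; pose w := r2v r.
have fw : act f w = w.
  have /submxP[u rE] : (r <= U)%MS by apply: submx_trans (nz_row_sub _) sMU.
  by rewrite /w rE UE v2rK act_idem.
exists w, B; split=> //.
- by apply: contra nzM => /eqP w0; rewrite -nz_row_eq0 -/r -(r2vK r) -/w w0 linear0.
- have cAB : abelian (A / B)%g by apply: quotient_abelian.
  by rewrite /= {1}rker_submod rstab_sub /= -(center_idP cAB) center_kquo_cyclic.
- move=> g gB; have : g \in rstab ext_unit_rep M by rewrite -BE.
  move=> /rstab_act/(_ (nz_row_sub M)); rewrite -/r => /(congr1 r2v).
  by rewrite [_ *m _]ext_unit_mxE v2rK -/w /ext_unit fw subrr addr0.
- by move=> p pK; apply: (pcore_sub_rker_mx_irr_pchar pK irrM).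
Qed.

End AbelianSubgroup.
End LocalGroupAction.

Section FixedVectors.
Import GRing.Theory.
Local Open Scope ring_scope.
Variables (K : fieldType) (S : finSemigroup) (V : vectType K) (act : S -> 'End(V)).
Variables (J : regJ S) (i : idem_elt S).
Hypotheses (simple_act : simple_module act) (apexJ : apex act J) (iJ : val i \in val J).

(** The fixed vectors of a normal subgroup are stable under all units, so together with w they
    contain its whole span, the image of [act (val i)]. *)
Lemma normal_fixed_vector (X : {group unit_group i}) w : (X <| [set: unit_group i])%g ->
  w != 0 -> act (val i) w = w -> (forall g, g \in X -> act (val g) w = w) ->
  forall g, g \in X -> act (val g) = act (val i).
Proof.
move=> /andP[_ nX] nzw fw Xw g gX; have [mod_act _ _] := simple_act.
apply/lfunP=> v; rewrite -[LHS]act_unitr // -[RHS]act_idem //; apply/eqlfunP.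
have : act (val i) v \in (\sum_(h : unit_group i) <[act (val h) w]>)%VS.
  by apply: (apex_span simple_act apexJ) => //; rewrite act_idem.
apply/subvP/subv_sumP=> h _; rewrite -memvE; apply/eqlfunP.
rewrite act_unitl // -[LHS]act_unitM // conjgC act_unitM // Xw //.
by rewrite memJ_norm // (subsetP nX) ?inE.
Qed.

End FixedVectors.

(** * Duality for abelian normal subgroups *)

Section NormalSubgroups.
Local Open Scope group_scope.
Variables (gT : finGroupType) (G : {group gT}).
Implicit Types (X Y Z M B H : {group gT}).

(* G-equivariant homomorphisms X -> Y; the value 1 outside X makes them
   determined by their restriction to X, so that they can be counted. *)
Definition ghom X Y : {set {ffun gT -> gT}} :=
  [set f : {ffun gT -> gT} | [&& [forall x, (x \notin X) ==> (f x == 1)],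
               [forall x in X, f x \in Y],
               [forall x in X, forall y in X, f (x * y) == f x * f y] &
               [forall x in X, forall g in G, f (x ^ g) == f x ^ g]]].

Lemma ghomP X Y (f : {ffun gT -> gT}) :
  reflect [/\ forall x, x \notin X -> f x = 1,
              forall x, x \in X -> f x \in Y,
              forall x y, x \in X -> y \in X -> f (x * y) = f x * f y &
              forall x g, x \in X -> g \in G -> f (x ^ g) = f x ^ g]
          (f \in ghom X Y).
Proof.
rewrite inE; apply: (iffP and4P) => [[A1 A2 A3 A4] | [A1 A2 A3 A4]]; split.
- by move=> x xX; apply/eqP; apply: (implyP (forallP A1 x)).
- by move=> x xX; apply: (forall_inP A2).
- by move=> x y xX yX; apply/eqP; apply: (forall_inP (forall_inP A3 x xX)).
- by move=> x g xX gG; apply/eqP; apply: (forall_inP (forall_inP A4 x xX)).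
- by apply/forallP=> x; apply/implyP=> xX; rewrite A1.
- by apply/forall_inP.
- by apply/forall_inP=> x xX; apply/forall_inP=> y yX; rewrite A3.
- by apply/forall_inP=> x xX; apply/forall_inP=> y yX; rewrite A4.
Qed.

Lemma ghom_ext X Y f f' : f \in ghom X Y -> f' \in ghom X Y -> {in X, f =1 f'} -> f = f'.
Proof.
move=> /ghomP[z _ _ _] /ghomP[z' _ _ _] E; apply/ffunP=> x.
by have [/E//|xX] := boolP (x \in X); rewrite z ?z'.
Qed.

Local Notation stable Y := (G \subset 'N(Y)).

Lemma stable_conj Y x g : stable Y -> g \in G -> (x ^ g \in Y) = (x \in Y).
Proof. by move=> /subsetP nY /nY gN; rewrite memJ_norm. Qed.

Lemma stable_commute X Y x y : X \subset G -> Y \subset G -> stable X -> stable Y ->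
  X :&: Y = 1 -> x \in X -> y \in Y -> commute x y.
Proof.
move=> XG YG nX nY tiXY xX yY; apply/commgP; rewrite -in_set1 -set1gE -tiXY inE.
rewrite {1}commgEl groupMl ?groupV // stable_conj ?(subsetP YG) // xX /=.
by rewrite commgEr groupMr ?yY ?groupV // stable_conj ?groupV ?(subsetP XG).
Qed.

Lemma ghom1 X Y f : f \in ghom X Y -> f 1 = 1.
Proof. by case/ghomP=> _ _ /(_ 1 1 (group1 _) (group1 _)) E _; apply: (mulgI (f 1));
  rewrite -E !mulg1. Qed.

Lemma ghomV X Y f x : f \in ghom X Y -> x \in X -> f x^-1 = (f x)^-1.
Proof.
move=> fH xX; have := ghom1 fH; case/ghomP: fH => _ _ fM _ f1.
by apply: (mulgI (f x)); rewrite -fM ?groupV // !mulgV.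
Qed.

Lemma ghom_graph X Y f : f \in ghom X Y -> stable X ->
  (forall x y, x \in X -> y \in Y -> commute x y) ->
  exists Z : {group gT}, stable Z /\ forall z, (z \in Z) = (z \in [set x * f x | x in X]).
Proof.
move=> fH nX cXY; have f1 := ghom1 fH; case/ghomP: fH => f0 fY fM fJ.
have gZ : group_set [set x * f x | x in X].
  apply/group_setP; split; first by apply/imsetP; exists 1; rewrite ?f1 ?mulg1.
  move=> _ _ /imsetP[x xX ->] /imsetP[y yX ->]; apply/imsetP; exists (x * y);
    rewrite ?groupM //.
  by rewrite fM // -!mulgA; congr (_ * _); rewrite !mulgA; congr (_ * _); symmetry;
    apply: cXY; rewrite ?fY.
exists (Group gZ); split=> //; apply/subsetP=> g gG; rewrite inE.
apply/subsetP=> _ /imsetP[_ /imsetP[x xX ->] ->]; apply/imsetP; exists (x ^ g).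
  by rewrite stable_conj.
by rewrite fJ // conjMg.
Qed.

(** Triviality of Y :&: Z makes the y attached to x unique, and uniqueness yields both
    multiplicativity and equivariance. *)
Lemma graph_ghom X Y Z : stable X -> stable Y -> stable Z -> Y :&: Z = 1 ->
  (forall x y, x \in X -> y \in Y -> commute x y) ->
  (forall x, x \in X -> exists2 y, y \in Y & x * y \in Z) ->
  exists2 f, f \in ghom X Y & forall x, x \in X -> x * f x \in Z.
Proof.
move=> nX nY nZ tiYZ cXY XYZ.
pose f := [ffun x => if x \in X then odflt 1 [pick y in Y | x * y \in Z] else 1].
have fP x : x \in X -> f x \in Y /\ x * f x \in Z.
  move=> xX; rewrite ffunE xX; case: pickP => [y /andP[] // | none].
  by have [y yY xyZ] := XYZ x xX; have := none y; rewrite yY xyZ.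
have uniqf x y : x \in X -> y \in Y -> x * y \in Z -> f x = y.
  move=> xX yY xyZ; have [fY fZ] := fP x xX; apply: (mulgI y^-1); rewrite mulVg.
  apply/eqP; rewrite -in_set1 -set1gE -tiYZ inE groupM ?groupV //=.
  have -> : y^-1 * f x = (x * y)^-1 * (x * f x) by rewrite invMg -!mulgA mulKg.
  by rewrite groupM ?groupV.
exists f => [|x /fP[]//]; apply/ghomP; split.
- by move=> x; rewrite ffunE => /negPf->.
- by move=> x /fP[].
- move=> x y xX yX; have [fx xZ] := fP x xX; have [fy yZ] := fP y yX.
  apply: uniqf; [exact: groupM | exact: groupM |].
  have -> : x * y * (f x * f y) = x * f x * (y * f y).
    by rewrite -!mulgA; congr (_ * _); rewrite !mulgA; congr (_ * _); apply: cXY.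
  exact: groupM.
- move=> x g xX gG; have [fx xZ] := fP x xX.
  by apply: uniqf; rewrite ?stable_conj // -conjMg stable_conj.
Qed.

End NormalSubgroups.

Section Duality.
Local Open Scope group_scope.
Variables (gT : finGroupType) (G : {group gT}).
Implicit Types (X Y Z M B H : {group gT}).
Local Notation stable Y := (G \subset 'N(Y)).

Lemma min_normal_sub M : is_min_normal G M -> M \subset G.
Proof. by case/andP. Qed.

Lemma min_normal_stable M : is_min_normal G M -> stable M.
Proof. by case/andP=> _ /mingroupP[/andP[]]. Qed.

Lemma min_normal_nt M : is_min_normal G M -> M :!=: 1.
Proof. by case/andP=> _ /mingroupP[/andP[]]. Qed.

Lemma min_normal_dichotomy M Y : is_min_normal G M -> stable Y ->
  M :&: Y = 1 \/ M \subset Y.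
Proof.
case/andP=> _ /mingroupP[/andP[_ nM] minM] nY.
have [|ntMY] := eqVneq (M :&: Y) 1; first by left.
right; rewrite -(minM [group of M :&: Y]) ?subsetIl ?subsetIr //.
by rewrite ntMY normsI.
Qed.

(** A family instead of a set: repetitions are allowed, so m bounds the number of generators from
    above. *)
Definition normal_gens m (w : 'I_m -> gT) H : Prop :=
  (forall i, w i \in H) /\
  (forall Y, stable Y -> (forall i, w i \in Y) -> H \subset Y).

Section Step.
Variables (m : nat) (M B : {group gT}).
Hypotheses (minM : is_min_normal G M) (cMM : abelian M).
Hypotheses (BG : B \subset G) (nB : stable B) (tiMB : M :&: B = 1).
Let nM : stable M := min_normal_stable minM.
Let MG : M \subset G := min_normal_sub minM.

Lemma min_factor_commute x y : x \in M -> y \in B -> commute x y.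
Proof. exact: (stable_commute MG BG nM nB tiMB). Qed.

Lemma factor_min_commute x y : x \in B -> y \in M -> commute x y.
Proof. by move=> xB yM; apply: commute_sym; apply: min_factor_commute. Qed.

Lemma join_prodP x : reflect (exists2 u, u \in M & exists2 b, b \in B & x = u * b) (x \in M
  <*> B).
Proof.
rewrite norm_joinEr ?(subset_trans BG) //.
by apply: (iffP mulsgP) => [[u b uM bB ->] | [u uM [b bB ->]]]; [exists u => //;
  exists b | exists u b].
Qed.

(** A stable Y containing the projections gives M <*> (Y :&: B), which contains the generators and
    hence B; as M :&: B = 1, its part in B is only Y :&: B. *)
Lemma normal_gens_proj (wM wB : 'I_m -> gT) :
  (forall i, wM i \in M) -> (forall i, wB i \in B) ->
  normal_gens (fun i => wB i * wM i) (M <*> B) -> normal_gens wB B.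
Proof.
move=> wMM wBB [_ genw]; split=> // Y nY wY; apply/subsetP=> b bB.
have nYB : stable (Y :&: B) by apply: normsI.
have sub1 : M \subset M <*> (Y :&: B) by apply: joing_subl.
have sub2 : Y :&: B \subset M <*> (Y :&: B) by apply: joing_subr.
have sMB : M <*> B \subset M <*> (Y :&: B).
  apply: genw => [|i]; first by rewrite normsY.
  by rewrite groupM ?(subsetP sub1 _ (wMM i)) // (subsetP sub2) // inE wY wBB.
have : b \in M <*> (Y :&: B) by rewrite (subsetP sMB) // (subsetP (joing_subr M B)).
rewrite norm_joinEr; last by rewrite subIset // (subset_trans BG) ?orbT.
case/mulsgP=> u y uM /setIP[yY yB] bE; suff u1 : u = 1 by rewrite bE u1 mul1g.
apply/eqP; rewrite -in_set1 -set1gE -tiMB inE uM /=.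
by rewrite -(groupMr _ yB) -bE.
Qed.

Lemma normal_gens_split (w : 'I_m -> gT) : normal_gens w (M <*> B) ->
  exists wM wB : 'I_m -> gT, [/\ forall i, wM i \in M, forall i, wB i \in B &
    normal_gens (fun i => wB i * wM i) (M <*> B)].
Proof.
move=> [win genw].
have dec i : exists p : gT * gT, [&& p.1 \in M, p.2 \in B & w i == p.2 * p.1].
  have /join_prodP[u uM [b bB E]] := win i.
  by exists (u, b); rewrite uM bB E /= (min_factor_commute uM bB).
pose wM i := (xchoose (dec i)).1; pose wB i := (xchoose (dec i)).2.
have wP i : [/\ wM i \in M, wB i \in B & w i = wB i * wM i].
  by case/and3P: (xchooseP (dec i)) => *; split=> //; apply/eqP.
exists wM, wB; split=> [i|i|]; try by case: (wP i).
split=> [i|Y nY wY]; first by case: (wP i) => _ _ <-.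
by apply: genw => // i; case: (wP i) => _ _ ->.
Qed.

(* Evaluation at wB embeds the homomorphisms B -> M in M ^ m, and it misses wM:
   otherwise all the generators would lie on the graph of a homomorphism. *)
Lemma card_ghom_gens (wM wB : 'I_m -> gT) :
  (forall i, wM i \in M) -> (forall i, wB i \in B) ->
  normal_gens (fun i => wB i * wM i) (M <*> B) -> #|ghom G B M| < #|M| ^ m.
Proof.
move=> wMM wBB genw; have [_ genB] := normal_gens_proj wMM wBB genw.
pose Phi (f : {ffun gT -> gT}) := [ffun i : 'I_m => f (wB i)].
have injPhi : {in ghom G B M &, injective Phi}.
  move=> f f' fH fH' E; apply: (ghom_ext fH fH') => b bB.
  have [[_ _ fM fJ] [_ _ fM' fJ']] := (ghomP _ _ _ _ fH, ghomP _ _ _ _ fH').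
  have gE : group_set [set b in B | f b == f' b].
    apply/group_setP; split; first by rewrite inE group1 (ghom1 fH) (ghom1 fH') /=.
    move=> x y; rewrite !inE => /andP[xB /eqP fx] /andP[yB /eqP fy].
    by rewrite groupM // fM // fM' // fx fy /=.
  have /subsetP/(_ b bB) : B \subset Group gE.
    apply: genB => [|i]; last first.
      by rewrite inE wBB /=; apply/eqP; have := congr1 (fun t : {ffun _} => t i) E;
        rewrite !ffunE.
    apply/subsetP=> g gG; rewrite inE; apply/subsetP=> _ /imsetP[x + ->].
    by rewrite !inE (stable_conj _ nB gG) => /andP[xB /eqP fx]; rewrite xB fJ // fJ' // fx /=.
  by rewrite inE => /andP[_ /eqP].
rewrite -(card_in_imset injPhi) -[m in (#|M| ^ m)%N]card_ord -card_ffun_on.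
apply/proper_card/properP; split.
  apply/subsetP=> _ /imsetP[f /ghomP[_ fY _ _] ->]; apply/ffun_onP=> i.
  by rewrite ffunE fY.
exists [ffun i => wM i]; first by apply/ffun_onP=> i; rewrite ffunE.
apply/imsetP=> -[f fH E].
have [Z [nZ ZE]] := ghom_graph fH nB factor_min_commute.
have sZ : M <*> B \subset Z.
  have [_ genZ] := genw; apply: genZ => // i.
  rewrite ZE; apply/imsetP; exists (wB i) => //; congr (_ * _).
  by have := congr1 (fun t : {ffun _} => t i) E; rewrite !ffunE.
case/negP: (min_normal_nt minM); apply/eqP/trivgP/subsetP=> x xM.
have : x \in Z by rewrite (subsetP sZ) // (subsetP (joing_subl _ _)).
rewrite ZE => /imsetP[b bB xE]; have [_ fY _ _] := ghomP _ _ _ _ fH.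
have b1 : b = 1.
  apply/eqP; rewrite -in_set1 -set1gE -tiMB inE bB andbT.
  by rewrite -(groupMr _ (fY b bB)) -xE.
by rewrite xE b1 (ghom1 fH) mulg1 set11.
Qed.

(** By counting, some tuple t in M is not the tuple of values at wB of any homomorphism. A stable Y
    containing all wB i * t i but not M would meet M trivially and contain the graph of a
    homomorphism taking exactly these values. *)
Lemma normal_gens_extend (wB : 'I_m -> gT) : normal_gens wB B ->
  #|ghom G B M| < #|M| ^ m ->
  exists w : 'I_m -> gT, normal_gens w (M <*> B).
Proof.
move=> [wBB genB]; pose Phi (f : {ffun gT -> gT}) := [ffun i : 'I_m => f (wB i)].
rewrite -[m in (#|M| ^ m)%N]card_ord -card_ffun_on => lt.
have [t tM tP] : exists2 t : {ffun 'I_m -> gT}, t \in ffun_on M & t \notin Phi @: ghom G B M.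
  apply/exists_inP; apply: contraLR lt => /exists_inPn H; rewrite -leqNgt.
  apply: leq_trans (leq_imset_card Phi _); apply/subset_leq_card/subsetP=> t tM.
  by apply: contraR (H t tM).
have {}tM i : t i \in M by apply: (ffun_onP tM).
exists (fun i => wB i * t i); split=> [i|Y nY wY].
  by rewrite groupM ?(subsetP (joing_subr M B) _ (wBB i)) ?(subsetP (joing_subl M B) _ (tM i)).
have [tiMY | sMY] := min_normal_dichotomy minM nY; last first.
  rewrite join_subG sMY; apply: genB => // i.
  by rewrite -(groupMr _ (subsetP sMY _ (tM i))).
case/negP: tP.
have sBMY : B \subset M <*> Y.
  apply: genB => [|i]; first by rewrite normsY.
  rewrite -(groupMr _ (subsetP (joing_subl M Y) _ (tM i))).
  by rewrite (subsetP (joing_subr _ _)).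
have [|f fH fY] := graph_ghom nB nM nY tiMY factor_min_commute.
  move=> b bB; have := subsetP sBMY b bB; rewrite norm_joinEl; last first.
    by rewrite (subset_trans MG).
  case/mulsgP=> u y uM yY bE; exists u^-1; rewrite ?groupV //.
  have <- : u^-1 * b = b * u^-1 by apply: min_factor_commute; rewrite ?groupV.
  by rewrite bE mulKg.
apply/imsetP; exists f => //; apply/ffunP=> i; rewrite ffunE.
have [_ fM _ _] := ghomP _ _ _ _ fH.
apply: (mulgI (t i)^-1); rewrite mulVg; apply/esym/eqP.
rewrite -in_set1 -set1gE -tiMY inE groupM ?groupV ?fM ?tM //=.
have -> : (t i)^-1 * f (wB i) = (wB i * t i)^-1 * (wB i * f (wB i)).
  by rewrite invMg -mulgA mulKg.
by rewrite groupM ?groupV ?fY.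
Qed.

End Step.
End Duality.

(** * Cogenerators: families of linear characters *)

Section DualGenerators.
Import GRing.Theory.
Local Open Scope ring_scope.
Local Open Scope group_scope.
Variables (gT : finGroupType) (G : {group gT}).
Implicit Types (X Y Z M B H : {group gT}).
Local Notation stable Y := (G \subset 'N(Y)).

(** Values in [algC] whatever K is: only the kernels matter, and a finite abelian group has as many
    such characters as elements. *)
Definition linear_on H (l : gT -> algC) : Prop :=
  l 1 = 1%R /\ {in H &, forall x y, l (x * y) = (l x * l y)%R}.

Lemma linear_on_irr M l : abelian M -> linear_on M l ->
  exists j : Iirr M, forall x, x \in M -> 'chi_j x = l x.
Proof.
move=> cMM [l1 lM]; pose r x : 'M[algC]_1 := ((l x)%:M)%R.
have rP : mx_repr M r.
  by split=> [|x y xM yM]; rewrite /r ?l1 // lM // scalar_mxM.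
pose chi := cfRepr (MxRepresentation rP).
have chiE x : x \in M -> chi x = l x.
  by move=> xM; rewrite cfunE xM mulr1n /= mxtrace_scalar.
have /irrP[j jE] : chi \in irr M.
  apply: lin_char_irr; apply/andP; split; first exact: cfRepr_char.
  by rewrite chiE ?group1 // l1.
by exists j => x xM; rewrite -jE chiE.
Qed.

Lemma irr_linear_on M (j : Iirr M) : abelian M -> linear_on M 'chi_j.
Proof.
move=> cMM; have lj : 'chi_j \is a linear_char by apply/char_abelianP.
by split; [apply: lin_char1 | move=> x y xM yM; apply: lin_charM].
Qed.

Lemma linear_on_neq0 H l x : linear_on H l -> x \in H -> l x != 0%R.
Proof.
move=> [l1 lM] xH; apply/eqP=> lx; have := lM x x^-1 xH; rewrite groupV => /(_ xH).
by rewrite mulgV l1 lx mul0r => /eqP; rewrite oner_eq0.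
Qed.

Lemma linear_onV H l x : linear_on H l -> x \in H -> l x^-1 = ((l x)^-1)%R.
Proof.
move=> lH xH; have nz := linear_on_neq0 lH xH; have [l1 lM] := lH.
by apply: (mulfI nz); rewrite -lM ?groupV // mulgV l1 divff.
Qed.

(* Dually to normal_gens, no nontrivial normal subgroup of G contained in H
   lies in all the kernels of the linear characters l i of H. *)
Definition normal_cogens m (l : 'I_m -> gT -> algC) H : Prop :=
  (forall i, linear_on H (l i)) /\
  (forall Y, stable Y -> Y \subset H -> (forall i y, y \in Y -> l i y = 1%R) -> Y :=: 1).

Section Step.
Variables (m : nat) (M B : {group gT}).
Hypotheses (minM : is_min_normal G M) (cMM : abelian M).
Hypotheses (BG : B \subset G) (nB : stable B) (tiMB : M :&: B = 1) (cBB : abelian B).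
Let nM : stable M := min_normal_stable minM.
Let MG : M \subset G := min_normal_sub minM.

Lemma normal_cogens_sub (l : 'I_m -> gT -> algC) :
  normal_cogens l (M <*> B) -> normal_cogens l B.
Proof.
have sB : B \subset M <*> B by apply: joing_subr.
move=> [lin cog]; split=> [i|Y nY YB]; last by apply: cog; rewrite ?(subset_trans YB).
by have [l1 lM] := lin i; split=> // x y xB yB; rewrite lM ?(subsetP sB).
Qed.

(* A homomorphism f : M -> B is determined by the characters l i \o f of M, and
   these cannot all be inverse to the restrictions of the l i to M: otherwise the
   graph of f would lie in all the kernels. *)
Lemma card_ghom_cogens (l : 'I_m -> gT -> algC) :
  normal_cogens l (M <*> B) -> (#|ghom G M B| < #|M| ^ m)%N.
Proof.
move=> cogl; have [linB cogB] := normal_cogens_sub cogl.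
have [lin cog] := cogl.
pose idx (k : gT -> algC) : Iirr M := odflt 0%R [pick j | [forall x in M, 'chi_j x == k x]].
have idxP k : linear_on M k -> forall x, x \in M -> 'chi_(idx k) x = k x.
  move=> /(linear_on_irr cMM)[j jE] x xM; rewrite /idx; case: pickP =>
    [j' /forall_inP E | /(_ j)].
    by apply/eqP/E.
  by case/negP; apply/forall_inP=> y yM; rewrite jE.
pose Phi (f : {ffun gT -> gT}) := [ffun i : 'I_m => idx (fun x => l i (f x))].
have linf f i : f \in ghom G M B -> linear_on M (fun x => l i (f x)).
  move=> fH; split; first by rewrite (ghom1 fH); case: (linB i).
  by case/ghomP: fH => _ fB fM _ x y xM yM; rewrite fM //; case: (linB i) => _ ->; rewrite ?fB.
have injPhi : {in ghom G M B &, injective Phi}.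
  move=> f f' fH fH' E; apply: (ghom_ext fH fH').
  have [[_ fB fM fJ] [_ fB' fM' fJ']] := (ghomP _ _ _ _ fH, ghomP _ _ _ _ fH').
  have gY : group_set [set (f x)^-1 * f' x | x in M].
    apply/group_setP; split.
      by apply/imsetP; exists 1; rewrite ?(ghom1 fH) ?(ghom1 fH') ?mulVg.
    move=> _ _ /imsetP[x xM ->] /imsetP[y yM ->]; apply/imsetP; exists (x * y);
      rewrite ?groupM //.
    rewrite fM // fM' // invMg !mulgA; congr (_ * _); rewrite -[LHS]mulgA.
    have c u v : u \in B -> v \in B -> u * v = v * u by move=> uB vB; apply: (centsP cBB).
    by rewrite -!mulgA (c (f' x)) ?groupV ?fB ?fB' // !mulgA (c (f x)^-1) ?groupV ?fB.
  have Y1 : [set (f x)^-1 * f' x | x in M] = 1.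
    apply: (cogB (Group gY)).
    - apply/subsetP=> g gG; rewrite inE; apply/subsetP=> _ /imsetP[_ /imsetP[x xM ->] ->].
      apply/imsetP; exists (x ^ g); first by rewrite (stable_conj _ nM gG).
      by rewrite fJ // fJ' // conjMg conjVg.
    - by apply/subsetP=> _ /imsetP[x xM ->]; rewrite groupM ?groupV ?fB ?fB'.
    - move=> i _ /imsetP[x xM ->]; have [_ ->] := linB i; rewrite ?groupV ?fB ?fB' //.
      rewrite (linear_onV (linB i)) ?fB //.
      have -> : l i (f' x) = l i (f x).
        rewrite -(idxP _ (linf f i fH)) // -(idxP _ (linf f' i fH')) //.
        by have := congr1 (fun t : {ffun _} => t i) E; rewrite !ffunE => ->.
      by rewrite mulVf // (linear_on_neq0 (linB i)) ?fB.
  move=> x xM; apply/esym/(mulgI (f x)^-1)/eqP; rewrite mulVg -in_set1 -set1gE -Y1.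
  by apply/imsetP; exists x.
rewrite -(card_in_imset injPhi) -[m in (#|M| ^ m)%N]card_ord -(card_Iirr_abelian cMM)
  -card_ffun.
have sM : M \subset M <*> B by apply: joing_subl.
have linV i : linear_on M (fun x => l i x^-1).
  have [l1 lM] := lin i; split=> [|x y xM yM]; first by rewrite invg1.
  by rewrite invMg mulrC lM ?groupV ?(subsetP sM).
apply/proper_card/properP; split; first exact/subsetP.
exists [ffun i => idx (fun x => l i x^-1)] => //; apply/imsetP=> -[f fH E].
have [Z [nZ ZE]] := ghom_graph fH nM (min_factor_commute minM BG nB tiMB).
have [_ fB fM fJ] := ghomP _ _ _ _ fH.
have Z1 : Z :=: 1.
  apply: cog => //.
    apply/subsetP=> z; rewrite ZE => /imsetP[x xM ->].
    by rewrite groupM ?(subsetP sM _ xM) ?(subsetP (joing_subr M B) _ (fB x xM)).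
  move=> i z; rewrite ZE => /imsetP[x xM ->]; have [l1 lM] := lin i.
  rewrite lM ?(subsetP sM _ xM) ?(subsetP (joing_subr M B) _ (fB x xM)) //.
  have -> : l i (f x) = l i x^-1.
    rewrite -(idxP _ (linf f i fH)) // -(idxP _ (linV i)) //.
    by have := congr1 (fun t : {ffun _} => t i) E; rewrite !ffunE => ->.
  by rewrite (linear_onV (lin i)) ?(subsetP sM) // divff // (linear_on_neq0 (lin i))
    ?(subsetP sM).
case/negP: (min_normal_nt minM); apply/eqP/trivgP/subsetP=> x xM.
have : x * f x \in Z by rewrite ZE; apply/imsetP; exists x.
rewrite Z1 => /set1P E1; rewrite /= -tiMB inE xM /=.
by rewrite -(groupMr _ (fB x xM)) E1 group1.
Qed.

(** A homomorphism f is bad for at most one tuple t of characters of M, because its graph lying in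
    the kernels determines t on M. As there are fewer homomorphisms than tuples, some t has no bad
    f. *)
Lemma normal_cogens_extend (l : 'I_m -> gT -> algC) : normal_cogens l B ->
  (#|ghom G M B| < #|M| ^ m)%N ->
  exists l' : 'I_m -> gT -> algC, normal_cogens l' (M <*> B).
Proof.
move=> [lin cog] lt.
pose bad (t : {ffun 'I_m -> Iirr M}) (f : {ffun gT -> gT}) :=
  [forall i, [forall x in M, 'chi_(t i) x * l i (f x) == 1]%R].
have [t tP] : exists t, forall f, f \in ghom G M B -> ~~ bad t f.
  have [/existsP[t /forall_inP tP]|] := boolP [exists t, [forall f in ghom G M B, ~~ bad t f]].
    by exists t.
  rewrite negb_exists => /forallP H; move: lt; rewrite ltnNge => /negP[].
  have {H} ex t : exists f, (f \in ghom G M B) && bad t f.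
    by move: (H t); rewrite negb_forall_in => /exists_inP[f fH]; rewrite negbK => E;
      exists f; rewrite fH.
  pose F t := xchoose (ex t); have FP t : (F t \in ghom G M B) && bad t (F t) := xchooseP (ex
    t).
  have injF : injective F.
    move=> t t' E; apply/ffunP=> i; apply: irr_inj; apply/cfun_inP=> x xM.
    have /andP[fH /forallP/(_ i)/forall_inP/(_ x xM)/eqP E1] := FP t.
    have /andP[_ /forallP/(_ i)/forall_inP/(_ x xM)/eqP E2] := FP t'.
    have [_ fB _ _] := ghomP _ _ _ _ fH.
    by apply: (mulIf (linear_on_neq0 (lin i) (fB x xM))); rewrite E1 -E2 E.
  rewrite -[m]card_ord -(card_Iirr_abelian cMM) -card_ffun -(card_codom injF).
  by apply/subset_leq_card/subsetP=> _ /codomP[t ->]; case/andP: (FP t).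
have inMB x : x \in M <*> B -> x \in M * B.
  by rewrite norm_joinEr // (subset_trans BG).
pose l' i x := ('chi_(t i) (divgr M B x) * l i (remgr M B x))%R.
have l'E i u b : u \in M -> b \in B -> l' i (u * b) = ('chi_(t i) u * l i b)%R.
  by move=> uM bB; rewrite /l' (divgrMid tiMB) ?(remgrMid tiMB).
have linM i := irr_linear_on (t i) cMM.
exists l'; split=> [i|Y nY YMB kerY].
  split; first by rewrite -[1]mulg1 l'E //; have [-> _] := linM i; have [-> _] := lin i;
    rewrite mulr1.
  move=> _ _ /(join_prodP minM BG)[u uM [b bB ->]] /(join_prodP minM BG)[v vM [c cB ->]].
  have -> : u * b * (v * c) = u * v * (b * c).
    rewrite -!mulgA; congr (_ * _); rewrite !mulgA; congr (_ * _).
    by apply/esym; apply: (min_factor_commute minM BG nB tiMB).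
  rewrite !l'E ?groupM //; have [_ ->] := linM i; rewrite // ; have [_ ->] := lin i; rewrite //.
  by rewrite mulrACA.
have YB1 : Y :&: B = 1.
  apply: (cog (Y :&: B)%G); rewrite ?subsetIr ?normsI // => i y /setIP[yY yB].
  have := kerY i y yY; rewrite -[y]mul1g l'E //; have [-> _] := linM i.
  by rewrite mul1r mul1g.
have nBY : stable (B <*> Y)%G by apply: normsY.
(* Either Y lies in B, where it is trivial by the case of B, or M is covered by B <*> Y and Y
   contains the graph of a homomorphism that is bad for t. *)
have [YM | sMY] := min_normal_dichotomy minM nBY.
- apply/trivgP/subsetP=> y yY.
  have /(join_prodP minM BG)[u uM [b bB yE]] := subsetP YMB y yY.
  have u1 : u = 1.
    apply/set1P; rewrite -[[set 1]]/(1 : {set gT}) -YM inE uM /=.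
    have -> : u = y * b^-1 by rewrite yE mulgK.
    by rewrite groupM ?groupV ?(subsetP (joing_subr B Y) _ yY) ?(subsetP (joing_subl B Y) _ bB).
  by rewrite -YB1 inE yY yE u1 mul1g.
have tiBY : B :&: Y = 1 by rewrite setIC.
have [|f fH fY] := graph_ghom nM nB nY tiBY (min_factor_commute minM BG nB tiMB).
  move=> x xM; have := subsetP sMY x xM; rewrite /= norm_joinEl; last first.
    by rewrite (subset_trans BG).
  case/mulsgP=> b y bB yY xE; exists b^-1; rewrite ?groupV //.
  by rewrite (min_factor_commute minM BG nB tiMB) ?groupV // xE mulKg.
case/negP: (tP f fH); apply/forallP=> i; apply/forall_inP=> x xM.
have [_ fB _ _] := ghomP _ _ _ _ fH.
by rewrite -l'E ?fB // kerY ?fY.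
Qed.

End Step.
End DualGenerators.

(** * Counting equivariant homomorphisms *)

Section HomCount.
Local Open Scope group_scope.
Variables (gT : finGroupType) (G : {group gT}).
Implicit Types (X Y Z M B H : {group gT}) (s : seq {group gT}).
Local Notation stable Y := (G \subset 'N(Y)).

Definition restr X (F : gT -> gT) : {ffun gT -> gT} := [ffun x => if x \in X then F x else 1].

Lemma restrE X F x : x \in X -> restr X F x = F x.
Proof. by rewrite ffunE => ->. Qed.

Lemma restr_ghom X Y F : stable X -> (forall x, x \in X -> F x \in Y) ->
  (forall x y, x \in X -> y \in X -> F (x * y) = F x * F y) ->
  (forall x g, x \in X -> g \in G -> F (x ^ g) = F x ^ g) ->
  restr X F \in ghom G X Y.
Proof.
move=> nX FY FM FJ; apply/ghomP; split=> [x xX|x xX|x y xX yX|x g xX gG].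
- by rewrite ffunE (negPf xX).
- by rewrite restrE ?FY.
- by rewrite !restrE ?groupM ?FM.
- by rewrite !restrE ?(stable_conj _ nX gG) ?FJ.
Qed.

Lemma restr1_ghom X Y : stable X -> restr X (fun=> 1) \in ghom G X Y.
Proof. by move=> nX; apply: restr_ghom => // *; rewrite ?mulg1 ?conj1g ?group1. Qed.

Lemma ghom_stable_img X Y f : stable X -> f \in ghom G X Y ->
  exists Z, stable Z /\ forall z, (z \in Z) = (z \in f @: X).
Proof.
move=> nX fH; have f1 := ghom1 fH; case/ghomP: fH => _ fY fM fJ.
have gZ : group_set (f @: X).
  apply/group_setP; split; first by apply/imsetP; exists 1.
  move=> _ _ /imsetP[x xX ->] /imsetP[y yX ->]; rewrite -fM //.
  by apply: imset_f; rewrite groupM.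
exists (Group gZ); split=> //; apply/subsetP=> g gG; rewrite inE.
apply/subsetP=> _ /imsetP[_ /imsetP[x xX ->] ->]; rewrite -fJ //.
by apply: imset_f; rewrite (stable_conj _ nX gG).
Qed.

Lemma ghom_stable_ker X Y f : stable X -> f \in ghom G X Y ->
  exists Z, stable Z /\ forall z, (z \in Z) = (z \in X) && (f z == 1).
Proof.
move=> nX fH; have f1 := ghom1 fH; case/ghomP: fH => _ fY fM fJ.
have gZ : group_set [set x in X | f x == 1].
  apply/group_setP; split; first by rewrite inE group1 f1 eqxx.
  move=> x y; rewrite !inE => /andP[xX /eqP fx] /andP[yX /eqP fy].
  by rewrite groupM // fM // fx fy mulg1 eqxx.
exists (Group gZ); split=> [|z]; last by rewrite inE.
apply/subsetP=> g gG; rewrite inE; apply/subsetP=> _ /imsetP[x + ->].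
by rewrite !inE (stable_conj _ nX gG) => /andP[xX /eqP fx]; rewrite xX fJ // fx conj1g eqxx.
Qed.

(** A nontrivial homomorphism f between minimal normal subgroups is an isomorphism; with g its
    inverse, sending h to g h g injects one set into the other. If there is no such f, only the
    trivial homomorphism has to be matched. *)
Lemma card_ghom_min_le M X : is_min_normal G M -> is_min_normal G X ->
  #|ghom G M X| <= #|ghom G X M|.
Proof.
move=> minM minX; have nM := min_normal_stable minM; have nX := min_normal_stable minX.
have [/exists_inP[f fH fn1]|] := boolP [exists f in ghom G M X, f != restr M (fun=> 1)];
  last first.
  rewrite negb_exists_in => /forall_inP triv.
  apply: (@leq_trans 1); last first.
    by rewrite card_gt0; apply/set0Pn; exists (restr X (fun=> 1)); apply: restr1_ghom.
  rewrite -(cards1 (restr M (fun=> 1))); apply/subset_leq_card/subsetP=> f /triv.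
  by rewrite negbK inE.
have [f0 fX fM fJ] := ghomP _ _ _ _ fH.
have [x0 x0M fx0] : exists2 x, x \in M & f x != 1.
  apply/exists_inP; apply: contraR fn1 => /exists_inPn triv; apply/eqP.
  by apply: (ghom_ext fH (restr1_ghom _ nM)) => x xM; rewrite restrE //; apply/eqP;
    have := triv x xM; rewrite negbK.
have injf : {in M &, injective f}.
  have [Z [nZ ZE]] := ghom_stable_ker nM fH.
  have [tiMZ | /subsetP/(_ x0 x0M)] := min_normal_dichotomy minM nZ; last first.
    by rewrite ZE x0M (negPf fx0).
  move=> x y xM yM E; apply: (mulgI x^-1); rewrite mulVg; apply/esym/eqP.
  rewrite -in_set1 -set1gE -tiMZ inE ZE groupM ?groupV //= fM ?groupV // (ghomV fH) //.
  by rewrite E mulVg.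
have surjf y : y \in X -> exists2 x, x \in M & f x = y.
  have [Z [nZ ZE]] := ghom_stable_img nM fH.
  have [tiXZ | /subsetP sXZ yX] := min_normal_dichotomy minX nZ; last first.
    by have := sXZ y yX; rewrite ZE => /imsetP[x xM ->]; exists x.
  case/negP: fx0; rewrite -in_set1 -set1gE -tiXZ inE fX //= ZE.
  exact: imset_f.
pose g y := odflt 1 [pick x in M | f x == y].
have gP y : y \in X -> g y \in M /\ f (g y) = y.
  move=> yX; rewrite /g; case: pickP => [x /andP[xM /eqP] // | none].
  by have [x xM xE] := surjf y yX; have := none x; rewrite xM xE eqxx.
have gf x : x \in M -> g (f x) = x.
  by move=> xM; have [gM] := gP (f x) (fX x xM); apply: injf.
pose Phi (h : {ffun gT -> gT}) := restr X (fun y => g (h (g y))).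
have gH y y' : y \in X -> y' \in X -> g (y * y') = g y * g y'.
  move=> yX yX'; have [gM fg] := gP y yX; have [gM' fg'] := gP y' yX'.
  by rewrite -{1}fg -{1}fg' -fM // gf ?groupM.
have gJ y z : y \in X -> z \in G -> g (y ^ z) = g y ^ z.
  move=> yX zG; have [gM fg] := gP y yX.
  by rewrite -{1}fg -fJ // gf // (stable_conj _ nM zG).
have PhiH h : h \in ghom G M X -> Phi h \in ghom G X M.
  case/ghomP=> _ hX hM hJ; have gM y : y \in X -> g y \in M by case/gP.
  apply: restr_ghom => // [x xX|x y xX yX|x z xX zG]; first by rewrite gM ?hX ?gM.
    by rewrite gH // hM ?gM // gH ?hX ?gM.
  by rewrite gJ // hJ ?gM // gJ ?hX ?gM.
have injPhi : {in ghom G M X &, injective Phi}.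
  move=> h h' hH hH' E; apply: (ghom_ext hH hH') => x xM.
  have [[_ hX _ _] [_ hX' _ _]] := (ghomP _ _ _ _ hH, ghomP _ _ _ _ hH').
  have := congr1 (fun t : {ffun gT -> gT} => f (t (f x))) E.
  rewrite /= !restrE ?fX // gf //.
  by have [_ ->] := gP (h x) (hX x xM); have [_ ->] := gP (h' x) (hX' x xM).
rewrite -(card_in_imset injPhi); apply/subset_leq_card/subsetP=> _ /imsetP[h hH ->].
exact: PhiH.
Qed.

Lemma card_ghom_min M X : is_min_normal G M -> is_min_normal G X ->
  #|ghom G M X| = #|ghom G X M|.
Proof. by move=> minM minX; apply/eqP; rewrite eqn_leq !card_ghom_min_le. Qed.

Section Product.
Variables X B M : {group gT}.
Hypotheses (minX : is_min_normal G X) (BG : B \subset G) (nB : stable B) (tiXB : X :&: B = 1).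
Hypotheses (nM : stable M).
Let nX := min_normal_stable minX.
Let XG := min_normal_sub minX.

Let cXB x y : x \in X -> y \in B -> y * x = x * y.
Proof. by move=> xX yB; apply/esym/(min_factor_commute minX BG nB tiXB). Qed.

Let mulXB x b x' b' : b \in B -> x' \in X -> x * b * (x' * b') = x * x' * (b * b').
Proof. by move=> bB xX'; rewrite -!mulgA; congr (_ * _); rewrite !mulgA (cXB xX' bB). Qed.

Let nXB : stable (X <*> B). Proof. exact: normsY. Qed.

Lemma card_ghom_to_prod : #|ghom G M (X <*> B)| = (#|ghom G M X| * #|ghom G M B|)%N.
Proof.
pose F (p : {ffun gT -> gT} * {ffun gT -> gT}) := restr M (fun x => p.1 x * p.2 x).
have injF : {in setX (ghom G M X) (ghom G M B) &, injective F}.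
  move=> [f g] [f' g'] /setXP[/= fH gH] /setXP[/= fH' gH'] E.
  have [_ fX _ _] := ghomP _ _ _ _ fH; have [_ gB _ _] := ghomP _ _ _ _ gH.
  have [_ fX' _ _] := ghomP _ _ _ _ fH'; have [_ gB' _ _] := ghomP _ _ _ _ gH'.
  have E1 x : x \in M -> f x * g x = f' x * g' x.
    by move=> xM; have := congr1 (fun t : {ffun gT -> gT} => t x) E; rewrite !restrE.
  congr pair; [apply: (ghom_ext fH fH') | apply: (ghom_ext gH gH')] => x xM.
    by rewrite -[LHS](divgrMid tiXB (fX x xM) (gB x xM)) E1 // divgrMid ?fX' ?gB'.
  by rewrite -[LHS](remgrMid tiXB (fX x xM) (gB x xM)) E1 // remgrMid ?fX' ?gB'.
rewrite -cardsX -(card_in_imset injF); apply: eq_card => h; apply/idP/imsetP =>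
  [hH | [[f g] /setXP[/= fH gH] ->]].
  have [_ hXB hM hJ] := ghomP _ _ _ _ hH.
  have dec x : x \in M -> exists u b, [/\ u \in X, b \in B & h x = u * b].
    by move=> xM; have /(join_prodP minX BG)[u uX [b bB E]] := hXB x xM; exists u, b.
  exists (restr M (fun x => divgr X B (h x)), restr M (fun x => remgr X B (h x))).
    apply/setXP; split; apply: restr_ghom => //= [x xM|x y xM yM|x z xM zG].
    - by have [u [b [uX bB ->]]] := dec x xM; rewrite divgrMid.
    - rewrite hM //; have [u [b [uX bB ->]]] := dec x xM; have [v [c [vX cB ->]]] := dec y yM.
      by rewrite mulXB // !divgrMid ?groupM.
    - rewrite hJ //; have [u [b [uX bB ->]]] := dec x xM.
      by rewrite conjMg !divgrMid ?(stable_conj _ nX zG) ?(stable_conj _ nB zG).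
    - by have [u [b [uX bB ->]]] := dec x xM; rewrite remgrMid.
    - rewrite hM //; have [u [b [uX bB ->]]] := dec x xM; have [v [c [vX cB ->]]] := dec y yM.
      by rewrite mulXB // !remgrMid ?groupM.
    - rewrite hJ //; have [u [b [uX bB ->]]] := dec x xM.
      by rewrite conjMg !remgrMid ?(stable_conj _ nX zG) ?(stable_conj _ nB zG).
  apply/ffunP=> x; rewrite ffunE /=; have [xM|xM] := boolP (x \in M);
    last by case/ghomP: hH => ->.
  by rewrite !restrE // -divgr_eq.
have [_ fX fM fJ] := ghomP _ _ _ _ fH; have [_ gB gM gJ] := ghomP _ _ _ _ gH.
apply: restr_ghom => //= [x xM|x y xM yM|x z xM zG].
- by rewrite groupM ?(subsetP (joing_subl X B) _ (fX x xM)) ?(subsetP (joing_subr X B) _ (gB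
  x xM)).
- by rewrite fM // gM // [RHS]mulXB ?fX ?gB.
- by rewrite fJ // gJ // conjMg.
Qed.

Hypothesis cMM : abelian M.

Lemma card_ghom_from_prod : #|ghom G (X <*> B) M| = (#|ghom G X M| * #|ghom G B M|)%N.
Proof.
pose F (p : {ffun gT -> gT} * {ffun gT -> gT}) :=
  restr (X <*> B) (fun x => p.1 (divgr X B x) * p.2 (remgr X B x)).
have sX := joing_subl X B; have sB := joing_subr X B.
have FE p u b : u \in X -> b \in B -> F p (u * b) = p.1 u * p.2 b.
  move=> uX bB; rewrite restrE; last by rewrite groupM ?(subsetP sX _ uX) ?(subsetP sB _ bB).
  by rewrite divgrMid ?remgrMid.
have injF : {in setX (ghom G X M) (ghom G B M) &, injective F}.
  move=> [f g] [f' g'] /setXP[/= fH gH] /setXP[/= fH' gH'] E.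
  have E1 u b : u \in X -> b \in B -> f u * g b = f' u * g' b.
    by move=> uX bB; have := congr1 (fun t : {ffun gT -> gT} => t (u * b)) E; rewrite !FE.
  congr pair; [apply: (ghom_ext fH fH') | apply: (ghom_ext gH gH')] => x xX.
    by have := E1 x 1 xX (group1 _); rewrite (ghom1 gH) (ghom1 gH') !mulg1.
  by have := E1 1 x (group1 _) xX; rewrite (ghom1 fH) (ghom1 fH') !mul1g.
rewrite -cardsX -(card_in_imset injF); apply: eq_card => h; apply/idP/imsetP =>
  [hH | [[f g] /setXP[/= fH gH] ->]].
  have [h0 hXB hM hJ] := ghomP _ _ _ _ hH.
  exists (restr X h, restr B h).
    apply/setXP; split; apply: restr_ghom => //= [x xM|x y xM yM|x z xM zG].
    - by rewrite hXB ?(subsetP sX _ xM).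
    - by rewrite hM ?(subsetP sX _ xM) ?(subsetP sX _ yM).
    - by rewrite hJ ?(subsetP sX _ xM).
    - by rewrite hXB ?(subsetP sB _ xM).
    - by rewrite hM ?(subsetP sB _ xM) ?(subsetP sB _ yM).
    - by rewrite hJ ?(subsetP sB _ xM).
  apply/ffunP=> x; have [xXB|xXB] := boolP (x \in X <*> B);
    last by rewrite h0 // ffunE (negPf xXB).
  have /(join_prodP minX BG)[u uX [b bB ->]] := xXB.
  by rewrite FE //= !restrE // hM ?(subsetP sX _ uX) ?(subsetP sB _ bB).
have [_ fX fM fJ] := ghomP _ _ _ _ fH; have [_ gB gM gJ] := ghomP _ _ _ _ gH.
have dec x : x \in X <*> B -> exists u b, [/\ u \in X, b \in B & x = u * b].
  by case/(join_prodP minX BG)=> u uX [b bB E]; exists u, b.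
apply: restr_ghom => //= [x /dec[u [b [uX bB ->]]]|_ _ /dec[u [b [uX bB ->]]] /dec[v [c [vX
  cB ->]]]|_ z /dec[u [b [uX bB ->]]] zG].
- by rewrite divgrMid // remgrMid // groupM ?fX ?gB.
- rewrite mulXB // !divgrMid ?remgrMid ?groupM // fM // gM // -!mulgA; congr (_ * _).
  by rewrite !mulgA; congr (_ * _); apply: (centsP cMM); rewrite ?fX ?gB.
- by rewrite conjMg !divgrMid ?remgrMid ?(stable_conj _ nX zG) ?(stable_conj _ nB zG) // fJ
  // gJ // conjMg.
Qed.

End Product.

Definition joins s : {group gT} := foldr (fun M H => (M <*> H)%G) 1%G s.

Lemma joins_sub s H : (joins s \subset H) = all (fun M => M \subset H) s.
Proof. by elim: s => [|M s IH] /=; rewrite ?sub1G // join_subG IH. Qed.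

Lemma joins_stable s : all (is_min_normal G) s -> stable (joins s).
Proof.
elim: s => [|M s IH] /=; first by rewrite norms1.
by case/andP=> /min_normal_stable nM /IH nB; rewrite normsY.
Qed.

Lemma joins_subG s : all (is_min_normal G) s -> joins s \subset G.
Proof. by rewrite joins_sub => /allP mins; apply/allP=> M /mins/min_normal_sub. Qed.

(** This allows induction over redundant lists: a further minimal normal subgroup is independent of
    the earlier ones or adds nothing. *)
Lemma joins_cons M s : is_min_normal G M -> all (is_min_normal G) s ->
  M :&: joins s = 1 \/ joins (M :: s) = joins s.
Proof.
move=> minM mins; have [|sM] := min_normal_dichotomy minM (joins_stable mins); first by left.
by right; apply/val_inj/joing_idPr.
Qed.

Lemma joins_abelian s : all (is_min_normal G) s -> all (fun M =>
  abelian M) s -> abelian (joins s).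
Proof.
elim: s => [|M s IH] /=; first by rewrite abelian1.
move=> /andP[minM mins] /andP[cMM cs].
have [ti | E] := joins_cons minM mins; last by rewrite -[X in abelian X]/(val (joins (M ::
  s))) E IH.
rewrite abelianY cMM IH //=; apply/centsP=> x xM y yB.
exact/esym/(min_factor_commute minM (joins_subG mins) (joins_stable mins) ti).
Qed.

(** Both counts are multiplicative in the list, which leaves two minimal normal subgroups, that is,
    [card_ghom_min]. *)
Lemma card_ghom_swap M s : is_min_normal G M -> abelian M ->
  all (is_min_normal G) s -> #|ghom G M (joins s)| = #|ghom G (joins s) M|.
Proof.
move=> minM cMM; have nM := min_normal_stable minM; elim: s => [|X s IH] /=.
  have triv (A B : {group gT}) f : f \in ghom G A B -> (A :=: 1) \/ (B :=: 1) -> f = restr A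
    (fun=> 1).
    move=> fH; have f1 := ghom1 fH; case/ghomP: fH => f0 fB _ _ AB; apply/ffunP=> x;
      rewrite ffunE.
    case: ifP => [xA|/negbT/f0//]; case: AB => [E|E]; first by move: xA; rewrite E => /set1P->.
    by have := fB x xA; rewrite E => /set1P.
  have card1 (A B : {group gT}) : stable A -> (A :=: 1) \/ (B :=: 1) -> #|ghom G A B| = 1%N.
    move=> nA AB; rewrite -(cards1 (restr A (fun=> 1))); apply: eq_card => f; rewrite in_set1.
    by apply/idP/eqP => [/triv->//|->]; apply: restr1_ghom.
  by rewrite !card1 ?norms1 //; [left | right].
move=> /andP[minX mins]; have [ti | E] := joins_cons minX mins; last first.
  by rewrite -![(X <*> joins s)%G]/(joins (X :: s)) E IH.
have [sG nB] := (joins_subG mins, joins_stable mins).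
by rewrite card_ghom_to_prod // card_ghom_from_prod // IH // card_ghom_min.
Qed.

(* A minimal normal subgroup can be added to B, with m generators or with m
   characters, exactly when #|ghom G B M|, resp. #|ghom G M B|, is less than
   #|M| ^ m, and these two numbers agree. *)
Theorem normal_gens_cogens m s : all (is_min_normal G) s -> all (fun M => abelian M) s ->
  (exists w : 'I_m -> gT, normal_gens G w (joins s)) <->
  (exists l : 'I_m -> gT -> algC, normal_cogens G l (joins s)).
Proof.
elim: s => [|M s IH] /=.
  split=> _; last by exists (fun=> 1); split=> [i|Y _ _]; rewrite ?group1 ?sub1G.
  exists (fun _ _ => 1%R); split=> [i|Y _ + _]; last by move/trivgP.
  by split=> // x y _ _; rewrite GRing.mulr1.
move=> /andP[minM mins] /andP[cMM cs].
have [ti | E] := joins_cons minM mins; last first.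
  by rewrite -[(M <*> joins s)%G]/(joins (M :: s)) E; apply: IH.
have [[sG nB] cB] := (joins_subG mins, joins_stable mins, joins_abelian mins cs).
have {IH} IH := IH mins cs; split=> [[w genw] | [l cogl]].
  have [wM [wB [wMM wBB genw']]] := normal_gens_split minM sG nB ti genw.
  have genB := normal_gens_proj minM sG nB ti wMM wBB genw'.
  have [l cogl] := IH.1 (ex_intro _ wB genB).
  apply: (normal_cogens_extend minM cMM sG nB ti cogl).
  by rewrite card_ghom_swap // (card_ghom_gens minM sG nB ti wMM wBB genw').
have [w genw] := IH.2 (ex_intro _ l (normal_cogens_sub cogl)).
apply: (normal_gens_extend minM sG nB ti genw).
by rewrite -card_ghom_swap // (card_ghom_cogens minM cMM sG nB ti cB cogl).
Qed.

End HomCount.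

(** * Generators of the socle *)

Section SocleGenerators.
Local Open Scope group_scope.
Variables (gT : finGroupType) (G : {group gT}).
Implicit Types (X Y Z M B H N D : {group gT}) (s : seq {group gT}).
Local Notation stable Y := (G \subset 'N(Y)).

Lemma min_normal_below Y : Y \subset G -> stable Y -> Y :!=: 1 ->
  exists2 M, is_min_normal G M & M \subset Y.
Proof.
move=> sYG nY ntY; have [M minM sMY] := minnormal_exists ntY nY.
by exists M => //; rewrite /is_min_normal minM (subset_trans sMY).
Qed.

Lemma socle_stable : stable (normal_socle G).
Proof.
apply: norms_gen; apply: norms_bigcup; apply/bigcapsP=> M.
exact: min_normal_stable.
Qed.

Lemma min_normal_socle M : is_min_normal G M -> M \subset normal_socle G.
Proof. by move=> minM; apply/sub_gen/bigcup_sup. Qed.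

(* In the socle, Y has a complement that is stable under G, and that complement
   meets H trivially, since it contains no minimal normal subgroup of H. *)
Lemma socle_cover H Y : H \subset G -> H \subset normal_socle G -> stable H -> stable Y -> Y
  \subset H ->
  (forall M, is_min_normal G M -> M \subset H -> M \subset Y) -> Y :=: H.
Proof.
move=> sHG sHS nH nY sYH minY.
pose P D := (stable D) && (Y :&: D == 1) && (D \subset G).
have P1 : P 1%G by rewrite /P norms1 sub1G setIC (setIidPl (sub1G _)) eqxx.
have [D /maxgroupP[/andP[/andP[nD /eqP tiYD] sDG] maxD] _] := maxgroup_exists (gP := P) P1.
have sSYD : normal_socle G \subset Y <*> D.
  rewrite gen_subG; apply/bigcupsP=> M minM.
  have nYD : stable (Y <*> D)%G by apply: normsY.
  have nM := min_normal_stable minM; have sMG := min_normal_sub minM.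
  have [tiM | //] := min_normal_dichotomy minM nYD.
  have PMD : P (M <*> D)%G.
    rewrite /P normsY //= join_subG sDG sMG !andbT; apply/eqP/trivgP/subsetP=> y.
    rewrite /= norm_joinEr ?(subset_trans sDG) // => /setIP[yY /mulsgP[u d uM dD E]].
    have u1 : u \in [1].
      rewrite -[[1]]/(1 : {set gT}) -tiM inE uM /=.
      have -> : u = y * d^-1 by rewrite E mulgK.
      by rewrite groupM ?groupV ?(subsetP (joing_subl Y D) _ yY) ?(subsetP (joing_subr Y D) _
        dD).
    by rewrite -tiYD inE yY E (set1P u1) mul1g.
  have <- : (M <*> D)%G :=: D by apply: maxD; rewrite ?joing_subr.
  by rewrite (subset_trans (joing_subl M D)) ?joing_subr.
have nsHD : stable (H :&: D) by apply: normsI.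
apply/eqP; rewrite eqEsubset sYH; apply/subsetP=> h hH.
have : h \in Y <*> D by rewrite (subsetP sSYD) // (subsetP sHS).
rewrite norm_joinEr ?(subset_trans sDG) // => /mulsgP[y d yY dD E].
have dH : d \in H by rewrite -(groupMl _ (subsetP sYH _ yY)) -E.
suff HD1 : H :&: D = 1.
  have /set1P d1 : d \in [1] by rewrite -[[1]]/(1 : {set gT}) -HD1 inE dH.
  by rewrite E d1 mulg1.
apply/eqP/negPn/negP=> nt.
have [|M minM] := @min_normal_below (H :&: D)%G _ nsHD nt; first by rewrite subIset ?sHG.
rewrite subsetI => /andP[sMH sMD]; case/negP: (min_normal_nt minM).
by rewrite -subG1 -tiYD subsetI sMD minY.
Qed.

Section Below.
Variable N : {group gT}.
Hypotheses (sNG : N \subset G) (nN : stable N).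

Definition abelian_min_normals : seq {group gT} :=
  [seq M <- enum {group gT} | [&& is_min_normal G M, abelian M & M \subset N]].

Definition nonabelian_min_normals : seq {group gT} :=
  [seq M <- enum {group gT} | [&& is_min_normal G M, ~~ abelian M & M \subset N]].

Lemma mem_abelian_min_normals M :
  (M \in abelian_min_normals) = [&& is_min_normal G M, abelian M & M \subset N].
Proof. by rewrite mem_filter mem_enum andbT. Qed.

Lemma mem_nonabelian_min_normals M :
  (M \in nonabelian_min_normals) = [&& is_min_normal G M, ~~ abelian M & M \subset N].
Proof. by rewrite mem_filter mem_enum andbT. Qed.

Lemma abelian_min_normalsP : all (is_min_normal G) abelian_min_normals /\
  all (fun M => abelian M) abelian_min_normals.
Proof. by split; apply/allP=> M; rewrite mem_abelian_min_normals => /and3P[]. Qed.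

Lemma nonabelian_min_normalsP : all (is_min_normal G) nonabelian_min_normals.
Proof. by apply/allP=> M; rewrite mem_nonabelian_min_normals => /and3P[]. Qed.

Let A := joins abelian_min_normals.
Let T := joins nonabelian_min_normals.

Lemma abelian_part_abelian : abelian A.
Proof. by have [m a] := abelian_min_normalsP; apply: joins_abelian m a. Qed.

Lemma abelian_part_sub : A \subset N.
Proof. by rewrite joins_sub; apply/allP=> M; rewrite mem_abelian_min_normals => /and3P[]. Qed.

Lemma nonabelian_part_sub : T \subset N.
Proof. by rewrite joins_sub; apply/allP=> M; rewrite mem_nonabelian_min_normals =>
  /and3P[]. Qed.

Lemma sub_joins M s : M \in s -> M \subset joins s.
Proof. by move=> Ms; have := joins_sub s (joins s); rewrite subxx => /esym/allP/(_ M Ms). Qed.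

Lemma min_normal_parts M : is_min_normal G M -> M \subset N -> M \subset A \/ M \subset T.
Proof.
move=> minM sMN; have [cMM | ncMM] := boolP (abelian M).
  by left; apply: sub_joins; rewrite mem_abelian_min_normals minM cMM.
by right; apply: sub_joins; rewrite mem_nonabelian_min_normals minM ncMM.
Qed.

Lemma min_normal_commute M M' x y : is_min_normal G M -> is_min_normal G M' -> M != M' ->
  x \in M -> y \in M' -> commute x y.
Proof.
move=> minM minM' neq; have [nM nM'] := (min_normal_stable minM, min_normal_stable minM').
apply: (stable_commute (min_normal_sub minM) (min_normal_sub minM') nM nM').
have [//|sMM'] := min_normal_dichotomy minM nM'.
have [tiM|sM'M] := min_normal_dichotomy minM' nM; first by rewrite setIC.
by case/eqP: neq; apply/val_inj/eqP; rewrite eqEsubset sMM' sM'M.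
Qed.

Lemma nonabelian_cent_abelian M x a : M \in nonabelian_min_normals -> x \in M -> a \in A ->
  commute x a.
Proof.
rewrite mem_nonabelian_min_normals => /and3P[minM ncMM sMN].
have sMC : A \subset 'C(M).
  rewrite joins_sub; apply/allP=> M'; rewrite mem_abelian_min_normals => /and3P[minM' cMM' _].
  apply/centsP=> y yM' z zM; apply: (min_normal_commute minM' minM) => //.
  by apply: contraNneq ncMM => <-.
by move=> xM aA; apply/esym/(centsP sMC).
Qed.

(** Distinct minimal normal subgroups commute, so multiplying t by a noncentral element of M repairs
    the condition at M without disturbing the others. *)
Lemma exists_noncentralizing :
  exists2 t, t \in T & forall M, M \in nonabelian_min_normals -> t \notin 'C(M).
Proof.
suff : forall s, {subset s <= nonabelian_min_normals} ->
    exists2 t, t \in T & forall M, M \in s -> t \notin 'C(M) by apply.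
elim=> [|M s IH] sub; first by exists 1.
have [|t tT tP] := IH; first by move=> L Ls; apply: sub; rewrite inE Ls orbT.
have Mn : M \in nonabelian_min_normals by apply: sub; rewrite mem_head.
have [tM|tM] := boolP (t \in 'C(M)); last first.
  by exists t => // L; rewrite inE => /orP[/eqP->//|/tP].
have := Mn; rewrite mem_nonabelian_min_normals => /and3P[minM /subsetPn[x xM xC] _].
exists (t * x); first by rewrite groupM // (subsetP (sub_joins Mn)).
move=> L; have [-> _|neq] := eqVneq L M; first by rewrite groupMl.
rewrite inE (negPf neq) => /= Ls; have Ln : L \in nonabelian_min_normals by apply: sub;
  rewrite inE Ls orbT.
have := Ln; rewrite mem_nonabelian_min_normals => /and3P[minL _ _].
rewrite groupMr ?tP //; apply/centP=> y yL.
by apply: (min_normal_commute minM minL) => //; rewrite eq_sym.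
Qed.

Let H := (normal_socle G :&: N)%G.

Lemma socle_part_stable : stable H.
Proof. by apply: normsI => //; apply: socle_stable. Qed.

Lemma normal_closure_stable (X : {set gT}) : stable (normal_closure G X).
Proof.
apply: norms_gen; apply/subsetP=> g gG; rewrite inE;
  apply/subsetP=> _ /imsetP[_ /imset2P[x y xX yG ->] ->].
by rewrite -conjgM; apply/imset2P; exists x (y * g); rewrite ?groupM.
Qed.

Lemma sub_normal_closure (X : {set gT}) : X \subset normal_closure G X.
Proof.
apply/subsetP=> x xX; apply/mem_gen/imset2P; exists x 1; rewrite ?group1 ?conjg1 //.
Qed.

Lemma normal_closure_sub (X : {set gT}) Y : stable Y -> X \subset Y -> normal_closure G X
  \subset Y.
Proof.
move=> nY sXY; rewrite gen_subG; apply/subsetP=> _ /imset2P[x y xX yG ->].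
by rewrite (stable_conj _ nY yG) (subsetP sXY).
Qed.

Lemma normal_closure_id Y : stable Y -> normal_closure G Y = Y.
Proof. by move=> nY; apply/eqP; rewrite eqEsubset normal_closure_sub ?sub_normal_closure. Qed.

Lemma normal_closure0 : normal_closure G set0 = 1.
Proof. by apply/trivgP/normal_closure_sub; rewrite ?norms1 ?sub0set. Qed.

(** A nonabelian M meeting the new normal closure trivially would commute with w * t, hence with t,
    since w lies in the abelian part, which centralizes M. So the closure contains T, in particular
    t, and therefore recovers w. *)
Lemma min_normal_gens_le m (w : 'I_m -> gT) : normal_gens G w A -> (N :!=: 1 -> 0 < m) ->
  min_normal_gens G H <= m.
Proof.
move=> [wA genA] m0; rewrite /min_normal_gens.
case: arg_minnP => [|X0 _ minX0]; first by rewrite normal_closure_id ?socle_part_stable.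
have [t tT tP] := exists_noncentralizing.
have [m_eq0 | m_gt0] := posnP m.
  have N1 : N :=: 1 by apply/eqP; apply: contraTT isT => /m0; rewrite m_eq0.
  have := minX0 set0; rewrite cards0 m_eq0; apply; apply/eqP.
  by rewrite normal_closure0 /H /= N1 setIC (setIidPl (sub1G _)).
pose w' i := if i == Ordinal m_gt0 then w i * t else w i.
pose X := [set w' i | i : 'I_m].
apply: leq_trans (minX0 X _) _; last by rewrite -[X in _ <= X]card_ord leq_imset_card.
have sTH : T \subset H.
  rewrite subsetI nonabelian_part_sub andbT joins_sub; apply/allP=> M.
  by rewrite mem_nonabelian_min_normals => /and3P[minM _ _]; apply: min_normal_socle.
have sAH : A \subset H.
  rewrite subsetI abelian_part_sub andbT joins_sub; apply/allP=> M.
  by rewrite mem_abelian_min_normals => /and3P[minM _ _]; apply: min_normal_socle.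
have sHG : H \subset G by rewrite subIset // sNG orbT.
have sYH : normal_closure G X \subset H.
  apply: normal_closure_sub; first exact: socle_part_stable.
  apply/subsetP=> _ /imsetP[i _ ->]; rewrite /w'; case: ifP => _; last exact: (subsetP sAH).
  by rewrite groupM ?(subsetP sAH _ (wA i)) ?(subsetP sTH _ tT).
have nY : stable (normal_closure G X) by apply: normal_closure_stable.
have w'Y i : w' i \in normal_closure G X.
  by apply: (subsetP (sub_normal_closure X)); apply: imset_f.
have sTY : T \subset normal_closure G X.
  rewrite joins_sub; apply/allP=> M Mn; have := Mn; rewrite mem_nonabelian_min_normals =>
    /and3P[minM ncMM _].
  have [tiM | //] := min_normal_dichotomy (Y := <<class_support X G>>%G) minM nY.
  case/negP: (tP M Mn); rewrite -(groupMl _ (_ : w (Ordinal m_gt0) \in 'C(M))); last first.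
    by apply/centP=> x xM; apply/esym/(nonabelian_cent_abelian Mn).
  have := w'Y (Ordinal m_gt0); rewrite /w' eqxx => wtY.
  apply/centP=> x xM; apply: (stable_commute _ _ nY (min_normal_stable minM)) (wtY) xM.
  - exact: subset_trans sYH sHG.
  - exact: min_normal_sub.
  - by rewrite setIC.
have sAY : A \subset normal_closure G X.
  apply: (genA <<class_support X G>>%G) => // i; have := w'Y i; rewrite /w'.
  by case: ifP => // _; rewrite (groupMr _ (subsetP sTY _ tT)).
apply/eqP; apply: (@socle_cover H <<class_support X G>>%G) => //.
- exact: subsetIl.
- exact: socle_part_stable.
move=> M minM; rewrite subsetI => /andP[_ sMN].
by have [/subset_trans|/subset_trans] := min_normal_parts minM sMN; apply.
Qed.

Lemma normal_gens_tail m s1 s2 : all (is_min_normal G) s1 -> all (is_min_normal G) s2 ->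
  (exists w : 'I_m -> gT, normal_gens G w (joins (s1 ++ s2))) ->
  exists w : 'I_m -> gT, normal_gens G w (joins s2).
Proof.
move=> min1 min2; elim: s1 min1 => //= M s1 IH /andP[minM min1] [w genw].
have mins : all (is_min_normal G) (s1 ++ s2) by rewrite all_cat min1.
apply: IH => //; have [ti | E] := joins_cons minM mins; last first.
  by exists w; rewrite -E.
have [sG nB] := (joins_subG mins, joins_stable mins).
have [wM [wB [wMM wBB genw']]] := normal_gens_split minM sG nB ti genw.
by exists wB; apply: (normal_gens_proj minM sG nB ti wMM wBB).
Qed.

Lemma min_normal_gens_cogens : exists l : 'I_(min_normal_gens G H) -> gT -> algC,
  normal_cogens G l A.
Proof.
have [ma ca] := abelian_min_normalsP; have mn := nonabelian_min_normalsP.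
apply/(normal_gens_cogens _ ma ca)/(normal_gens_tail mn ma).
rewrite /min_normal_gens; case: arg_minnP => [|X /eqP XE _];
  first by rewrite normal_closure_id ?socle_part_stable.
(* The nonabelian subgroups come first, so that the abelian part is the tail onto which
   [normal_gens_tail] projects. *)
have mins : all (is_min_normal G) (nonabelian_min_normals ++ abelian_min_normals) by rewrite
  all_cat ma mn.
have E : joins (nonabelian_min_normals ++ abelian_min_normals) :=: H.
  apply: socle_cover; rewrite ?socle_part_stable ?joins_stable //.
  - by rewrite subIset // sNG orbT.
  - exact: subsetIl.
  - rewrite joins_sub; apply/allP=> M; rewrite mem_cat mem_nonabelian_min_normals
    mem_abelian_min_normals.
    by case/orP=> /and3P[minM _ sMN]; rewrite subsetI min_normal_socle.
  move=> M minM; rewrite subsetI => /andP[_ sMN]; apply: sub_joins.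
  by rewrite mem_cat mem_nonabelian_min_normals mem_abelian_min_normals minM sMN !andbT orNb.
exists (fun i => enum_val i); split=> [i|Y nY XY]; rewrite E.
  by rewrite -XE (subsetP (sub_normal_closure X)) // enum_valP.
rewrite -XE; apply: normal_closure_sub => //; apply/subsetP=> x xX.
by have := XY (enum_rank_in xX x); rewrite enum_rankK_in.
Qed.

Lemma min_normal_gens_gt0 : N :!=: 1 -> 0 < min_normal_gens G H.
Proof.
move=> ntN; rewrite /min_normal_gens; case: arg_minnP => [|X /eqP XE _];
  first by rewrite normal_closure_id ?socle_part_stable.
rewrite card_gt0; apply: contraTneq isT => X0; have [M minM sMN] := min_normal_below sNG nN ntN.
have : M \subset H by rewrite subsetI min_normal_socle.
by rewrite -XE X0 normal_closure0 subG1 (negPf (min_normal_nt minM)).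
Qed.

End Below.
End SocleGenerators.

(** * Necessity *)

Section Sections.
Import GRing.Theory.
Local Open Scope ring_scope.

Lemma act_divs0 (K : fieldType) (S : finSemigroup) (V : vectType K) (act : S -> 'End(V)) s t :
  is_module act -> divs s t -> act s = 0 -> act t = 0.
Proof.
move=> mod_act /divsP[l [r ->]] s0; apply/lfunP=> v; rewrite [RHS]lfunE /=.
by case: l r => [x|] [y|] /=; rewrite ?(modM mod_act) s0 !lfunE /= ?linear0.
Qed.

Variables (K : fieldType) (S : finSemigroup) (V : vectType K) (act : S -> 'End(V)).
Hypothesis mod_act : is_module act.
Implicit Types A B X : {vspace V}.

(* B / A is a simple module; the quotient itself is formed in simple_factor. *)
Definition simple_section A B : Prop :=
  [/\ submodule act A, submodule act B, (A <= B)%VS,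
      forall X, submodule act X -> (A <= X)%VS -> (X <= B)%VS -> X = A \/ X = B &
      ~~ (KSmul act B <= A)%VS].

(* s and t act in the same way on B / A. *)
Definition section_eq A B (s t : S) : Prop := forall v, v \in B -> act s v - act t v \in A.

(** What an apex provides is stated on V itself, so that factors living on different quotient spaces
    are handled uniformly. In the last clause D fixes a nonzero vector of the local module. *)
Definition section_apex A B (J : regJ S) : Prop :=
  [/\ forall s t, congJ J s t -> section_eq A B s t,
      forall s x, x \in val J -> divs s x \/ forall v, v \in B -> act s v \in A &
      forall (i : idem_elt S) (H : {group unit_group i}), val i \in val J -> abelian H ->
        exists D : {group unit_group i},
          [/\ (D \subset H) && cyclic (H / D)%g,
              forall p, p \in [pchar K] -> ('O_p(H) \subset D)%g &
              forall X : {group unit_group i}, (X <| [set: unit_group i])%g -> X \subset D ->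
                forall g, g \in X -> section_eq A B (val g) (val i)]].

Lemma section_apex_exists A B : simple_section A B -> exists J, section_apex A B J.
Proof.
case=> sA sB sAB maxA nz; have [W [act' [q [simW qact qB q0]]]] := simple_factor mod_act sA
  sB sAB maxA nz.
have [mod' _ _] := simW.
have [J apJ] := apex_exists simW; exists J.
have BS s v : v \in B -> act s v \in B by move: s v; apply/submoduleP.
have tr s t : act' s = act' t -> section_eq A B s t.
  move=> E v vB; rewrite -q0; last by rewrite memvB ?BS.
  by rewrite linearB /= !qact // E subrr.
split=> [s t|s x xJ|i H iJ cHH].
- by move/(apex_congJ simW apJ); apply: tr.
- have [E|nzs] := eqVneq (act' s) 0; last by left; apply: (apex_divs simW apJ).
  by right=> v vB; rewrite -q0 ?BS // qact // E lfunE.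
have nzi : act' (val i) != 0.
  have [[s sJ nzs] _] := apJ; apply: contra nzs => /eqP i0; apply/eqP.
  apply: act_divs0 mod' _ i0.
  by move: sJ; rewrite (mem_regJ _ iJ) => /andP[].
have [w [D [nzw fw sDH Dw OD]]] := local_eigenvector mod' cHH nzi.
exists D; split=> // X nX sXD g gX; apply: tr.
by apply: (normal_fixed_vector simW apJ iJ nX nzw fw) => // h hX; rewrite Dw ?(subsetP sXD).
Qed.

End Sections.

Section Averages.
Import GRing.Theory.
Local Open Scope ring_scope.
Variables (K : fieldType) (S : finSemigroup) (i : idem_elt S).
Implicit Types (P D : {group unit_group i}).

(** For a subgroup P of order invertible in K and a module, this is a projection onto the P-fixed
    vectors in the image of [act (val i)]. *)
Definition avg (V : vectType K) (act : S -> 'End(V)) (P : {set unit_group i}) : 'End(V) :=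
  #|P|%:R^-1 *: \sum_(g in P) act (val g).

Variables (V : vectType K) (act : S -> 'End(V)).

Lemma avgE (P : {set unit_group i}) v : avg act P v = #|P|%:R^-1 *: \sum_(g in P) act (val g) v.
Proof. by rewrite scale_lfunE sum_lfunE. Qed.

Hypothesis mod_act : is_module act.

Lemma act_avg P g v : g \in P -> act (val g) (avg act P v) = avg act P v.
Proof.
move=> gP; rewrite !avgE linearZ linear_sum /=; congr (_ *: _).
rewrite [RHS](reindex_inj (mulgI g)) /=; apply: eq_big => [h|h _]; first by rewrite groupMl.
by rewrite -act_unitM.
Qed.

Lemma avg_act P g v : g \in P -> avg act P (act (val g) v) = avg act P v.
Proof.
move=> gP; rewrite !avgE; congr (_ *: _).
rewrite [RHS](reindex_inj (mulIg g)) /=; apply: eq_big => [h|h _]; first by rewrite groupMr.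
by rewrite -act_unitM.
Qed.

Lemma avg_avgl D P v : #|D|%:R != 0 :> K -> D \subset P -> avg act D (avg act P v) = avg act
  P v.
Proof.
move=> nz sDP; rewrite avgE (eq_bigr (fun=> avg act P v)) => [|g gD]; last first.
  by rewrite act_avg ?(subsetP sDP).
by rewrite sumr_const -scaler_nat scalerA mulVf ?scale1r.
Qed.

Lemma avg_avgr D P v : #|D|%:R != 0 :> K -> D \subset P -> avg act P (avg act D v) = avg act
  P v.
Proof.
move=> nz sDP; rewrite [avg act D v]avgE linearZ linear_sum /=.
rewrite (eq_bigr (fun=> avg act P v)) => [|g gD]; last by rewrite avg_act ?(subsetP sDP).
by rewrite sumr_const -scaler_nat scalerA mulVf ?scale1r.
Qed.

End Averages.

Lemma has_char_dvd (K : fieldType) p n : has_char K p -> (p %| n) = (n%:R == 0 :> K)%R.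
Proof.
rewrite /has_char; case: eqP => [-> /GRing.pcharf0P->|_ pK];
  last by rewrite (GRing.dvdn_pcharf pK).
by rewrite dvd0n.
Qed.

Lemma has_char_pchar (K : fieldType) p n : has_char K p -> (0 < n) -> (p %| n) -> (p \in
  [pchar K])%R.
Proof.
by rewrite /has_char; case: eqP => // -> _; rewrite dvd0n => /lt0n_neq0/negPf->.
Qed.

Section NecessaryConditions.
Import GRing.Theory.
Local Open Scope ring_scope.
Variables (K : fieldType) (S : finSemigroup) (V : vectType K) (act : S -> 'End(V)).
Hypotheses (mod_act : is_module act) (inj_act : injective act).
Implicit Types A B X : {vspace V}.

Lemma simple_submodule_section W : simple_submodule act W -> simple_section act 0%VS W.
Proof.
case=> sW nz maxW; split=> //; first by move=> s; rewrite limg0.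
- exact: sub0v.
- by move=> X sX _ /maxW-/(_ sX).
- by rewrite subv0.
Qed.

Lemma semisimple_ext k (s t : S) : semisimple act k ->
  (forall W, simple_section act 0%VS W -> section_eq act 0%VS W s t) -> s = t.
Proof.
case=> W [simW sumW _] H; apply: inj_act; apply/lfunP=> v; apply/eqlfunP.
apply: (@subvP _ _ fullv); last exact: memvf.
rewrite -sumW; apply/subv_sumP=> i _; apply/subvP=> w wW; apply/eqlfunP/eqP.
by rewrite -subr_eq0 -memv0; apply: H wW; apply: simple_submodule_section.
Qed.

Lemma semisimple_congGGM k (s t : S) : semisimple act k -> congGGM s t -> s = t.
Proof.
move=> ss /forallP GGM; apply: semisimple_ext ss _ => W secW.
have [J [E _ _]] := section_apex_exists mod_act secW; exact: E.
Qed.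

Variables (e : regJ S -> idem_elt S).
Hypothesis he : forall J, val (e J) \in val J.

(** If e_J acts nontrivially on the factor, its apex J' lies below J and the hypothesis on x covers
    it; otherwise e_J, and with it x = e_J x, annihilates the factor. *)
Lemma section_below A B (J J' : regJ S) x : simple_section act A B -> section_apex act A B J' ->
  J' != J -> val (e J) ** x = x -> cong_below J x (val (e J)) -> section_eq act A B x (val (e
    J)).
Proof.
move=> [/submoduleP sA /submoduleP sB sAB _ _] [E div _] neq ex /cong_belowP below v vB.
have [x0 x0J'] := regJ_nonempty J'.
have [d | kill] := div (val (e J)) x0 x0J'; last first.
  by rewrite memvB ?kill // -ex (modM mod_act) kill ?sB.
apply: E vB; apply: below; rewrite (Jlt_divs x0J' (he J)) d /=.
apply: contra neq => d'; apply/eqP; apply: (regJ_eq x0J').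
by rewrite (mem_regJ _ (he J)) d.
Qed.

(** The p-core of A(G_J) :&: N_J is normal in G_J. It acts trivially on the simple submodules of
    apex J because it lies in D, and on the others by [section_below]; faithfulness makes it
    trivial. *)
Lemma NJ_trivial_char k p J : has_char K p -> semisimple act k ->
  ~~ (p %| #|abelian_socle (maxsubgroup e J) :&: NJ e J|)%N.
Proof.
move=> hp ss; apply/negP=> pd.
set G := maxsubgroup e J; pose N := NJ_group e J.
pose A := (abelian_socle G :&: N)%G.
have nsN : (N <| G)%g := NJ_normal e J.
have nA : (A <| G)%g.
  apply/andP; split; first exact: subsetT.
  apply: normsI; last by case/andP: nsN.
  apply: norms_gen; apply: norms_bigcup; apply/bigcapsP=> M /andP[minM _].
  exact: min_normal_stable.
have cAA : abelian A.
  apply: (@abelianS _ _ (joins (abelian_min_normals G G))); last first.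
    exact: abelian_part_abelian.
  apply: subset_trans (subsetIl _ _) _; rewrite gen_subG; apply/bigcupsP=> M /andP[minM cMM].
  by apply: sub_joins; rewrite mem_abelian_min_normals minM cMM min_normal_sub.
have pK : p \in [pchar K] by apply: has_char_pchar hp _ pd; apply: cardG_gt0 A.
have pr_p : prime p := pcharf_prime pK.
have nP : ('O_p(A) <| G)%g by apply: gFnormal_trans.
have : ('O_p(A) != 1)%g.
  have hall := nilpotent_pcore_Hall p (abelian_nil cAA).
  by rewrite -cardG_gt1 (card_Hall hall) p_part_gt1 mem_primes pr_p cardG_gt0.
case/trivgPn=> g gP; case/negP; apply/eqP/val_inj.
have gA : g \in A by apply: subsetP gP; apply: pcore_sub.
apply: semisimple_ext ss _ => W secW.
have [J' apJ'] := section_apex_exists mod_act secW.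
have [E|neq] := eqVneq J' J.
  have [_ _ /(_ (e J) A)] := apJ'; rewrite E => /(_ (he J) cAA)[D [_ /(_ p pK) sPD]].
  by move=> /(_ ('O_p(A))%G nP sPD); apply.
apply: (section_below secW apJ' neq); first by case: (unit_mem_local g).
by move: gA; rewrite inE => /andP[_]; rewrite inE.
Qed.

End NecessaryConditions.

Section GroupPreliminaries.
Import GRing.Theory.

(** The cyclic group A / D is embedded in the roots of unity of [algC], where primitive roots of
    every order exist. *)
Lemma cyclic_quotient_character (gT : finGroupType) (A D : {group gT}) :
  abelian A -> D \subset A -> cyclic (A / D)%g ->
  exists2 l : gT -> algC, linear_on A l & forall x, x \in A -> l x = 1%R -> x \in D.
Proof.
move=> cAA sDA /cyclicP[x defx].
have nDA : A \subset 'N(D)%g by apply: sub_abelian_norm.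
have inx y : y \in A -> coset D y \in <[x]>%g by move=> yA; rewrite -defx mem_quotient.
have [z prz] := C_prim_root_exists (order_gt0 x).
(* k y is the discrete logarithm of the coset of y to base x, smaller than the order of x; the value
   0 of the other branch concerns only y outside A. *)
pose k y := if (coset D y \in <[x]>%g) =P true is ReflectT yx then s2val (cyclePmin yx) else
  0%N.
have kP y : y \in A -> (k y < #[x]%g)%N /\ coset D y = (x ^+ k y)%g.
  move=> yA; rewrite /k; case: eqP => [yx|]; last by rewrite inx.
  by case: (cyclePmin yx).
exists (fun y => z ^+ k y)%R.
  have kM y y' : y \in A -> y' \in A -> (z ^+ k (y * y')%g = z ^+ k y * z ^+ k y')%R.
    move=> yA yA'; have [_ E] := kP _ yA; have [_ E'] := kP _ yA'.
    have [_] := kP _ (groupM yA yA'); rewrite morphM ?(subsetP nDA) //= E E' -expgD.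
    move/eqP; rewrite eq_expg_mod_order => /eqP mE.
    by rewrite -exprD -(prim_expr_mod prz) -mE prim_expr_mod.
  split=> //; have [lt E] := kP _ (group1 A).
  move: E; rewrite morph1 => /eqP; rewrite -{1}(expg0 x) eq_expg_mod_order mod0n modn_small
    // => /eqP <-.
  by rewrite expr0.
move=> y yA /eqP; have [lt E] := kP y yA; rewrite -(prim_order_dvd prz).
move=> /(@dvdn_leq _ _)H; apply: coset_idr; rewrite ?(subsetP nDA) // E.
by move: H lt; case: (k y) => [|m] // /(_ isT); rewrite leqNgt => /negPf->.
Qed.

(** By Cauchy p is the only prime dividing the order of M, so M is a p-group, hence solvable, and a
    solvable minimal normal subgroup is elementary abelian. *)
Lemma min_normal_char_group (K : fieldType) (gT : finGroupType) (G M : {group gT}) p :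
  has_char K p -> is_min_normal G M ->
  (forall x, x \in M -> prime #[x]%g -> (#[x]%g%:R = 0 :> K)%R) -> abelian M /\ p %| #|M|.
Proof.
move=> hp minM ord0.
have primeM q : prime q -> (q %| #|M|)%N -> q = p.
  move=> pr_q /(Cauchy pr_q)[x xM ox]; have q0 : (q%:R = 0 :> K)%R by rewrite -ox ord0 ?ox.
  have pq : (p %| q)%N by rewrite (has_char_dvd _ hp) q0.
  have pr_p := pcharf_prime (has_char_pchar hp (prime_gt0 pr_q) pq).
  by apply/eqP; rewrite eq_sym -(dvdn_prime2 pr_p pr_q).
have M_gt1 : (1 < #|M|)%N by rewrite cardG_gt1 (min_normal_nt minM).
have pM : (p %| #|M|)%N by rewrite -(primeM _ (pdiv_prime M_gt1)) ?pdiv_dvd.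
have pgM : (p.-group M)%g by apply/pgroupP=> q pr_q /(primeM _ pr_q)->; rewrite inE.
have [_ _ abM] := minnormal_solvable (proj2 (andP minM)) (subxx M) (pgroup_sol pgM).
by split=> //; apply: abelem_abelian abM.
Qed.

End GroupPreliminaries.

(** * The lower bound on the number of simple factors *)

Section CompositionSeries.
Import GRing.Theory.
Local Open Scope ring_scope.
Variables (K : fieldType) (S : finSemigroup) (V : vectType K) (act : S -> 'End(V)).
Hypotheses (mod_act : is_module act) (inj_act : injective act).
Variables (n : nat) (c : nat -> {vspace V}).
Hypothesis ser : composition_series act n c.

(** z is nilpotent, since it lowers the filtration, and idempotent. *)
Lemma series_idem0 (z : 'End(V)) : (forall v, z (z v) = z v) ->
  (forall j v, (j < n)%N -> v \in c j.+1 -> z v \in c j) -> z = 0.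
Proof.
move=> zz zc; have [c0 cn _ _] := ser.
have H j : (j <= n)%N -> forall v, v \in c j -> z v = 0.
  elim: j => [_ v|j IH ltj v vc]; first by rewrite c0 memv0 => /eqP->; rewrite linear0.
  by rewrite -zz (IH (ltnW ltj)) // zc.
by apply/lfunP=> v; rewrite lfunE /= (H n) // cn memvf.
Qed.

Definition series_eq (s t : S) : Prop := forall j, (j < n)%N -> section_eq act (c j) (c j.+1)
  s t.

Lemma series_act j v s : (j <= n)%N -> v \in c j -> act s v \in c j.
Proof. by move=> lej; case: ser => _ _ sub _; move: s v; apply/submoduleP/sub. Qed.

Lemma series_idem (f h : S) : f ** f = f -> h ** h = h -> f ** h = h -> h ** f = h ->
  series_eq h f -> f = h.
Proof.
move=> ff hh fh hf E; apply: inj_act; apply/eqP; rewrite -subr_eq0; apply/eqP.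
apply: series_idem0 => [v|j v ltj vc].
  rewrite !add_lfunE !opp_lfunE !linearB /= -!(modM mod_act) ff hh fh hf.
  by rewrite subrr addr0.
rewrite add_lfunE opp_lfunE -opprB rpredN; exact: E.
Qed.

(** The difference of [act (val i)] and the average over P is an idempotent that lowers the series,
    hence zero; so P acts as its identity does. *)
Lemma series_group (i : idem_elt S) (P : {group unit_group i}) :
  #|P|%:R != 0 :> K -> (forall g, g \in P -> series_eq (val g) (val i)) -> P :=: 1%g.
Proof.
move=> nzP E; apply/trivgP/subsetP=> g gP; apply/set1P/val_inj/inj_act.
have fE v : avg act P (act (val i) v) = avg act P v := avg_act mod_act v (group1 P).
have Ef v : act (val i) (avg act P v) = avg act P v := act_avg mod_act v (group1 P).
have z0 : act (val i) - avg act P = 0.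
  apply: series_idem0 => [v|j v ltj vc].
    rewrite !add_lfunE !opp_lfunE !linearB /= Ef fE act_idem // avg_avgl //.
    by rewrite subrr addr0.
  rewrite add_lfunE opp_lfunE avgE.
  have -> : act (val i) v = #|P|%:R^-1 *: \sum_(g in P) act (val i) v.
    by rewrite sumr_const -scaler_nat scalerA mulVf ?scale1r.
  rewrite -scalerBr -sumrB memvZ // memv_suml // => h hP.
  by rewrite -opprB rpredN; apply: E.
move/eqP: z0; rewrite subr_eq0 => /eqP z0.
by apply/lfunP=> v; rewrite -act_unitr // z0 act_avg.
Qed.

Variables (e : regJ S -> idem_elt S).
Hypothesis he : forall J, val (e J) \in val J.

Definition simple_indices := [set j : 'I_n | ~~ (KSmul act (c j.+1) <= c j)%VS].

Lemma simple_indices_section (j : 'I_n) : j \in simple_indices ->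
  simple_section act (c j) (c j.+1).
Proof.
rewrite inE => nz; have [_ _ sub /(_ j (ltn_ord j))[le _ max]] := ser.
by split=> //; apply: sub => //; apply: ltnW.
Qed.

Variable a : 'I_n -> option (regJ S).
Hypothesis aP : forall j, j \in simple_indices ->
  exists2 J, a j = Some J & section_apex act (c j) (c j.+1) J.

Section OneClass.
Variable J : regJ S.
Let G := maxsubgroup e J.
Let N := NJ_group e J.
Let f := val (e J).
Let ff : f ** f = f := idem_eltK (e J).

Definition apex_indices := [set j in simple_indices | a j == Some J].

Lemma series_eq_below x : f ** x = x -> cong_below J x f ->
  (forall j : 'I_n, j \in apex_indices -> section_eq act (c j) (c j.+1) x f) ->
  series_eq x f.
Proof.
move=> fx below E j ltj; pose o := Ordinal ltj; rewrite -[j]/(val o).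
have [oF | ] := boolP (o \in simple_indices); last first.
  rewrite inE negbK => /KSmul_sub null v vc.
  by rewrite memvB ?null.
have [J' aE apJ'] := aP oF; have [E'|neq] := eqVneq J' J.
  by apply: E; rewrite inE oF aE E' eqxx.
exact: (section_below mod_act he (simple_indices_section oF) apJ' neq fx below).
Qed.

Lemma NJ_series_eq g : g \in N ->
  (forall j : 'I_n, j \in apex_indices -> section_eq act (c j) (c j.+1) (val g) f) ->
  series_eq (val g) f.
Proof.
move=> gN; apply: series_eq_below; first by case: (unit_mem_local g).
by move: gN; rewrite inE.
Qed.

Variable p : nat.
Hypothesis hp : has_char K p.
Hypothesis pA : ~~ (p %| #|abelian_socle G :&: NJ e J|)%N.

(** In a minimal normal subgroup M inside Y every element of prime order has order p, for otherwise
    [series_group] kills the cyclic group it generates. So M is an abelian p-group inside A(G_J) :&: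
    N_J. *)
Lemma NJ_sub_trivial (Y : {group unit_group (e J)}) : (G \subset 'N(Y))%g -> Y \subset N ->
  (forall g, g \in Y -> series_eq (val g) f) -> Y :=: 1%g.
Proof.
move=> nY sYN E; apply/eqP/negPn/negP=> ntY.
have [M minM sMY] := min_normal_below (subsetT Y) nY ntY.
have [|cMM pM] := min_normal_char_group hp minM.
  move=> x xM pr_x; apply/eqP; apply: contraTT (pr_x) => nzx.
  have /eqP : <[x]>%g :=: 1%g.
    apply: series_group => // g gx.
    by apply: E; apply: subsetP gx; rewrite cycle_subG (subsetP sMY).
  by rewrite cycle_eq1 -order_eq1 => /eqP->.
have sMA : M \subset (abelian_socle G :&: N)%G.
  rewrite subsetI (subset_trans sMY sYN) andbT; apply/sub_gen/bigcup_sup.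
  by rewrite minM cMM.
by case/negP: pA; apply: dvdn_trans pM (cardSg sMA).
Qed.

Lemma kJ_le : (kJ e J <= #|apex_indices|)%N.
Proof.
rewrite /kJ; case: ifP => [//|/negbT irr].
case: ifP => [/eqP N1 | /negbT/eqP ntN].
  (* If no factor has apex J, elements of f S congruent to f below J act as f on every factor; this
     is shown to make J reducible. *)
  rewrite lt0n cards_eq0; apply: contraNneq irr => D0.
  have trE x : f ** x = x -> cong_below J x f -> series_eq x f.
    by move=> fx bx; apply: series_eq_below => // j; rewrite D0 inE.
  apply/forallP=> s; apply/forallP=> t; apply/implyP.
  apply: (congJ_of_units (he J) (R := cong_below J));
    [exact: cong_below_sym | exact: cong_below_mull |
    exact: cong_below_mulr | move=> h fh hf hbelow | move=> g gN]; last first.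
    by apply/set1P; rewrite -[[set 1%g]]/(1%g : {set _}) -N1 inE.
  (* The idempotent power of h still acts as f on every factor, so it equals f by [series_idem], and
     f is a multiple of h. *)
  have [m hm] := idem_pow h.
  have fhm : f ** spow h m = spow h m by case: (m) => [|k] //; rewrite spowS smulA fh.
  have hmf : spow h m ** f = spow h m by case: (m) => [|k] //; rewrite spowSr -smulA hf.
  have E : f = spow h m.
    apply: series_idem => //; have Eh := trE h fh hbelow.
    elim: {hm fhm hmf} m => // m IH j ltj v vc; rewrite spowS (modM mod_act).
    have -> : act h (act (spow h m) v) - act f v =
        act h (act (spow h m) v - act f v) + (act h (act f v) - act f (act f v)).
      by rewrite linearB /= act_idem // addrA subrK.
    by rewrite memvD ?Eh ?series_act // ?(ltnW ltj) // IH.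
  apply: (regJ_ideal (he J)); first by rewrite -fh divs_mulr.
  rewrite -/f E; case: (m) => [|k]; first exact: divs_refl.
  exact: divs_mulr.
have [nG sNG] : (G \subset 'N(N))%g /\ (N \subset G)%g by case/andP: (NJ_normal e J).
pose A := joins (abelian_min_normals G N).
have cAA : abelian A := abelian_part_abelian G N.
have sAN : A \subset N := abelian_part_sub G N.
have exD (d : 'I_#|apex_indices|) : exists D : {group unit_group (e J)},
    [/\ (D \subset A) && cyclic (A / D)%g &
     forall X : {group unit_group (e J)}, (X <| G)%g -> X \subset D -> forall g, g \in X ->
       section_eq act (c (enum_val d)) (c (enum_val d).+1) (val g) f].
  have := enum_valP d; rewrite inE => /andP[dF /eqP aE].
  have [J' aE' [_ _ /(_ (e J) A)]] := aP dF; move: aE'; rewrite aE => -[<-].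
  by case/(_ (he J) cAA)=> B [H1 _ H2]; exists B.
have [D DP] := fin_all_exists exD.
have exl (d : 'I_#|apex_indices|) : exists l : unit_group (e J) -> algC,
    linear_on A l /\ forall x, x \in A -> l x = 1 -> x \in D d.
  have [/andP[sDA cycD] _] := DP d.
  by have [k lk kk] := cyclic_quotient_character cAA sDA cycD; exists k.
have [l lP] := fin_all_exists exl.
(* A stable subgroup in all the kernels lies in every D d, so it acts trivially on the factors of
   apex J and thus on all factors. *)
have cog : normal_cogens G l A.
  split=> [d|Y nY sYA kY]; first by case: (lP d).
  apply: NJ_sub_trivial => //; first exact: subset_trans sAN.
  move=> g gY; apply: NJ_series_eq; first by rewrite (subsetP sAN) ?(subsetP sYA).
  move=> j jD; have [_ H] := DP (enum_rank_in jD j).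
  rewrite -[j](enum_rankK_in jD jD); apply: H gY; first by rewrite /normal subsetT.
  by apply/subsetP=> x xY; have [_ ->] := lP (enum_rank_in jD j); rewrite ?(subsetP sYA) ?kY.
have [ma ca] := abelian_min_normalsP G N.
have [w genw] := (normal_gens_cogens _ ma ca).2 (ex_intro _ l cog).
apply: (@min_normal_gens_le _ G N sNG nG _ w genw) => _.
(* A may be trivial when N is not, so positivity is a separate claim: without factors of apex J all
   of N would act trivially. *)
rewrite lt0n cards_eq0; apply/eqP=> D0; case: ntN.
apply: (@NJ_sub_trivial N) => // g gN; apply: NJ_series_eq => // j.
by rewrite D0 inE.
Qed.

End OneClass.
End CompositionSeries.

Section Conditions12.
Import GRing.Theory.
Local Open Scope ring_scope.
Variables (K : fieldType) (S : finSemigroup) (V : vectType K) (act : S -> 'End(V)).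

Lemma sum_kJ_le (e : regJ S -> idem_elt S) p n c :
  is_module act -> injective act -> composition_series act n c ->
  (forall J, val (e J) \in val J) -> has_char K p ->
  (forall J, ~~ (p %| #|abelian_socle (maxsubgroup e J) :&: NJ e J|)%N) ->
  (\sum_(J : regJ S) kJ e J <= nb_simple_factors act n c)%N.
Proof.
move=> mod_act inj_act ser he hp pA.
have exa (j : 'I_n) : exists oJ : option (regJ S), j \in simple_indices act n c ->
    exists2 J, oJ = Some J & section_apex act (c j) (c j.+1) J.
  have [jF|_] := boolP (j \in simple_indices act n c); last by exists None.
  have [J apJ] := section_apex_exists mod_act (simple_indices_section ser jF).
  by exists (Some J) => _; exists J.
have [a aP] := fin_all_exists exa.
apply: (@leq_trans (\sum_(J : regJ S) #|apex_indices act c a J|)).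
  by apply: leq_sum => J _; apply: (kJ_le mod_act inj_act ser he aP hp).
under eq_bigr => J _ do rewrite -sum1_card.
have -> : nb_simple_factors act n c = (\sum_(j in simple_indices act n c) 1)%N by rewrite
  sum1_card.
(* Counting by factors instead of by classes: each simple factor has a single chosen apex. *)
rewrite (exchange_big_dep (mem (simple_indices act n c))) /=; last by move=> J j _;
  rewrite inE => /andP[].
apply: leq_sum => j jF; rewrite sum1_card.
have [J aE _] := aP j jF; rewrite -(cards1 J); apply/subset_leq_card/subsetP=> J'.
move=> jJ'; have : j \in apex_indices act c a J' by [].
by rewrite in_set1 inE aE => /andP[_ /eqP[->]].
Qed.

Lemma semisimple_series k : semisimple act k ->
  exists n c, composition_series act n c /\ nb_simple_factors act n c = k.
Proof.
case=> W [simW sumW /directv_sumP dW].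
pose c j := (\sum_(i : 'I_k | (i < j)%N) W i)%VS.
have subc j : submodule act (c j).
  move=> s; rewrite limg_sum; apply/subv_sumP=> i ij; have [sub _ _] := simW i.
  by apply: subv_trans (sub s) _; apply: (sumv_sup i).
have cS (j : 'I_k) : c j.+1 = (c j + W j)%VS.
  rewrite /c (bigD1 j) //= addvC; congr (_ + _)%VS; apply: eq_bigl => i.
  by rewrite ltnS ltn_neqAle andbC.
have cap (j : 'I_k) : (W j :&: c j = 0)%VS.
  apply/eqP; rewrite -subv0 -(dW j isT); apply: capvS => //.
  apply/subv_sumP=> i ij; apply: (sumv_sup i) => //=.
  by apply: contraTneq ij => ->; rewrite ltnn.
have nzW (j : 'I_k) : ~~ (KSmul act (c j.+1) <= c j)%VS.
  apply/negP=> /KSmul_sub H; have [/submoduleP sub nz _] := simW j.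
  case/negP: nz; rewrite -subv0 -(cap j); apply/KSmul_sub=> s v vW.
  rewrite memv_cap sub //= H // cS; exact: subvP (addvSr _ _) _ vW.
exists k, c; split; last first.
  rewrite /nb_simple_factors -[RHS]card_ord -cardsT; congr #|pred_of_set _|.
  by apply/setP=> j; rewrite !inE nzW.
split=> [||j _|j ltj]; rewrite ?subc //.
- by rewrite /c big_pred0.
- by rewrite -sumW; apply: eq_bigl => i; rewrite ltn_ord.
have := cS (Ordinal ltj); have := nzW (Ordinal ltj); have := cap (Ordinal ltj).
have [/= subW _ maxW] := simW (Ordinal ltj).
set Wj := W _ in subW maxW * => capj nzj cSj.
have lej : (c j <= c j.+1)%VS by rewrite cSj addvSl.
split=> // [E|X sX cX Xc].
  case/negP: nzj; rewrite -E; apply/KSmul_sub=> s v vc.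
  by move: s v vc; apply/submoduleP.
have sXW : submodule act (X :&: Wj)%VS.
  move=> s; apply: subv_trans (limg_cap _ _ _) _.
  by apply: capvS; [apply: sX | apply: subW].
have [X0|XW] := maxW _ sXW (capvSr _ _); [left | right]; apply/eqP; rewrite eqEsubv.
  rewrite cX andbT; apply/subvP=> x xX; have := subvP Xc x xX; rewrite cSj =>
    /memv_addP[u uc [w wW xE]].
  have : w \in (X :&: Wj)%VS.
    rewrite memv_cap wW andbT.
    have -> : w = x - u by rewrite xE addrC addKr.
    by rewrite memvB // (subvP cX).
  by rewrite X0 memv0 xE => /eqP->; rewrite addr0.
by rewrite Xc cSj subv_add cX -XW capvSl.
Qed.

End Conditions12.

(** * Sufficiency *)

Section Idempotents.
Import GRing.Theory.
Local Open Scope ring_scope.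
Variables (K : fieldType) (S : finSemigroup) (V : vectType K) (act : S -> 'End(V)).
Implicit Types A B X : {vspace V}.

Lemma minimal_vspace (P : {vspace V} -> Prop) B : P B ->
  exists2 B', P B' & forall X, P X -> (X <= B')%VS -> X = B'.
Proof.
have [n] := ubnP (\dim B); elim: n B => // n IH B ltn PB.
have [[X [PX XB neq]] | none] := classic (exists X, [/\ P X, (X <= B)%VS & X <> B]).
  apply: (IH X) => //; rewrite ltnS in ltn; apply: leq_trans ltn.
  rewrite ltn_neqAle (dimvS XB) andbT; apply: contra_notN neq => /eqP E.
  by apply/eqP; rewrite eqEdim XB E leqnn.
by exists B => // X PX XB; apply: NNPP => neq; apply: none; exists X.
Qed.

Lemma maximal_vspace (P : {vspace V} -> Prop) A : P A ->
  exists2 A', P A' & forall X, P X -> (A' <= X)%VS -> X = A'.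
Proof.
have [n] := ubnP (\dim (fullv : {vspace V}) - \dim A); elim: n A => // n IH A ltn PA.
have [[X [PX AX neq]] | none] := classic (exists X, [/\ P X, (A <= X)%VS & X <> A]).
  apply: (IH X) => //; rewrite ltnS in ltn; apply: leq_trans ltn.
  have lt : (\dim A < \dim X)%N.
    rewrite ltn_neqAle (dimvS AX) andbT; apply: contra_notN neq => /eqP E.
    by apply/esym/eqP; rewrite eqEdim AX E leqnn.
  by apply: ltn_sub2l => //; apply: leq_trans lt (dimvS (subvf X)).
by exists A => // X PX AX; apply: NNPP => neq; apply: none; exists X.
Qed.

(* B is a minimal submodule on which E is nonzero and A a maximal one of B on
   which it vanishes; E being idempotent, it does not vanish on B / A. *)
Lemma idempotent_section (E : 'End(V)) : (forall v, E (E v) = E v) -> E != 0 ->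
  (forall X v, submodule act X -> v \in X -> E v \in KSmul act X) ->
  exists A B, simple_section act A B /\ exists2 v, v \in B & E v \notin A.
Proof.
move=> EE nzE EX.
pose PB X := submodule act X /\ exists2 v, v \in X & E v != 0.
have [|B [sB [v vB nzv]] minB] := @minimal_vspace PB fullv.
  split; first by move=> s; apply: subvf.
  apply: NNPP => none; case/eqP: nzE; apply/lfunP=> v; rewrite lfunE /=.
  by apply/eqP/negPn/negP=> nz; apply: none; exists v; rewrite ?memvf.
pose PA X := [/\ submodule act X, (X <= B)%VS & forall v, v \in X -> E v = 0].
have [|A [sA AB A0] maxA] := @maximal_vspace PA 0%VS.
  split; [by move=> s; rewrite limg0 | exact: sub0v |].
  by move=> u; rewrite memv0 => /eqP->; rewrite linear0.
have EvA : E v \notin A by apply: contra nzv => /A0 E0; rewrite -EE E0.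
exists A, B; split; last by exists v.
split=> // [X sX AX XB|]; last first.
  by apply: contra EvA => /subvP; apply; apply: EX.
have [[u [uX nzu]] | none] := classic (exists u, u \in X /\ E u != 0).
  by right; apply: minB => //; split=> //; exists u.
left; apply: maxA => //; split=> // u uX.
by apply/eqP/negPn/negP=> nz; apply: none; exists u.
Qed.

End Idempotents.

(** * Products of differences of averages *)

Section AverageProducts.
Import GRing.Theory.
Local Open Scope ring_scope.
Variables (K : fieldType) (S : finSemigroup) (i : idem_elt S).
Implicit Types (P D Q X : {group unit_group i}) (l : seq ({group unit_group i} * {group
  unit_group i})).
Local Notation f := (val i).

(** With orders invertible in K, the factor for (D, Q) keeps D-fixed vectors and removes their
    Q-fixed part, so it vanishes where Q acts no more than D does. The empty product is [act f]. *)
Definition avg_prod (V : vectType K) (act : S -> 'End(V))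
    (l : seq ({group unit_group i} * {group unit_group i})) : 'End(V) :=
  foldr (fun (DQ : {group unit_group i} * {group unit_group i}) T =>
    ((avg act DQ.1 - avg act DQ.2) \o T)%VF) (act f) l.

Definition hull l : {group unit_group i} := joins [seq DQ.2 | DQ <- l].

(** This makes [avg_prod] idempotent, its factors commuting, and nonzero on the module with basis J,
    the groups DQ.2 forming a direct product. *)
Fixpoint independent l : Prop :=
  if l is DQ :: l' then
    [/\ DQ.1 \proper DQ.2, #|DQ.2|%:R != 0 :> K, hull l' \subset ('C(DQ.2))%g,
        (DQ.2 :&: hull l' = 1)%g & independent l']
  else True.

Lemma sub_card_neq0 D Q : D \subset Q -> #|Q|%:R != 0 :> K -> #|D|%:R != 0 :> K.
Proof. by move=> sDQ; apply: contra => /eqP D0; rewrite -(Lagrange sDQ) natrM D0 mul0r. Qed.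

Section Module.
Variables (V : vectType K) (act : S -> 'End(V)).
Hypothesis mod_act : is_module act.

Lemma avg_prod_cons D Q l v :
  avg_prod act ((D, Q) :: l) v = avg act D (avg_prod act l v) - avg act Q (avg_prod act l v).
Proof. by rewrite /= comp_lfunE add_lfunE opp_lfunE. Qed.

Lemma avg_KSmul P (X : {vspace V}) v : v \in X -> avg act P v \in KSmul act X.
Proof.
move=> vX; rewrite avgE memvZ // memv_suml // => g _.
by apply: (subvP (sumv_sup (val g) isT (subvv _))); apply: memv_img.
Qed.

Lemma KSmul_submodule (X : {vspace V}) : submodule act X -> (KSmul act X <= X)%VS.
Proof. by move=> /submoduleP sX; apply/KSmul_sub. Qed.

Lemma avg_prod_KSmul l (X : {vspace V}) v : submodule act X -> v \in X -> avg_prod act l v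
  \in KSmul act X.
Proof.
move=> sX vX; elim: l => [|[D Q] l IH].
  by apply: (subvP (sumv_sup f isT (subvv _))); apply: memv_img.
have IH' := subvP (KSmul_submodule sX) _ IH.
by rewrite avg_prod_cons memvB ?avg_KSmul.
Qed.

Lemma avg_commute P g v : (forall h, h \in P -> (g * h = h * g)%g) ->
  act (val g) (avg act P v) = avg act P (act (val g) v).
Proof.
move=> cgP; rewrite !avgE linearZ linear_sum /=; congr (_ *: _); apply: eq_bigr => h hP.
by rewrite -!act_unitM // cgP.
Qed.

Lemma avg_prod_commute l g v : (forall DQ, DQ \in l -> DQ.1 \subset DQ.2) -> g \in ('C(hull
  l))%g ->
  act (val g) (avg_prod act l v) = avg_prod act l (act (val g) v).
Proof.
elim: l v => [|[D Q] l IH] v sub cg; first by rewrite /= act_unitl // act_unitr.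
have cgQ h : h \in Q -> (g * h = h * g)%g.
  by move=> hQ; apply: (centP cg); apply: (subsetP (joing_subl Q (hull l))).
have sDQ : D \subset Q by apply: (sub (D, Q)); rewrite mem_head.
rewrite !avg_prod_cons linearB /= !avg_commute // => [|h hD]; last first.
  by apply: cgQ; apply: (subsetP sDQ).
by rewrite IH // => [DQ DQl|]; [apply: sub; rewrite inE DQl orbT | apply: subsetP cg;
  apply/centS/joing_subr].
Qed.

Lemma independent_sub l : independent l -> forall DQ, DQ \in l -> DQ.1 \subset DQ.2.
Proof.
elim: l => // DQ l IH [/proper_sub sub _ _ _ /IH H] DQ'.
by rewrite inE => /orP[/eqP->|/H].
Qed.

Lemma avg_prod_idem l v : independent l -> avg_prod act l (avg_prod act l v) = avg_prod act l v.
Proof.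
elim: l v => [|[D Q] l IH] v; first by move=> _; rewrite /= act_idem.
case=> /= /proper_sub sDQ nzQ cQ _ ind; have nzD := sub_card_neq0 sDQ nzQ.
have comm (P : {group unit_group i}) u : P \subset Q ->
    avg_prod act l (avg act P u) = avg act P (avg_prod act l u).
  move=> sPQ; rewrite !avgE linearZ linear_sum /=; congr (_ *: _); apply: eq_bigr => g gP.
  rewrite avg_prod_commute //; first exact: independent_sub.
  by rewrite (subsetP _ _ (subsetP sPQ _ gP)) // centsC.
rewrite !avg_prod_cons linearB /= !comm // IH //.
rewrite !linearB /= avg_avgl // avg_avgl // avg_avgr // avg_avgl //.
by rewrite subrr addr0.
Qed.

Lemma avg_prod_act_idem l v : avg_prod act l (act f v) = avg_prod act l v.
Proof. by elim: l => [|[D Q] l IH]; rewrite ?avg_prod_cons ?IH //= act_idem. Qed.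

Lemma avg_prod_sub l (X : {vspace V}) v : submodule act X -> v \in X -> avg_prod act l v \in X.
Proof. by move=> sX vX; apply: (subvP (KSmul_submodule sX)); apply: avg_prod_KSmul. Qed.

(** Modulo A an element of Q, being a product of elements of X and D, fixes every D-fixed vector;
    hence averaging such a vector over Q changes nothing, and the factor for (D, Q) is zero
    there. *)
Lemma avg_prod_section_eq0 l A B D Q X : submodule act A -> submodule act B ->
  (D, Q) \in l -> D \subset Q -> #|Q|%:R != 0 :> K ->
  (Q \subset X * D)%g ->
  (forall g, g \in X -> section_eq act A B (val g) f) ->
  forall v, v \in B -> avg_prod act l v \in A.
Proof.
move=> sA sB lDQ sDQ nzQ QXD triv v vB.
have avgS P Y u : submodule act Y -> u \in Y -> avg act P u \in Y.
  by move=> sY uY; apply: (subvP (KSmul_submodule sY)); apply: avg_KSmul.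
have nzD := sub_card_neq0 sDQ nzQ.
elim: l lDQ => // -[D' Q'] l IH; rewrite inE avg_prod_cons => /orP[/eqP[<- <-]|/IH H];
  last first.
  by rewrite memvB ?avgS.
set w := avg_prod act l v; have wB : w \in B by apply: avg_prod_sub.
rewrite -(avg_avgr mod_act w nzD sDQ); set u := avg act D w.
have uB : u \in B by apply: avgS.
have fu : act f u = u := act_avg mod_act w (group1 D).
have -> : u - avg act Q u = #|Q|%:R^-1 *: \sum_(g in Q) (act f u - act (val g) u).
  by rewrite sumrB scalerBr -avgE sumr_const -scaler_nat scalerA mulVf // scale1r fu.
rewrite memvZ // memv_suml // => g gQ.
have /mulsgP[x d xX dD ->] := subsetP QXD g gQ.
rewrite act_unitM // [act (val d) u]act_avg // -opprB rpredN.
exact: triv.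
Qed.

End Module.
End AverageProducts.

(** * The module with basis J *)

Section ContractedModule.
Import GRing.Theory.
Local Open Scope ring_scope.
Variables (K : fieldType) (S : finSemigroup) (J : regJ S).
Local Notation V := {ffun S -> K^o}.
Implicit Types (phi : V) (s t u : S).

(** Push-forward of coefficient functions. Coordinates outside J are discarded, so indexing by all
    of S adds only a null direct summand. *)
Definition jact_fun s (phi : V) : V :=
  [ffun t => \sum_(u | [&& u \in val J, s ** u == t & t \in val J]) phi u].

Lemma jact_fun_linear s : linear (jact_fun s).
Proof.
move=> a phi psi; apply/ffunP=> t; rewrite !ffunE scaler_sumr -big_split /=.
by apply: eq_bigr => u _; rewrite !ffunE.
Qed.

HB.instance Definition _ s := GRing.isLinear.Build K V V _ (jact_fun s) (jact_fun_linear s).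

(* In terms of the basis J, s sends t to s ** t, or to 0 if that product leaves J. *)
Definition jact s : 'End(V) := linfun (jact_fun s).

Lemma jactE s phi t :
  jact s phi t = \sum_(u | [&& u \in val J, s ** u == t & t \in val J]) phi u.
Proof. by rewrite lfunE ffunE. Qed.

Lemma jact_module : is_module jact.
Proof.
move=> s s'; apply/lfunP=> phi; apply/ffunP=> t; rewrite comp_lfunE !jactE.
rewrite (partition_big (fun u => s' ** u) (fun w => [&& w \in val J, s ** w == t & t \in val
  J])) /=.
  apply: eq_bigr => w /and3P[wJ /eqP <- swJ]; rewrite jactE; apply: eq_bigl => u.
  rewrite wJ swJ !andbT -!andbA; congr (_ && _); rewrite -smulA.
  by case: (s' ** u =P w) => [->|_]; rewrite ?eqxx ?andbF.
move=> u /and3P[uJ /eqP <- tJ]; rewrite -smulA eqxx smulA tJ /= andbT.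
have d : divs (s' ** u) (s ** s' ** u) by rewrite -smulA divs_mull.
apply: (regJ_ideal uJ); first exact: divs_mull.
by apply: divs_trans d _; move: tJ; rewrite (mem_regJ _ uJ) => /andP[].
Qed.

Lemma jact_below s : s \in ideal1 (val J) -> s \notin val J -> jact s = 0.
Proof.
have [j jJ] := regJ_nonempty J; rewrite (ideal1_regJ _ jJ) => js sJ.
apply/lfunP=> phi; apply/ffunP=> t; rewrite jactE lfunE /= ffunE big_pred0 // => u.
apply/negbTE; apply: contra sJ => /and3P[uJ /eqP <- tJ].
apply: (regJ_ideal jJ js); apply: divs_trans (divs_mulr s u) _.
by move: tJ; rewrite (mem_regJ _ jJ) => /andP[].
Qed.

Variable i : idem_elt S.
Hypothesis iJ : val i \in val J.
Implicit Types (H P D Q : {group unit_group i}) (g h : unit_group i).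

Definition supported (phi : V) H : Prop := forall u, phi u != 0 -> exists2 h, h \in H & u =
  val h.

Lemma unit_J g : val g \in val J.
Proof. by move: (valP g); rewrite (local_unitsE _ (idem_eltK i) iJ) => /andP[]. Qed.

(** Elements u of J with g ** u = h need not satisfy f ** u = u; the support condition leaves only
    the one in the unit group. *)
Lemma jact_unit phi H g h : supported phi H -> jact (val g) phi (val h) = phi (val (g^-1 *
  h)%g).
Proof.
move=> sup; have gh : val g ** val (g^-1 * h)%g = val h by rewrite -unit_valM mulKVg.
rewrite jactE (bigD1 (val (g^-1 * h)%g)); last by rewrite !unit_J gh eqxx.
rewrite /= big1 ?addr0 // => u /andP[/and3P[uJ /eqP E _] neq].
apply/eqP; apply: contraNT neq => /sup[k kH uE]; apply/eqP; rewrite uE.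
suff -> : k = (g^-1 * h)%g by [].
by apply: (mulgI g); rewrite mulKVg; apply: val_inj; rewrite unit_valM -uE.
Qed.

Lemma supported_avg phi H P : supported phi H -> supported (avg jact P phi) (P <*> H)%G.
Proof.
move=> sup u; rewrite avgE ffunE sum_ffunE => nz.
have [/exists_inP[g gP]|] := boolP [exists g in P, jact (val g) phi u != 0]; last first.
  rewrite negb_exists_in => /forall_inP all0; case/eqP: nz.
  by rewrite big1 ?scaler0 // => g /all0; rewrite negbK => /eqP.
rewrite jactE => nz'.
have [/exists_inP[w /and3P[wJ /eqP E _] /sup[h hH wE]]|] :=
    boolP [exists w in [pred w | [&& w \in val J, val g ** w == u & u \in val J]], phi w != 0].
  exists (g * h)%g; last by rewrite unit_valM -wE.
  by rewrite groupM ?(subsetP (joing_subl P H) _ gP) ?(subsetP (joing_subr P H) _ hH).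
rewrite negb_exists_in => /forall_inP all0; case/eqP: nz'.
by rewrite big1 // => w /all0; rewrite negbK => /eqP.
Qed.

Lemma avg_val phi H P h : supported phi H ->
  avg jact P phi (val h) = #|P|%:R^-1 * \sum_(g in P) phi (val (g^-1 * h)%g).
Proof.
move=> sup; rewrite avgE ffunE sum_ffunE; congr (_ * _); apply: eq_bigr => g _.
exact: jact_unit sup.
Qed.

Definition unit_vector : V := [ffun t => (t == val i)%:R].

(* If phi is supported on H and x is in Q but not in D, then averaging over D
   gives 0 at x * h for h in H, while averaging over Q gives phi h / #|Q|. *)
Lemma avg_prod_unit_vector l : independent K l ->
  supported (avg_prod jact l unit_vector) (hull l) /\
  exists2 h, h \in hull l & avg_prod jact l unit_vector (val h) != 0.
Proof.
elim: l => [_|[D Q] l IH [/= /properP[sDQ [x xQ xD]] nzQ cQ tiQ /IH[sup [h hH nz]]]].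
  have E t : jact (val i) unit_vector t = (t == val i)%:R.
    rewrite jactE; case: eqP => [->|neq].
      rewrite (bigD1 (val i)) /= ?iJ ?idem_eltK ?eqxx // ffunE eqxx big1 ?addr0 // =>
        u /andP[_ /negPf ne].
      by rewrite ffunE ne.
    rewrite big1 // => u /and3P[_ /eqP uE _]; rewrite ffunE; case: eqP => // ui.
    by case: neq; rewrite -uE ui idem_eltK.
  split; last by exists 1%g; rewrite ?group1 // E eqxx oner_eq0.
  move=> u; rewrite E; case: (u =P val i) => [-> _|]; last by rewrite eqxx.
  by exists 1%g; rewrite ?group1.
set phi := avg_prod jact l unit_vector in sup nz.
have sub P : P \subset Q -> supported (avg jact P phi) (hull ((D, Q) :: l)).
  move=> sPQ u /(supported_avg sup)[k kP ->]; exists k => //.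
  by apply: subsetP kP; rewrite /= genS // setSU.
split.
  move=> u; rewrite avg_prod_cons !ffunE => nzu.
  have [E|/(sub D sDQ)//] := eqVneq (avg jact D phi u) 0.
  by apply: (sub Q (subxx _)); move: nzu; rewrite E add0r oppr_eq0.
have Qh g : g \in Q -> g != x -> phi (val (g^-1 * (x * h))%g) = 0.
  move=> gQ neq; apply/eqP; apply: contraNT neq => /sup[k kH /val_inj E].
  have : (g^-1 * x)%g \in (Q :&: hull l)%g.
    rewrite inE groupM ?groupV //=; have -> : (g^-1 * x = k * h^-1)%g by rewrite -E mulgA mulgK.
    by rewrite groupM ?groupV.
  by rewrite tiQ => /set1P E1; rewrite -[x](mulKVg g) E1 mulg1.
exists (x * h)%g.
  by rewrite groupM ?(subsetP (joing_subl Q (hull l)) _ xQ) ?(subsetP (joing_subr Q (hull l))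
    _ hH).
rewrite avg_prod_cons !ffunE !(avg_val _ _ sup) big1 ?mulr0 => [|g gD]; last first.
  by apply: Qh; [apply: (subsetP sDQ) | apply: contraNneq xD => <-].
rewrite (bigD1 x xQ) mulKg big1 => [|g /andP[]]; last exact: Qh.
by rewrite Monoid.mulm1 sub0r oppr_eq0 mulf_neq0 ?invr_eq0.
Qed.

Lemma jact_section (l : seq ({group unit_group i} * {group unit_group i})) : independent K l ->
  exists A B, simple_section jact A B /\ exists2 v, v \in B & avg_prod jact l v \notin A.
Proof.
move=> ind; apply: idempotent_section.
- by move=> v; apply: (avg_prod_idem jact_module).
- have [_ [h _ nz]] := avg_prod_unit_vector ind.
  by apply: contra nz => /eqP E; rewrite E lfunE ffunE.
- by move=> X v; apply: avg_prod_KSmul.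
Qed.

End ContractedModule.

(** * The idempotent attached to a character *)

Section IdempotentList.
Import GRing.Theory.
Local Open Scope ring_scope.
Local Open Scope group_scope.
Variables (K : fieldType) (S : finSemigroup) (i : idem_elt S).
Local Notation gT := (unit_group i).
Variables (G N : {group gT}).
Hypotheses (sNG : N \subset G) (nN : G \subset 'N(N)).
Implicit Types (M P D Q X : {group gT}) (s : seq nat) (t : seq {group gT}).
Let A := joins (abelian_min_normals G N).
Hypothesis nzA : (#|A|%:R != 0 :> K)%R.
Variable lam : gT -> algC.
Hypothesis lin : linear_on A lam.
Variable P : {group gT} -> {group gT}.
Hypothesis hP : forall M, M \in nonabelian_min_normals G N ->
  [/\ P M \subset M, P M :!=: 1 & (#|P M|%:R != 0 :> K)%R].
Let cAA : abelian A := abelian_part_abelian G N.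

Lemma linear_ker_group_set : group_set [set x in A | lam x == 1%R].
Proof.
have [l1 lM] := lin; apply/group_setP; split; first by rewrite inE group1 l1 eqxx.
move=> x y; rewrite !inE => /andP[xA /eqP lx] /andP[yA /eqP ly].
by rewrite groupM //= lM // lx ly mulr1 eqxx.
Qed.

Definition linear_ker : {group gT} := Group linear_ker_group_set.

(** For q prime, the largest elementary abelian q-subgroup of A. *)
Definition omega (q : nat) : {group gT} := 'Ohm_1('O_q(A))%G.

Lemma omega_sub (q : nat) : omega q \subset A.
Proof. exact: subset_trans (Ohm_sub _ _) (pcore_sub _ _). Qed.

Lemma omega_pgroup (q : nat) : q.-group (omega q).
Proof. exact: pgroupS (Ohm_sub _ _) (pcore_pgroup _ _). Qed.

(** Primes at which lam is trivial are left out, since D would equal Q there and the product of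
    idempotents would be zero. *)
Definition abelian_pairs s : seq ({group gT} * {group gT}) :=
  [seq ((linear_ker :&: omega q)%G, omega q) | q <- s & ~~ (omega q \subset linear_ker)].

Definition nonabelian_pairs t : seq ({group gT} * {group gT}) := [seq (1%G, P M) | M <- t].

Lemma abelian_pairs_independent s : uniq s ->
  [/\ independent K (abelian_pairs s), hull (abelian_pairs s) \subset A &
      forall q : nat, q \notin s -> q^'.-group (hull (abelian_pairs s))].
Proof.
elim: s => [_|q s IH /= /andP[qs /IH[ind sub pi']]].
  by split=> //; [apply: sub1G | move=> q _; apply: pgroup1].
rewrite /abelian_pairs /=; case: ifP => [nsub|_]; last first.
  by split=> // q'; rewrite inE negb_or => /andP[_ /pi'].
rewrite -/(abelian_pairs s) /=.
have cen : hull (abelian_pairs s) \subset 'C(omega q).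
  by apply: subset_trans sub _; apply: sub_abelian_cent => //; apply: omega_sub.
split.
- split=> //.
  + by rewrite properE subsetIr subsetI negb_and nsub.
  + exact: sub_card_neq0 (omega_sub q) nzA.
  + apply: coprime_TIg; apply: pnat_coprime (omega_pgroup q) _; exact: pi'.
- by rewrite /hull /= join_subG omega_sub.
- move=> q'; rewrite inE negb_or => /andP[neq /pi' pi'q].
  rewrite /hull /= norm_joinEr ?(subset_trans cen) ?cent_sub // pgroupM -/(hull _) pi'q andbT.
  by apply: pi_pgroup (omega_pgroup q) _; rewrite !inE eq_sym.
Qed.

(** The groups already in the list centralize M, and a nonabelian minimal normal M meets its
    centralizer trivially. *)
Lemma pairs_independent t s : uniq s -> uniq t -> {subset t <= nonabelian_min_normals G N} ->
  independent K (nonabelian_pairs t ++ abelian_pairs s) /\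
  forall M, M \in nonabelian_min_normals G N -> M \notin t ->
    hull (nonabelian_pairs t ++ abelian_pairs s) \subset 'C(M).
Proof.
move=> us; have [indA subA _] := abelian_pairs_independent us.
elim: t => [_ _|M t IH /= /andP[Mt ut] sub].
  split=> // M Mn _; apply/centsP=> a aH x xM; apply/esym.
  by apply: (nonabelian_cent_abelian Mn xM); apply: (subsetP subA).
have Mn : M \in nonabelian_min_normals G N by apply: sub; rewrite mem_head.
have [|ind cen] := IH ut; first by move=> L Lt; apply: sub; rewrite inE Lt orbT.
have [sPM ntP nzP] := hP Mn.
have := Mn; rewrite mem_nonabelian_min_normals => /and3P[minM ncMM _].
have cM := cen M Mn Mt; split.
  split=> //.
  - by rewrite /= proper1G.
  - by apply: subset_trans cM _; apply: centS.
  have nC : G \subset 'N('C(M)) by apply: norms_cent; apply: min_normal_stable.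
  have [tiMC|] := min_normal_dichotomy (Y := 'C(M)%G) minM nC; last by move=> cMM;
    case/negP: ncMM.
  by apply/trivgP; rewrite -tiMC setISS.
move=> L Ln; rewrite inE negb_or => /andP[neq Lt].
rewrite /hull /= join_subG -/(hull _) cen // andbT (subset_trans sPM) //.
have := Ln; rewrite mem_nonabelian_min_normals => /and3P[minL _ _].
by apply/centsP=> x xM y yL; apply: (min_normal_commute minM minL) => //; rewrite eq_sym.
Qed.

Definition idempotent_list :=
  nonabelian_pairs (nonabelian_min_normals G N) ++ abelian_pairs (primes #|A|).

Lemma idempotent_list_independent : independent K idempotent_list.
Proof.
have [] := @pairs_independent (nonabelian_min_normals G N) (primes #|A|) => //.
  exact: primes_uniq.
by rewrite filter_uniq ?enum_uniq.
Qed.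

(** In the abelian case lam y is a primitive q-th root of unity, and on [omega q] lam takes only
    q-th roots of unity as values; so each element of [omega q] is a power of y times an element of
    the kernel. *)
Lemma idempotent_list_detects M : is_min_normal G M -> M \subset N ->
  ~~ abelian M \/ (exists2 y, y \in M & lam y != 1%R) ->
  exists D Q, [/\ (D, Q) \in idempotent_list, D \subset Q, (#|Q|%:R != 0 :> K)%R & Q \subset
    M * D].
Proof.
move=> minM sMN; have [cMM|ncMM _] := boolP (abelian M); last first.
  have Mn : M \in nonabelian_min_normals G N by rewrite mem_nonabelian_min_normals minM ncMM.
  have [sPM ntP nzP] := hP Mn; exists 1%G, (P M); split=> //; last by rewrite mulg1.
    by rewrite mem_cat; apply/orP; left; apply: map_f.
  exact: sub1G.
case=> // -[y yM ly]; have ntM := min_normal_nt minM.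
have sMA : M \subset A by apply: sub_joins; rewrite mem_abelian_min_normals minM cMM.
have [_ _ abM] := minnormal_solvable (proj2 (andP minM)) (subxx M) (abelian_sol cMM).
pose q := pdiv #|M|; have pr_q : prime q by rewrite pdiv_prime ?cardG_gt1.
have abqM : q.-abelem M := abM.
have sMO : M \subset omega q.
  rewrite -(Ohm1_id abqM); apply: OhmS.
  by rewrite (sub_Hall_pcore (nilpotent_pcore_Hall q (abelian_nil cAA)) sMA) (abelem_pgroup
    abqM).
have abO : q.-abelem (omega q).
  by apply: Ohm1_abelem; [apply: pcore_pgroup | apply: abelianS (pcore_sub _ _) cAA].
have [l1 lM] := lin.
have lX x n : x \in A -> lam (x ^+ n) = (lam x ^+ n)%R.
  move=> xA; elim: n => [|n IH]; first by rewrite expg0 expr0.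
  by rewrite expgS exprS lM ?groupX // IH.
have lq x : x \in omega q -> (lam x ^+ q = 1)%R.
  move=> xO; rewrite -lX ?(subsetP (omega_sub q)) //.
  by have [_ ->] := abelemP pr_q abO.
have prim_y : (q.-primitive_root (lam y))%R.
  have [m prm mq] := prim_order_exists (prime_gt0 pr_q) (lq y (subsetP sMO y yM)).
  have /primeP[_ /(_ m mq)/orP[/eqP m1|/eqP <-//]] := pr_q.
  by case/eqP: ly; rewrite -[lam y]expr1 -m1 prim_expr_order.
exists (linear_ker :&: omega q)%G, (omega q); split.
- rewrite mem_cat; apply/orP; right; apply/mapP; exists q => //.
  rewrite mem_filter mem_primes pr_q cardG_gt0 (dvdn_trans (pdiv_dvd _) (cardSg sMA)) !andbT.
  apply/subsetPn; exists y; first exact: (subsetP sMO).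
  by rewrite inE (negPf ly) andbF.
- exact: subsetIr.
- exact: sub_card_neq0 (omega_sub q) nzA.
apply/subsetP=> a aO; have [j ja] := prim_rootP prim_y (lq a aO).
apply/mulsgP; exists (y ^+ j) (y ^- j * a); rewrite ?groupX ?mulKVg //.
have aA := subsetP (omega_sub q) a aO; have yA := subsetP sMA y yM.
have wA : y ^- j * a \in A by rewrite groupM ?groupV ?groupX.
have wO : y ^- j * a \in omega q by rewrite groupM ?groupV ?groupX ?(subsetP sMO y yM).
rewrite inE wO andbT inE wA /= lM ?groupV ?groupX //.
by rewrite (linear_onV lin) ?groupX // lX // -ja mulVf ?(linear_on_neq0 lin aA).
Qed.

End IdempotentList.

(** * Direct sums of simple modules *)

Section DirectSums.
Import GRing.Theory.
Local Open Scope ring_scope.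
Variables (K : fieldType) (S : finSemigroup).

(** Only the kernel congruence of the module is recorded: direct sums become intersections, and the
    underlying spaces can be forgotten. *)
Definition realizable (k : nat) (R : S -> S -> Prop) : Prop :=
  exists (V : vectType K) (act : S -> 'End(V)),
    [/\ is_module act, semisimple act k & forall s t, act s = act t <-> R s t].

Lemma realizable0 : realizable 0 (fun _ _ => True).
Proof.
exists 'rV[K]_0, (fun=> 0); split=> //.
  by move=> s t; apply/lfunP=> v; rewrite comp_lfunE !lfunE.
exists (fun=> 0%VS); split; try by case.
  by apply/eqP; rewrite eqEsubv subvf; apply/subvP=> v _; rewrite [v]thinmx0 mem0v.
by apply/directv_sumP; case.
Qed.

Lemma semisimple_simple (V : vectType K) (act : S -> 'End(V)) :
  simple_module act -> semisimple act 1.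
Proof.
case=> _ nz max; exists (fun=> fullv); split.
- move=> _; split=> // [s|X sX _]; [exact: subvf | exact: max].
- by rewrite big_ord1.
- by apply/directvP; rewrite /= !big_ord1.
Qed.

Lemma realizable_section (V : vectType K) (act : S -> 'End(V)) A B :
  is_module act -> simple_section act A B -> realizable 1 (section_eq act A B).
Proof.
move=> mod_act [sA sB sAB maxA nz].
have [W [act' [q [simW qact qB q0]]]] := simple_factor mod_act sA sB sAB maxA nz.
exists W, act'; split; [by case: simW | exact: semisimple_simple |].
have BS s v : v \in B -> act s v \in B by move: s v; apply/submoduleP.
move=> s t; split=> [E v vB | E].
  rewrite -q0; last by rewrite memvB ?BS.
  by rewrite linearB /= !qact // E subrr.
apply/lfunP=> w; have : w \in fullv by apply: memvf.
rewrite -qB => /memv_imgP[v vB ->]; apply/eqP; rewrite -!qact // -subr_eq0 -linearB.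
by rewrite q0 ?E // memvB ?BS.
Qed.

(** Padding up to larger k. The element s0 makes K S act nontrivially on the line. *)
Lemma realizable_trivial (s0 : S) : realizable 1 (fun _ _ => True).
Proof.
exists (K^o : vectType K), (fun=> \1%VF); split=> //.
  by move=> s t; rewrite comp_lfun1l.
apply: semisimple_simple; split=> [s t||X _]; first by rewrite comp_lfun1l.
  apply/negP=> /eqP E; have : (1 : K^o) \in KSmul (S := S) (fun=> \1%VF) (fullv : {vspace K^o}).
    apply: (subvP (sumv_sup s0 isT (subvv _))).
    by rewrite -[X in X \in _](id_lfunE (1 : K^o)) memv_img ?memvf.
  by rewrite E memv0 oner_eq0.
have [->|nzX] := eqVneq X 0%VS; [by left | right; apply/eqP].
by rewrite eqEdim subvf dimvf /= lt0n dimv_eq0.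
Qed.

Section Embedding.
Variables (V V' : vectType K) (act : S -> 'End(V)) (act' : S -> 'End(V')) (j : 'Hom(V, V')).
Hypotheses (injj : lker j == 0%VS) (jact : forall s v, j (act s v) = act' s (j v)).

Lemma simple_submodule_img W : simple_submodule act W -> simple_submodule act' (j @: W)%VS.
Proof.
have ij := lker0P injj; case=> /submoduleP sW nz maxW; split.
- apply/submoduleP=> s _ /memv_imgP[v vW ->]; rewrite -jact memv_img //; exact: sW.
- apply: contra nz => nz; rewrite -subv0; apply/KSmul_sub=> s v vW.
  rewrite -subv0 in nz; move/KSmul_sub: nz => /(_ s (j v) (memv_img j vW)).
  by rewrite -jact !memv0 => /eqP jv; apply/eqP/ij; rewrite jv linear0.
move=> X /submoduleP sX sXW.
pose Y := (j @^-1: X :&: W)%VS.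
have XE : X = (j @: Y)%VS.
  apply/eqP; rewrite eqEsubv; apply/andP; split.
    apply/subvP=> x xX; have /memv_imgP[w wW xE] := subvP sXW x xX.
    by rewrite xE memv_img // memv_cap wW -memv_preim -xE xX.
  by apply/subvP=> _ /memv_imgP[v + ->]; rewrite memv_cap -memv_preim => /andP[].
rewrite XE; have [||->|->] := maxW Y; [|exact: capvSr|by left; rewrite limg0|by right].
apply/submoduleP=> s v; rewrite !memv_cap -!memv_preim => /andP[jX vW].
by rewrite jact sX ?sW.
Qed.

End Embedding.

Section Product.
Variables (V1 V2 : vectType K) (act1 : S -> 'End(V1)) (act2 : S -> 'End(V2)).
Local Notation V := (V1 * V2)%type.

Definition inl_fun (u : V1) : V := (u, 0).
Definition inr_fun (v : V2) : V := (0, v).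
Definition prod_act_fun s (w : V) : V := (act1 s w.1, act2 s w.2).

Lemma inl_fun_linear : linear inl_fun.
Proof. by move=> a u v; congr pair; rewrite /= ?scaler0 ?addr0. Qed.
Lemma inr_fun_linear : linear inr_fun.
Proof. by move=> a u v; congr pair; rewrite /= ?scaler0 ?addr0. Qed.
Lemma prod_act_fun_linear s : linear (prod_act_fun s).
Proof. by move=> a u v; congr pair; rewrite /= linearP. Qed.

HB.instance Definition _ := GRing.isLinear.Build K V1 V _ inl_fun inl_fun_linear.
HB.instance Definition _ := GRing.isLinear.Build K V2 V _ inr_fun inr_fun_linear.
HB.instance Definition _ s := GRing.isLinear.Build K V V _ (prod_act_fun s)
  (prod_act_fun_linear s).

Definition prod_act s : 'End(V) := linfun (prod_act_fun s).
Definition inlv : 'Hom(V1, V) := linfun inl_fun.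
Definition inrv : 'Hom(V2, V) := linfun inr_fun.

Lemma semisimple_prod k1 k2 : semisimple act1 k1 -> semisimple act2 k2 ->
  semisimple prod_act (k1 + k2).
Proof.
case=> W1 [sim1 sum1 /directvP d1] [W2 [sim2 sum2 /directvP d2]].
have inj1 : lker inlv == 0%VS by apply/lker0P=> u v; rewrite !lfunE => -[].
have inj2 : lker inrv == 0%VS by apply/lker0P=> u v; rewrite !lfunE => -[].
have act1E s u : inlv (act1 s u) = prod_act s (inlv u).
  by rewrite !lfunE /= /prod_act_fun /inl_fun /= linear0.
have act2E s u : inrv (act2 s u) = prod_act s (inrv u).
  by rewrite !lfunE /= /prod_act_fun /inr_fun /= linear0.
pose W (i : 'I_(k1 + k2)) := match split i with inl a => (inlv @: W1 a)%VS | inr b =>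
  (inrv @: W2 b)%VS end.
have Wl a : W (lshift k2 a) = (inlv @: W1 a)%VS by rewrite /W (unsplitK (inl a)).
have Wr b : W (rshift k1 b) = (inrv @: W2 b)%VS by rewrite /W (unsplitK (inr b)).
have sumE : (\sum_i W i)%VS = fullv.
  rewrite big_split_ord /=; under eq_bigr => a _ do rewrite Wl.
  under [X in (_ + X)%VS]eq_bigr => b _ do rewrite Wr.
  rewrite -!limg_sum sum1 sum2; apply/eqP; rewrite eqEsubv subvf; apply/subvP=> -[u v] _.
  have -> : (u, v) = inlv u + inrv v by rewrite !lfunE; congr pair; rewrite /= ?addr0 ?add0r.
  by rewrite memv_add ?memv_img ?memvf.
exists W; split=> // [i|].
  by rewrite /W; case: (split i) => a; [apply: (simple_submodule_img inj1 act1E) | apply: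
    (simple_submodule_img inj2 act2E)].
apply/directvP; rewrite /= sumE big_split_ord /=.
have dimg (U : vectType K) (h : 'Hom(U, V)) X : lker h == 0%VS -> \dim (h @: X) = \dim X.
  by move=> /eqP h0; apply: limg_dim_eq; rewrite h0 capv0.
rewrite (eq_bigr (fun a => \dim (W1 a))) => [|a _]; last by rewrite Wl dimg.
rewrite [X in (_ + X)%N](eq_bigr (fun b => \dim (W2 b))) => [|b _]; last by rewrite Wr dimg.
by move: d1 d2; rewrite /= sum1 sum2 !dimvf => <- <-.
Qed.

End Product.

Lemma realizable_add k1 k2 R1 R2 : realizable k1 R1 -> realizable k2 R2 ->
  realizable (k1 + k2) (fun s t => R1 s t /\ R2 s t).
Proof.
move=> [V1 [act1 [m1 ss1 E1]]] [V2 [act2 [m2 ss2 E2]]].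
exists ((V1 * V2)%type : vectType K), (prod_act act1 act2); split.
- move=> s t; apply/lfunP=> -[u v]; rewrite comp_lfunE !lfunE /= /prod_act_fun /=.
  by rewrite (modM m1) (modM m2).
- exact: semisimple_prod.
move=> s t; rewrite -E1 -E2; split=> [E | [F1 F2]].
  split; apply/lfunP=> v.
    by have := congr1 (fun h : 'End((V1 * V2)%type) => (h (v, 0)).1) E; rewrite /= !lfunE.
  by have := congr1 (fun h : 'End((V1 * V2)%type) => (h (0, v)).2) E; rewrite /= !lfunE.
by apply/lfunP=> -[u v]; rewrite !lfunE /= /prod_act_fun F1 F2.
Qed.

Lemma realizable_sum (I : eqType) (r : seq I) (k : I -> nat) (R : I -> S -> S -> Prop) :
  (forall i, realizable (k i) (R i)) ->
  exists2 Q, realizable (\sum_(i <- r) k i) Q & forall s t, Q s t -> forall i, i \in r -> R i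
    s t.
Proof.
move=> kR; elim: r => [|i r [Q kQ QP]].
  by exists (fun _ _ => True); rewrite ?big_nil //; apply: realizable0.
exists (fun s t => R i s t /\ Q s t); first by rewrite big_cons; apply: realizable_add.
by move=> s t [Rst /QP H] j; rewrite inE => /orP[/eqP->|/H].
Qed.

Lemma realizable_pad (s0 : S) k d Q : realizable k Q ->
  exists2 Q', realizable (k + d) Q' & forall s t, Q' s t -> Q s t.
Proof.
move=> kQ; elim: d => [|d [Q' kQ' QP]]; first by exists Q; rewrite ?addn0.
exists (fun s t => Q' s t /\ True); last by move=> s t [/QP].
by rewrite addnS -addn1; apply: realizable_add => //; apply: realizable_trivial s0.
Qed.

End DirectSums.

(** * Construction of the faithful module *)

Section SufficientConditions.
Import GRing.Theory.
Local Open Scope ring_scope.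
Variables (K : fieldType) (S : finSemigroup) (e : regJ S -> idem_elt S).
Hypothesis he : forall J, val (e J) \in val J.
Variables (p : nat) (hp : has_char K p).

Section OneClass.
Variable J : regJ S.
Let G := maxsubgroup e J.
Let N := NJ_group e J.
Let f := val (e J).
Let ff : f ** f = f := idem_eltK (e J).
Hypothesis pA : ~~ (p %| #|abelian_socle G :&: NJ e J|)%N.
Hypothesis irr : ~~ reducible J.

Lemma detecting_lists : (0 < kJ e J)%N /\
  exists L : 'I_(kJ e J) -> seq ({group unit_group (e J)} * {group unit_group (e J)}),
    (forall d, independent K (L d)) /\
    forall M : {group unit_group (e J)}, is_min_normal G M -> M \subset N ->
      exists d D Q, [/\ (D, Q) \in L d, D \subset Q, #|Q|%:R != 0 :> K & (Q \subset M * D)%g].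
Proof.
rewrite /kJ (negPf irr); case: ifP => [/eqP N1|/negbT/eqP ntN].
  (* The product for the empty list is [act f], so it yields a factor on which e_J is nonzero; there
     is no M to detect. *)
  split=> //; exists (fun=> [::]); split=> // M minM sMN.
  by case/negP: (min_normal_nt minM); rewrite -subG1 -N1.
have [nG sNG] : (G \subset 'N(N))%g /\ (N \subset G)%g by case/andP: (NJ_normal e J).
have gt0 : (0 < min_normal_gens G (normal_socle G :&: N)%G)%N.
  by apply: (min_normal_gens_gt0 sNG nG); apply/eqP.
split; first exact: gt0.
have [lam [lin cog]] := min_normal_gens_cogens sNG nG.
pose A := joins (abelian_min_normals G N).
have nzA : #|A|%:R != 0 :> K.
  have sAA : A \subset (abelian_socle G :&: N)%G.
    rewrite subsetI (abelian_part_sub G N) andbT joins_sub; apply/allP=> M.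
    rewrite mem_abelian_min_normals => /and3P[minM cMM _].
    by apply/sub_gen/bigcup_sup; rewrite minM.
  by rewrite -(has_char_dvd _ hp); apply: contra pA => /dvdn_trans; apply; apply: cardSg sAA.
(* P M is generated by an element of prime order invertible in K; without one, M would be an abelian
   p-group. *)
have exP (M : {group unit_group (e J)}) : exists P : {group unit_group (e J)},
    M \in nonabelian_min_normals G N -> [/\ P \subset M, P :!=: 1%g & #|P|%:R != 0 :> K].
  have [Mn|_] := boolP (M \in nonabelian_min_normals G N); last by exists 1%G.
  have := Mn; rewrite mem_nonabelian_min_normals => /and3P[minM ncMM _].
  apply: NNPP => none; case/negP: ncMM; have [|//] := min_normal_char_group hp minM.
  move=> x xM pr_x; apply/eqP/negPn/negP=> nzx; apply: none; exists <[x]>%G => _.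
  by split=> //; rewrite ?cycle_subG // cycle_eq1 -order_eq1; case: eqP pr_x => // ->.
have [P PP] := fin_all_exists exP.
exists (fun d => idempotent_list (lin d) P); split=> [d|M minM sMN].
  exact: (idempotent_list_independent nzA (lin d) PP).
have detect d := idempotent_list_detects nzA (lin d) PP minM sMN.
have [cMM|ncMM] := boolP (abelian M); last by exists (Ordinal gt0); apply: detect; left.
suff [d [y yM ly]] : exists d, exists2 y, y \in M & lam d y != 1.
  by exists d; apply: detect; right; exists y.
apply: NNPP => none; case/eqP: (min_normal_nt minM).
apply: cog (min_normal_stable minM) _ _ => [|d y yM].
  by apply: sub_joins; rewrite mem_abelian_min_normals minM cMM.
by apply/eqP/negPn/negP=> ly; apply: none; exists d; exists y.
Qed.

(** One factor per list, each keeping its idempotent nonzero. [congJ_of_units] is applied to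
    congruence below J together with equal action on these factors. *)
Lemma class_realizable : exists2 R, realizable K (kJ e J) R &
  forall s t, R s t -> cong_below J s t -> congJ J s t.
Proof.
have [k_gt0 [L [indL detL]]] := detecting_lists.
pose act := jact K J; have mod_act : is_module act := jact_module K J.
have exAB (d : 'I_(kJ e J)) : exists AB : {vspace {ffun S -> K^o}} * {vspace {ffun S -> K^o}},
    simple_section act AB.1 AB.2 /\ exists2 v, v \in AB.2 & avg_prod act (L d) v \notin AB.1.
  by have [A [B H]] := jact_section (he J) (indL d); exists (A, B).
have [AB ABP] := fin_all_exists exAB.
have real d : realizable K 1 (section_eq act (AB d).1 (AB d).2).
  by apply: realizable_section => //; case: (ABP d).
have [R kR RP] := realizable_sum (index_enum 'I_(kJ e J)) real.
exists R; first by move: kR; rewrite sum1_card card_ord.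
move=> s t Rst /cong_belowP st.
have {RP} Rst d : section_eq act (AB d).1 (AB d).2 s t.
  exact: (RP s t Rst d (mem_index_enum d)).
have secmul d u v x y : section_eq act (AB d).1 (AB d).2 u v ->
    section_eq act (AB d).1 (AB d).2 x y -> section_eq act (AB d).1 (AB d).2 (u ** x) (v ** y).
  have [[sA sB _ _ _] _] := ABP d; move/submoduleP: sA => sA; move/submoduleP: sB => sB.
  move=> uv xy w wB; rewrite !(modM mod_act).
  have -> : act u (act x w) - act v (act y w) =
      act u (act x w - act y w) + (act u (act y w) - act v (act y w)).
    by rewrite linearB /= addrA subrK.
  by rewrite memvD ?sA ?xy ?uv ?sB.
have sec_refl d u : section_eq act (AB d).1 (AB d).2 u u.
  by move=> v _; rewrite subrr mem0v.
have sec_sym d u v : section_eq act (AB d).1 (AB d).2 u v -> section_eq act (AB d).1 (AB d).2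
  v u.
  by move=> uv w wB; rewrite -opprB rpredN uv.
pose R' u v := cong_below J u v /\ forall d, section_eq act (AB d).1 (AB d).2 u v.
apply: (congJ_of_units (he J) (R := R')); last by split=> //; apply/cong_belowP.
- by move=> u v [/cong_below_sym uv H]; split=> // d; apply/sec_sym.
- by move=> x u v [uv H]; split=> [|d]; [apply: cong_below_mull | apply: secmul].
- by move=> x u v [uv H]; split=> [|d]; [apply: cong_below_mulr | apply: secmul].
- move=> h fh hf [_ sech]; apply/negPn/negP=> hJ; pose d := Ordinal k_gt0.
  have [[sA sB _ _ _] [v vB]] := ABP d; case/negP.
  have h0 : act h = 0.
    by apply: jact_below => //; rewrite (ideal1_regJ _ (he J)) -/f -fh divs_mulr.
  rewrite -avg_prod_act_idem //; apply: avg_prod_sub => //.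
  by have := sech d v vB; rewrite h0 lfunE sub0r rpredN.
move=> g [gN secg].
pose inY (x : unit_group (e J)) := [forall d, (act (val x) - act f) @: (AB d).2 <= (AB d).1]%VS.
have inYP x : reflect (forall d, section_eq act (AB d).1 (AB d).2 (val x) f) (inY x).
  apply: (iffP forallP) => H d.
    by move=> v vB; have := subvP (H d) _ (memv_img _ vB); rewrite add_lfunE opp_lfunE.
  by apply/subvP=> _ /memv_imgP[v vB ->]; rewrite add_lfunE opp_lfunE H.
(* The elements of N acting trivially on all the factors form a normal subgroup Y. A minimal normal
   subgroup inside Y would be detected by some list, which would make its idempotent vanish on the
   corresponding factor. *)
have gY : group_set [set x in N | inY x].
  apply/group_setP; split.
    by apply/setIdP; split; [apply: group1 | apply/inYP=> d; apply: sec_refl].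
  move=> x y /setIdP[xN /inYP xY] /setIdP[yN /inYP yY].
  apply/setIdP; split; [exact: groupM | apply/inYP=> d].
  by rewrite unit_valM -[f in section_eq _ _ _ _ f]ff; apply: secmul.
pose Y := Group gY.
have sYN : Y \subset N by apply/subsetP=> x /setIdP[].
have nY : (G \subset 'N(Y))%g.
  apply/subsetP=> z zG; rewrite inE; apply/subsetP=> _ /imsetP[x + ->].
  move=> /setIdP[xN /inYP xY]; apply/setIdP; split.
    by rewrite memJ_norm //; apply: subsetP zG; case/andP: (NJ_normal e J).
  apply/inYP=> d; rewrite conjgE mulgA !unit_valM.
  have <- : val (z^-1)%g ** f ** val z = f.
    have [_ ->] := unit_mem_local (z^-1)%g.
    by rewrite -unit_valM mulVg.
  by apply: (secmul) => //; apply: (secmul).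
apply/set1P; rewrite -[[set 1%g]]/(1%g : {set _}); suff <- : Y :=: 1%g.
  by apply/setIdP; split; [rewrite inE | apply/inYP].
apply/eqP/negPn/negP=> ntY; have [M minM sMY] := min_normal_below (subsetT Y) nY ntY.
have [d [D [Q [lDQ sDQ nzQ QMD]]]] := detL M minM (subset_trans sMY sYN).
have [[sA sB _ _ _] [v vB]] := ABP d; case/negP.
apply: (avg_prod_section_eq0 mod_act sA sB lDQ sDQ nzQ QMD _ vB) => x xM.
by have /setIdP[_ /inYP] := subsetP sMY x xM.
Qed.

End OneClass.

Lemma sufficient_condition (k : nat) : (#|S| = 0 -> k = 0)%N ->
  (forall s t : S, congGGM s t <-> s = t) ->
  (forall J, ~~ reducible J -> ~~ (p %| #|abelian_socle (maxsubgroup e J) :&: NJ e J|)%N) ->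
  (\sum_(J : regJ S) kJ e J <= k)%N -> has_faithful_semisimple K S k.
Proof.
move=> hS GGM pA lek.
have real J : exists R : S -> S -> Prop, realizable K (kJ e J) R /\
    forall s t, R s t -> cong_below J s t -> congJ J s t.
  have [red|irr] := boolP (reducible J).
    exists (fun _ _ => True); split; first by rewrite /kJ red; apply: realizable0.
    by move=> s t _; move: red => /forallP/(_ s)/forallP/(_ t)/implyP.
  by have [R kR RP] := class_realizable (pA J irr) irr; exists R.
have [R RP] := fin_all_exists real.
have [Q kQ QP] := realizable_sum (index_enum (regJ S)) (fun J => proj1 (RP J)).
have Qeq s t : Q s t -> s = t.
  (* Induction up the J-order turns the relative statements, modulo the classes below, into [congJ]
     for every J. *)
  move=> Qst; apply/GGM/forallP; apply: Jlt_ind => J IH.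
  have [_ H] := RP J; apply: H; first exact: (QP s t Qst J (mem_index_enum J)).
  exact/cong_belowP.
have [Q' kQ' QP'] : exists2 Q', realizable K k Q' & forall s t, Q' s t -> Q s t.
  (* Padding takes an element of S; for the empty semigroup hS leaves nothing to pad. *)
  have [/card0_eq S0|] := posnP #|S|; last first.
    by case/card_gt0P=> s0 _; rewrite -(subnKC lek); apply: realizable_pad.
  exists Q => //; move: kQ; have k0 : k = 0%N by apply: hS; apply: eq_card0.
  by move: lek; rewrite k0 leqn0 => /eqP->.
have [V [act [mod_act ss E]]] := kQ'; exists V, act; split=> // s t.
by move=> /E/QP'/Qeq.
Qed.

End SufficientConditions.

(* hS concerns only the empty semigroup: it has no simple module, so for it
   (1) and (2) force k = 0, while (3) holds for every k. *)
Theorem theorem3p9 (K : fieldType) (p : nat) (hp : has_char K p)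
    (S : finSemigroup) (e : regJ S -> idem_elt S)
    (he : forall J : regJ S, val (e J) \in val J)
    (k : nat) (hS : #|S| = 0 -> k = 0) :
  let cond1 := has_faithful_semisimple K S k in
  let cond2 :=
    (exists j : nat, has_faithful_semisimple K S j) /\
    has_faithful_with_simple_factors K S k in
  let cond3 :=
    [/\ forall s t : S, congGGM s t <-> s = t,
        forall J : regJ S, ~~ reducible J ->
          ~~ (p %| #|abelian_socle (maxsubgroup e J) :&: NJ e J|)%N &
        (\sum_(J : regJ S) kJ e J <= k)%N] in
  (cond1 <-> cond2) /\ (cond2 <-> cond3).
Proof.
move=> cond1 cond2 cond3.
have H12 : cond1 -> cond2.
  case=> V [act [mod_act inj_act ss]]; split; first by exists k, V, act.
  by exists V, act; split=> //; apply: semisimple_series.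
have H23 : cond2 -> cond3.
  case=> -[j [V0 [act0 [mod0 inj0 ss0]]]] [V [act [mod_act inj_act [n [c [ser kE]]]]]].
  have pA J := NJ_trivial_char mod0 inj0 he J hp ss0.
  split=> [s t|J _|]; [split=> [|->] | exact: pA | rewrite -kE;
    exact: (sum_kJ_le mod_act inj_act ser he hp pA)].
    exact: (semisimple_congGGM mod0 inj0 ss0).
  by apply/forallP=> J; apply: congJ_refl.
have H31 : cond3 -> cond1 by case=> GGM pA lek; apply: (sufficient_condition he hp hS GGM pA
  lek).
by split; split=> //; [move/H23; apply: H31 | move/H31; apply: H12].
Qed.
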